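(* Let $f:\mathbf{C}\mathrm{P}^1\to\mathrm{Gr}_n(\mathbf{R}^{n+2})$ be a totally real, full, Einstein-Hermitian minimal immersion of degree $0$ and EH-constant $l$. Then $n=4l$ and $f$ is image-equivalent to the standard map.
   Context: $\mathrm{Gr}_n(\mathbf{R}^{n+2})$ is the Grassmannian of oriented $n$-planes of Euclidean $\mathbf{R}^{n+2}$ (complex hyperquadric), with tautological bundle $S$ and universal quotient bundle $Q\cong S^\perp$, an oriented rank 2 bundle with fibre metric and hence complex structure; maps differing by the orientation-reversing isometry of the Grassmannian are not distinguished. With $i_S,i_Q$ the inclusions into the trivial bundle and $\pi_S,\pi_Q$ the orthogonal projections, $\nabla^Q=\pi_Q\,d\,i_Q$ is the canonical connection, $K=\pi_S\,d\,i_Q$, $H=\pi_Q\,d\,i_S$. The tangent bundle is $S^*\otimes Q$ with induced metric; the quadric is Kähler with fundamental form $\omega_Q$. For $f:M\to\mathrm{Gr}_n(\mathbf{R}^{n+2})$, $V=f^{-1}Q$ carries the pulled-back structures; the mean curvature operator is $A=\sum_iH_{e_i}K_{e_i}$ ($\{e_i\}$ an orthonormal frame), $e(f)=|df|^2=-\mathrm{Tr}\,A$, and $f$ is Einstein-Hermitian (EH) if $A=-\mu\,\mathrm{id}_V$ for a constant $\mu\ge0$. $f$ is full if the map $\mathbf{R}^{n+2}\to\Gamma(V)$, $t\mapsto\pi_V(t)$, is injective. $f$ is totally real if $f^*\omega_Q=0$. Immersions are isometric up to homothety. $\mathbf{C}\mathrm{P}^1=\mathrm{SU}(2)/\mathrm{U}(1)$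 has the Fubini-Study metric of area $1$. The degree of $f$ is the $k$ with $V\cong\mathcal{O}(k)$ as complex line bundles. For an EH harmonic map of degree $k$ and constant Kähler angle (equivalently, $V\cong\mathcal{O}(k)$ with metrics and canonical connections preserved; for $k=0$ this is the totally real condition) the EH-constant is the integer $l\ge0$ with $e(f)=4\pi\{2l(|k|+l+1)+|k|\}$; thus for $k=0$, $e(f)=8\pi l(l+1)$. Standard map (degree $0$, EH-constant $l$): let $S^{2l}\mathbf{C}^2=\mathbf{C}_{2l}\oplus\mathbf{C}_{2l-2}\oplus\cdots\oplus\mathbf{C}_0\oplus\cdots\oplus\mathbf{C}_{-2l}$ be the $\mathrm{U}(1)$-weight decomposition of the eigenspace $S^{2l}\mathbf{C}^2\subset\Gamma(\mathcal{O}(0))$, regarded as Euclidean $\mathbf{R}^{4l+2}$; the standard map is $f_0([g])=g\,\mathbf{C}_0^\perp$, i.e. $f_0([g])=\{t:t([g])=0\}$. Two maps $f_1,f_2$ into $\mathrm{Gr}_n(\mathbf{R}^{n+2})$ are image-equivalent if there is an isometry $\psi$ of $\mathrm{Gr}_n(\mathbf{R}^{n+2})$ with $f_2=\psi\circ f_1$. *)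

(* Defs.v *)
From HB Require Import structures.
From mathcomp Require Import all_boot all_order all_algebra.
From mathcomp Require Import all_classical all_reals all_analysis.
From mathcomp Require Import complex.
From mathcomp Require Import zify ring.

Set Implicit Arguments.
Unset Strict Implicit.
Unset Printing Implicit Defensive.

Import Order.TTheory GRing.Theory Num.Theory.
Import numFieldNormedType.Exports.

Local Open Scope classical_set_scope.
Local Open Scope ring_scope.
Local Open Scope complex_scope.

(** * Smooth maps *)

(* C^k on an open set D, for finite-dimensional U: all directional derivatives
   up to order k exist and are continuous. *)
Fixpoint Ck (R : realType) (U V : normedModType R) (D : set U) (k : nat)
    (F : U -> V) : Prop :=
  if k is k'.+1 then
    (forall x, D x -> differentiable F x) /\
    (forall v, Ck D k' (fun x => 'D_v F x))
  else forall x, D x -> {for x, continuous F}.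

Definition smooth_on (R : realType) (U V : normedModType R) (D : set U)
    (F : U -> V) : Prop := forall k, Ck D k F.

(** * The Grassmannian of oriented n-planes of R^(n+2) *)

Definition dot (R : realType) (m : nat) (u v : 'cV[R]_m) : R := (u^T *m v) 0 0.

Definition orthonormal2 (R : realType) (m : nat) (e1 e2 : 'cV[R]_m) : Prop :=
  [/\ dot e1 e1 = 1, dot e2 e2 = 1 & dot e1 e2 = 0].

(* The rotation by a quarter turn, e1 |-> e2 |-> - e1, in the plane of e1, e2,
   extended by 0 on the orthogonal complement. *)
Definition quarter_turn (R : realType) (m : nat) (e1 e2 : 'cV[R]_m) : 'M[R]_m :=
  e2 *m e1^T - e1 *m e2^T.

(* An oriented n-plane S of the oriented space R^(n+2) is the same thing as the
   oriented 2-plane Q = S^perp.  The latter is encoded by its quarter turn,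
   which two oriented orthonormal frames share iff they span the same oriented
   2-plane.  This realizes Gr_n(R^(n+2)) as a compact submanifold of the space
   of matrices; on the fibre Q the matrix is the complex structure given by the
   orientation and the fibre metric.  Reversing the orientation is J |-> - J. *)
Record Gr (R : realType) (n : nat) := MkGr {
  Jmx :> 'M[R]_n.+2 ;
  _ : exists e1 e2 : 'cV[R]_n.+2, orthonormal2 e1 e2 /\ Jmx = quarter_turn e1 e2
}.

Definition oriented_span (R : realType) (n : nat) (e1 e2 : 'cV[R]_n.+2)
    (h : orthonormal2 e1 e2) : Gr R n :=
  MkGr (ex_intro _ e1 (ex_intro _ e2 (conj h erefl))).

Definition piQ (R : realType) (n : nat) (J : Gr R n) : 'M[R]_n.+2 :=
  - (Jmx J *m Jmx J).
Definition piS (R : realType) (n : nat) (J : Gr R n) : 'M[R]_n.+2 :=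
  1%:M - piQ J.

Lemma piQE (R : realType) (n : nat) (e1 e2 : 'cV[R]_n.+2)
    (h : orthonormal2 e1 e2) :
  piQ (oriented_span h) = e1 *m e1^T + e2 *m e2^T.
Proof.
have E (u v : 'cV[R]_n.+2) : u^T *m v = (dot u v)%:M by rewrite [LHS]mx11_scalar.
have dotC (u v : 'cV[R]_n.+2) : dot u v = dot v u.
  by rewrite /dot !mxE; apply: eq_bigr => k _; rewrite !mxE mulrC.
case: (h) => h1 h2 h3; have h4 : dot e2 e1 = 0 by rewrite dotC.
rewrite /piQ /= /quarter_turn mulmxBl !mulmxBr !mulmxA.
rewrite -!(mulmxA _ e1^T) -!(mulmxA _ e2^T) !E h1 h2 h3 h4.
by rewrite !mul_mx_scalar !scale0r !scale1r !mul0mx sub0r subr0 -opprD opprK addrC.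
Qed.

(* Hom(S, Q) = S^* (x) Q is represented by the matrices B with
   B = piQ *m B *m piS.  Its induced inner product. *)
Definition hom_dot (R : realType) (m : nat) (A B : 'M[R]_m) : R := \tr (A^T *m B).

(* For a smooth family F of oriented planes over U, a tangent vector v at z:
   H_v = piQ o d_v o i_S and K_v = piS o d_v o i_Q are tensorial, and are
   evaluated on the sections x |-> piS (F x) t of S, resp. x |-> piQ (F x) t of
   Q (t constant); both are extended by 0 to R^(n+2).  H_v is also the
   differential dF(v), as an element of the tangent space Hom(S, Q). *)
Section FundamentalForms.
Variables (R : realType) (n : nat) (U : normedModType R) (F : U -> Gr R n).

Definition Hform (z v : U) : 'M[R]_n.+2 :=
  piQ (F z) *m 'D_v (fun x => piS (F x)) z *m piS (F z).

Definition Kform (z v : U) : 'M[R]_n.+2 :=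
  piS (F z) *m 'D_v (fun x => piQ (F x)) z *m piQ (F z).

End FundamentalForms.

Definition smooth_family (R : realType) (n : nat) (U : normedModType R)
    (F : U -> Gr R n) : Prop :=
  smooth_on setT (fun z => Jmx (F z)).

(* Smooth self-maps of the submanifold Gr: locally restrictions of smooth maps
   of the ambient space of matrices. *)
Definition smooth_Gr (R : realType) (n : nat) (psi : Gr R n -> Gr R n) : Prop :=
  forall J : Gr R n, exists (D : set 'M[R]_n.+2) (Psi : 'M[R]_n.+2 -> 'M[R]_n.+2),
    [/\ open D, D (Jmx J), smooth_on D Psi &
        forall J' : Gr R n, D (Jmx J') -> Psi (Jmx J') = Jmx (psi J')].

(* psi^* g = g; tangent vectors are velocities of curves. *)
Definition preserves_metric (R : realType) (n : nat) (psi : Gr R n -> Gr R n)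
    : Prop :=
  forall g1 g2 : R^o -> Gr R n, smooth_family g1 -> smooth_family g2 ->
    g1 0 = g2 0 ->
    hom_dot (Hform (psi \o g1) 0 1) (Hform (psi \o g2) 0 1) =
    hom_dot (Hform g1 0 1) (Hform g2 0 1).

Definition isometry_Gr (R : realType) (n : nat) (psi : Gr R n -> Gr R n) : Prop :=
  [/\ exists phi : Gr R n -> Gr R n,
        [/\ cancel psi phi, cancel phi psi & smooth_Gr phi],
      smooth_Gr psi & preserves_metric psi].

(** * The complex projective line with the Fubini-Study metric of area 1 *)

Definition CP1 (R : realType) : Type :=
  {L : {vspace 'cV[R[i]]_2} | \dim L == 1%N}.

Lemma dim_line (R : realType) (v : 'cV[R[i]]_2) : v != 0 -> \dim <[v]>%VS == 1%N.
Proof. by move=> v0; rewrite dim_vline v0. Qed.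

Definition line (R : realType) (v : 'cV[R[i]]_2) (v0 : v != 0) : CP1 R :=
  exist _ <[v]>%VS (dim_line v0).

(* Affine chart with parameter z = z_0 + i z_1 and c-th homogeneous coordinate
   equal to 1. *)
Definition affine (R : realType) (c : 'I_2) (z : 'rV[R]_2) : 'cV[R[i]]_2 :=
  \col_(j < 2) (if j == c then 1 else z 0 0 +i* z 0 1).

Lemma affine_neq0 (R : realType) (c : 'I_2) (z : 'rV[R]_2) : affine c z != 0.
Proof.
apply/eqP => /matrixP /(_ c 0); rewrite !mxE eqxx; apply/eqP; exact: oner_neq0.
Qed.

Definition chart (R : realType) (c : 'I_2) (z : 'rV[R]_2) : CP1 R :=
  line (affine_neq0 c z).

(* In either chart the metric is |dz|^2 / (pi (1 + |z|^2)^2). *)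
Definition FS (R : realType) (z : 'rV[R]_2) : 'M[R]_2 :=
  ((pi * (1 + z 0 0 ^+ 2 + z 0 1 ^+ 2) ^+ 2)^-1)%:M.

Definition FS_dot (R : realType) (z u v : 'rV[R]_2) : R :=
  (u *m FS z *m v^T) 0 0.

Definition dz (R : realType) (i : 'I_2) : 'rV[R]_2 := delta_mx 0 i.

Definition FS_frame (R : realType) (z : 'rV[R]_2) (i : 'I_2) : 'rV[R]_2 :=
  (Num.sqrt pi * (1 + z 0 0 ^+ 2 + z 0 1 ^+ 2)) *: dz R i.

Lemma FS_frame_orthonormal (R : realType) (z : 'rV[R]_2) (i j : 'I_2) :
  FS_dot z (FS_frame z i) (FS_frame z j) = (i == j)%:R.
Proof.
rewrite /FS_dot /FS_frame /FS mul_mx_scalar [(_ *: dz R j)^T]linearZ /=.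
rewrite -!scalemxAl -scalemxAr [(dz R j)^T]trmx_delta mul_delta_mx_cond.
rewrite [LHS]mxE [X in _ * X]mxE [X in _ * (_ * X)]mxE.
set q := 1 + _ + _; have q0 : q != 0.
  by rewrite gt_eqF // /q -addrA ltr_pwDl // addr_ge0 // sqr_ge0.
have p0 : (pi : R) != 0 by rewrite gt_eqF // pi_gt0.
have -> : (pi : R) = Num.sqrt pi ^+ 2 by rewrite sqr_sqrtr // pi_ge0.
rewrite sqrtr_sqr ger0_norm ?sqrtr_ge0 //.
have s0 : Num.sqrt (pi : R) != 0 by rewrite gt_eqF // sqrtr_gt0 pi_gt0.
rewrite [X in _ * X]mulrA -expr2 -exprMn mulKf ?expf_neq0 ?mulf_neq0 //.
by rewrite mulmxnE mxE.
Qed.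

Definition christoffel (R : realType) (z : 'rV[R]_2) (k i j : 'I_2) : R :=
  2^-1 * \sum_(m < 2) invmx (FS z) k m *
    ('D_(dz R i) (fun x => FS x j m : R^o) z
     + 'D_(dz R j) (fun x => FS x i m : R^o) z
     - 'D_(dz R m) (fun x => FS x i j : R^o) z).

(* Levi-Civita derivative nabla_u v of the vector field with constant
   coefficients v in the coordinates of a chart. *)
Definition LC (R : realType) (z u v : 'rV[R]_2) : 'rV[R]_2 :=
  \row_k \sum_(i < 2) \sum_(j < 2) u 0 i * v 0 j * christoffel z k i j.

(** * Maps from CP^1 into the Grassmannian *)

Section Maps.
Variables (R : realType) (n : nat).
Implicit Type f : CP1 R -> Gr R n.

Definition local f (c : 'I_2) : 'rV[R]_2 -> Gr R n := fun z => f (chart c z).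

Definition smooth_map f : Prop := forall c, smooth_family (local f c).

Definition homothetic_immersion f : Prop :=
  exists2 a : R, 0 < a & forall c z u v,
    hom_dot (Hform (local f c) z u) (Hform (local f c) z v) = a * FS_dot z u v.

(* (nabla df)(u, v).  The Levi-Civita connection on the tangent bundle Hom(S, Q)
   is induced by the canonical connections piS d i_S and piQ d i_Q, so it maps a
   section B, with B = piQ *m B *m piS, to piQ *m dB *m piS. *)
Definition second_fundamental_form (F : 'rV[R]_2 -> Gr R n) (z u v : 'rV[R]_2)
    : 'M[R]_n.+2 :=
  piQ (F z) *m 'D_u (fun x => Hform F x v) z *m piS (F z) - Hform F z (LC z u v).

(* For an immersion which is isometric up to homothety this trace is a positive
   multiple of the mean curvature vector. *)
Definition minimal f : Prop := forall c z,
  \sum_(i < 2)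
     second_fundamental_form (local f c) z (FS_frame z i) (FS_frame z i) = 0.

Definition minimal_immersion f : Prop :=
  [/\ smooth_map f, homothetic_immersion f & minimal f].

(* f^* omega_Q = 0, with omega_Q (X, Y) = <J X, Y> on Hom(S, Q). *)
Definition totally_real f : Prop := forall c z u v,
  hom_dot (Jmx (local f c z) *m Hform (local f c) z u)
          (Hform (local f c) z v) = 0.

Definition full f : Prop :=
  injective (fun (t : 'cV[R]_n.+2) (p : CP1 R) => piQ (f p) *m t).

Definition mean_curvature_operator f c z : 'M[R]_n.+2 :=
  \sum_(i < 2) Hform (local f c) z (FS_frame z i) *m
               Kform (local f c) z (FS_frame z i).

Definition in_V f (p : CP1 R) (t : 'cV[R]_n.+2) : Prop := piQ (f p) *m t = t.

Definition Einstein_Hermitian f : Prop :=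
  exists2 mu : R, 0 <= mu & forall c z t, in_V f (chart c z) t ->
    mean_curvature_operator f c z *m t = - (mu *: t).

Definition energy_density f c z : R :=
  \sum_(i < 2) hom_dot (Hform (local f c) z (FS_frame z i))
                       (Hform (local f c) z (FS_frame z i)).

Definition EH_constant f (k : int) (l : nat) : Prop := forall c z,
  energy_density f c z = 4 * pi * (2 * l * (`|k| + l + 1) + `|k|)%N%:R.

(* Multiplication by a complex scalar on the complex line V_p. *)
Definition complex_smul f (p : CP1 R) (a : R[i]) (t : 'cV[R]_n.+2) : 'cV[R]_n.+2 :=
  complex.Re a *: t + complex.Im a *: (Jmx (f p) *m t).

(* V is isomorphic to O(k).  The fibre of O(-1) over a line is that line, so an
   isomorphism O(k) -> V is a map s on C^2 - {0}, with s v a nonzero element of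
   V over [v] (the image of the (-k)-th tensor power of v), homogeneous of
   degree - k. *)
Definition has_degree f (k : int) : Prop :=
  exists s : 'cV[R[i]]_2 -> 'cV[R]_n.+2,
    [/\ forall v (v0 : v != 0), in_V f (line v0) (s v) /\ s v != 0,
        forall (a : R[i]) v (v0 : v != 0), a != 0 ->
          s (a *: v) = complex_smul f (line v0) (a ^ (- k)) (s v) &
        forall c, smooth_on setT (fun z => s (affine c z))].

Definition image_equivalent f1 f2 : Prop :=
  exists psi : Gr R n -> Gr R n, isometry_Gr psi /\ f2 = psi \o f1.

End Maps.

(** * The standard map *)

Section Standard.
Variables (R : realType) (l : nat).

(* A vector of S^(2l) C^2 is a binary form in the basis x, y of C^2, and is
   given by the polynomial p obtained by x := 1, y := 'X, that is, by
   sum_j p_j x^(2l - j) y^j.  For the invariant Hermitian product the monomials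
   are orthogonal and |x^(2l - j) y^j|^2 = 1 / 'C(2l, j).  These are the
   coordinates of the underlying real vector in the orthonormal basis
   ..., b_j, i b_j, ... where b_j = sqrt 'C(2l, j) x^(2l - j) y^j. *)
Definition real_coords (p : {poly R[i]}) : 'cV[R]_(4 * l).+2 :=
  \col_(k < (4 * l).+2)
    ((if odd k then complex.Im p`_(k./2) else complex.Re p`_(k./2))
     / Num.sqrt ('C(2 * l, k./2)%:R)).

Definition SU2 : set 'M[R[i]]_2 :=
  [set g | (map_mx (@conjc R) g)^T *m g = 1%:M /\ \det g = 1].

(* g . (x^l y^l), which spans g C_0. *)
Definition weight0 (g : 'M[R[i]]_2) : {poly R[i]} :=
  ((g 0 0)%:P + g 1 0 *: 'X) ^+ l * ((g 0 1)%:P + g 1 1 *: 'X) ^+ l.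

Definition normalize (m : nat) (u : 'cV[R]_m) : 'cV[R]_m :=
  (Num.sqrt (dot u u))^-1 *: u.

Definition frame1 (g : 'M[R[i]]_2) : 'cV[R]_(4 * l).+2 :=
  normalize (real_coords (weight0 g)).
Definition frame2 (g : 'M[R[i]]_2) : 'cV[R]_(4 * l).+2 :=
  normalize (real_coords ('i *: weight0 g)).

(* An element g of SU(2) with [g] = g <[e_0]> equal to the line L. *)
Definition SU2_of_line (L : CP1 R) : 'M[R[i]]_2 :=
  let v := vpick (val L) in
  let r := (Num.sqrt (complex.Re (v 0 0) ^+ 2 + complex.Im (v 0 0) ^+ 2
                      + complex.Re (v 1 0) ^+ 2 + complex.Im (v 1 0) ^+ 2))^-1 in
  \matrix_(i < 2, j < 2) (r%:C *
    (if j == 0 then v i 0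
     else if i == 0 then - (conjc (v 1 0)) else (conjc (v 0 0)))).


Lemma det2 (g : 'M[R[i]]_2) : \det g = g 0 0 * g 1 1 - g 0 1 * g 1 0.
Proof.
rewrite (expand_det_row _ 0) !big_ord_recl big_ord0 addr0 /cofactor !det_mx11 !mxE.
rewrite /= expr0 expr1 mul1r mulN1r mulrN.
by congr (_ * g _ _ - g _ _ * g _ _); apply/val_inj.
Qed.

Lemma SU2_of_lineP (L : CP1 R) :
  SU2 (SU2_of_line L) /\ <[(col 0 (SU2_of_line L))%R]>%VS = val L.
Proof.
rewrite /SU2_of_line; set v := vpick _; set r := _^-1; cbv zeta.
have vL : val L = <[v]>%VS.
  apply/esym/eqP; rewrite eqEdim -memvE memv_pick (eqP (valP L)) dim_vline.
  rewrite vpick0 -dimv_eq0 (eqP (valP L)); by [].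
have v0 : v != 0 by rewrite vpick0 -dimv_eq0 (eqP (valP L)).
have vE : forall i, v i 0 = if i == 0 then v 0 0 else v 1 0.
  by case=> [[|[|//]] hi]; congr (v _ _); apply/val_inj.
have h0 : (v 0 0 != 0) || (v 1 0 != 0).
  rewrite -negb_and; apply: contra v0 => /andP[/eqP a0 /eqP b0].
  by apply/eqP/matrixP => i j; rewrite !mxE ord1 vE a0 b0; case: ifP.
have [rS r0] : r ^+ 2 * (complex.Re (v 0 0) ^+ 2 + complex.Im (v 0 0) ^+ 2
   + complex.Re (v 1 0) ^+ 2 + complex.Im (v 1 0) ^+ 2) = 1 /\ r != 0.
  move: h0; rewrite /r; set S := (X in Num.sqrt X) => h0.
  have S0 : 0 < S.
    rewrite lt_neqAle eq_sym; apply/andP; split; last first.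
      by rewrite /S !addr_ge0 ?sqr_ge0.
    apply: contraTneq h0; rewrite /S -addrA => /eqP.
    rewrite !paddr_eq0 ?addr_ge0 ?sqr_ge0 // !sqrf_eq0.
    by move=> /andP[/andP[a1 a2] /andP[b1 b2]]; rewrite !eq_complex a1 a2 b1 b2.
  split; first by rewrite exprVn sqr_sqrtr ?ltW // mulVf ?gt_eqF.
  by rewrite invr_eq0 sqrtr_eq0 -ltNge.
clearbody r.
have colE : col 0 (\matrix_(i < 2, j < 2) (r%:C *
    (if j == 0 then v i 0
     else if i == 0 then - (conjc (v 1 0)) else (conjc (v 0 0))))) = r%:C *: v :> 'cV_2.
  by apply/matrixP => i j; rewrite !mxE ord1.
split; last first.
  rewrite colE vL; apply/eqP; rewrite eqEdim -memvE memvZ ?memv_line //=.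
  rewrite !dim_vline scaler_eq0 negb_or v0 andbT.
  by rewrite eq_complex /= eqxx andbT r0.
clear vL h0 colE; set g := (X in SU2 X).
have gE i j : g i j = r%:C * (if j == 0 then (if i == 0 then v 0 0 else v 1 0)
     else if i == 0 then - (conjc (v 1 0)) else (conjc (v 0 0))) by rewrite mxE vE.
clearbody g; move: rS gE; case: (v 0 0) => a1 a2; case: (v 1 0) => b1 b2 /= rS gE.
split; last first.
  rewrite det2 !gE /=; apply/eqP; rewrite eq_complex /=.
  apply/andP; split; apply/eqP; [rewrite -rS|]; ring.
apply/matrixP => i j; rewrite !mxE !big_ord_recl big_ord0 !mxE !gE.
case: i => [[|[|//]] hi]; case: j => [[|[|//]] hj];
  rewrite /=; apply/eqP; rewrite eq_complex /= -?rS;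
  apply/andP; split; apply/eqP; ring.
Qed.

Lemma sum_pairs (m : nat) (F : nat -> R) :
  \sum_(k < m.*2) F k = \sum_(j < m) (F j.*2 + F j.*2.+1).
Proof.
elim: m => [|m IH]; first by rewrite !big_ord0.
by rewrite doubleS !big_ord_recr /= IH addrA.
Qed.

Lemma dot_real_coords (p q : {poly R[i]}) :
  dot (real_coords p) (real_coords q) =
  \sum_(j < (2 * l).+1) (complex.Re p`_j * complex.Re q`_j
     + complex.Im p`_j * complex.Im q`_j) / 'C(2 * l, j)%:R.
Proof.
pose F k := ((if odd k then complex.Im p`_(k./2) else complex.Re p`_(k./2))
     / Num.sqrt ('C(2 * l, k./2)%:R)) *
   ((if odd k then complex.Im q`_(k./2) else complex.Re q`_(k./2))
     / Num.sqrt ('C(2 * l, k./2)%:R)) : R.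
rewrite /dot mxE (eq_bigr (fun k : 'I__ => F k)); last first.
  by move=> k _; rewrite !mxE.
have -> : (4 * l).+2 = (2 * l).+1.*2 by rewrite doubleS -mul2n mulnA.
rewrite sum_pairs; apply: eq_bigr => j _.
rewrite /F /= odd_double doubleK uphalf_double /=.
rewrite !mulf_div -!expr2 sqr_sqrtr ?ler0n // -mulrDl; congr (_ / _).
Qed.

Lemma coords_orthonormal (p : {poly R[i]}) : p != 0 -> (size p <= (2 * l).+1)%N ->
  orthonormal2 (normalize (real_coords p)) (normalize (real_coords ('i *: p))).
Proof.
move=> p0 sp.
have N1 : dot (real_coords ('i *: p)) (real_coords ('i *: p)) =
          dot (real_coords p) (real_coords p).
  rewrite !dot_real_coords; apply: eq_bigr => j _; congr (_ / _).
  by rewrite coefZ; case: (p`_j) => x y /=; ring.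
have N2 : dot (real_coords p) (real_coords ('i *: p)) = 0.
  rewrite dot_real_coords big1 // => j _.
  by rewrite coefZ; case: (p`_j) => x y /=; ring.
have N0 : 0 < dot (real_coords p) (real_coords p).
  rewrite dot_real_coords.
  have jl : ((size p).-1 < (2 * l).+1)%N.
    by apply: leq_trans sp; rewrite prednK // lt0n size_poly_eq0.
  rewrite (bigD1 (Ordinal jl)) //= ltr_pwDl //; last first.
    by apply: sumr_ge0 => j _; rewrite divr_ge0 ?ler0n // addr_ge0 // -expr2 sqr_ge0.
  apply: divr_gt0; last by rewrite ltr0n bin_gt0.
  have : lead_coef p != 0 by rewrite lead_coef_eq0.
  rewrite lead_coefE; case: (p`_ _) => x y; rewrite eq_complex /= => h.
  rewrite lt_neqAle addr_ge0 -?expr2 ?sqr_ge0 // andbT eq_sym.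
  by apply: contra h; rewrite paddr_eq0 ?sqr_ge0 // !sqrf_eq0.
have dotZ a b (u v : 'cV[R]_(4 * l).+2) : dot (a *: u) (b *: v) = a * b * dot u v.
  by rewrite /dot [(_ *: u)^T]linearZ /= -scalemxAl -scalemxAr !mxE mulrA.
rewrite /orthonormal2 /normalize !dotZ N1 N2 mulr0 -expr2 exprVn.
by rewrite sqr_sqrtr ?ltW // mulVf ?gt_eqF.
Qed.

Lemma frame_orthonormal (g : 'M[R[i]]_2) : SU2 g ->
  orthonormal2 (frame1 g) (frame2 g).
Proof.
move=> gS; have gu : \det g != 0 by case: gS => _ ->; exact: oner_neq0.
have lin0 (a b : R[i]) : (a%:P + b *: 'X == 0) = (a == 0) && (b == 0).
  apply/eqP/andP => [h|[/eqP-> /eqP->]]; last by rewrite scale0r addr0.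
  have := congr1 (fun q : {poly R[i]} => q`_0) h.
  have := congr1 (fun q : {poly R[i]} => q`_1) h.
  rewrite !coefE /= mulr1 mulr0 add0r addr0.
  by move=> -> ->; rewrite eqxx.
  have sz (a b : R[i]) k : (size ((a%:P + b *: 'X) ^+ k)%R <= k.+1)%N.
  apply: leq_trans (size_poly_exp_leq _ _) _; rewrite ltnS.
  have : (size (a%:P + b *: 'X)%R <= 2)%N.
    apply: leq_trans (size_polyD _ _) _; rewrite geq_max.
    rewrite (leq_trans (size_polyC_leq1 _)) //.
    by rewrite (leq_trans (size_scale_leq _ _)) // size_polyX.
  by case: (size _) => [|[|[|//]]] //= _; rewrite ?mul0n ?mul1n.
apply: coords_orthonormal.
  rewrite /weight0 mulf_neq0 // expf_neq0 // lin0; apply: contra gu => /andP[/eqP h1 /eqP h2].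
    by rewrite det2 h1 h2 mulr0 mul0r subr0.
  by rewrite det2 h1 h2 mulr0 mul0r subr0.
rewrite /weight0; apply: leq_trans (size_polyMleq _ _) _.
have := sz (g 0 0) (g 1 0) l; have := sz (g 0 1) (g 1 1) l.
by move: (size _) (size _) => x y; lia.
Qed.

Definition standard_map (L : CP1 R) : Gr R (4 * l) :=
  oriented_span (frame_orthonormal (SU2_of_lineP L).1).

(* f_0([g]) = g C_0^perp, for every g. *)
Lemma standard_mapE (g : 'M[R[i]]_2) (L : CP1 R) :
  SU2 g -> <[(col 0 g)%R]>%VS = val L ->
  Jmx (standard_map L) = quarter_turn (frame1 g) (frame2 g).
Proof.
move=> gS gL; have [hS hL] := SU2_of_lineP L.
rewrite /standard_map /=; set h := SU2_of_line L in hS hL *; clearbody h.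
suff E : weight0 h = weight0 g by rewrite /frame1 /frame2 E.
have SU2P (k : 'M[R[i]]_2) : SU2 k ->
    [/\ k 0 1 = - (conjc (k 1 0)), k 1 1 = (conjc (k 0 0)) & (conjc (k 0 0)) * k 0 0 + (conjc (k 1 0)) * k 1 0 = 1].
  move=> [/matrixP kk]; rewrite det2 => kd.
  have := kk 0 0; have := kk 0 1; rewrite !mxE !big_ord_recl !big_ord0 !mxE /= !addr0.
  have -> : lift 0 0 = 1 :> 'I_2 by apply/val_inj.
  move=> k1 k2; split => //.
    transitivity (k 0 1 * ((conjc (k 0 0)) * k 0 0 + (conjc (k 1 0)) * k 1 0)).
      by rewrite k2 mulr1.
    transitivity (k 0 0 * ((conjc (k 0 0)) * k 0 1 + (conjc (k 1 0)) * k 1 1)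
      - (conjc (k 1 0)) * (k 0 0 * k 1 1 - k 0 1 * k 1 0)); first by ring.
    by rewrite k1 kd mulr0 mulr1 sub0r.
  transitivity (k 1 1 * ((conjc (k 0 0)) * k 0 0 + (conjc (k 1 0)) * k 1 0)).
    by rewrite k2 mulr1.
  transitivity (k 1 0 * ((conjc (k 0 0)) * k 0 1 + (conjc (k 1 0)) * k 1 1)
      + (conjc (k 0 0)) * (k 0 0 * k 1 1 - k 0 1 * k 1 0)); first by ring.
  by rewrite k1 kd mulr0 mulr1 add0r.
have [g1 g2 g3] := SU2P _ gS; have [h1 h2 h3] := SU2P _ hS.
have : (col 0 h)%R \in <[(col 0 g)%R]>%VS by rewrite gL -hL memv_line.
move=> /vlineP [a /matrixP ha].
have ha0 : h 0 0 = a * g 0 0 by have := ha 0 0; rewrite !mxE.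
have ha1 : h 1 0 = a * g 1 0 by have := ha 1 0; rewrite !mxE.
have aa : a * conjc a = 1.
  rewrite -h3 ha0 ha1 !rmorphM /= -[LHS]mulr1 -g3; ring.
have cM (x y : R[i]) : conjc (x * y) = conjc x * conjc y by rewrite rmorphM.
rewrite /weight0 h1 h2 g1 g2 ha0 ha1 !cM.
have -> : (a * g 0 0)%:P + (a * g 1 0) *: 'X = a *: ((g 0 0)%:P + g 1 0 *: 'X).
  by rewrite scalerDr scalerA polyCM mul_polyC.
have -> : (- (conjc a * (conjc (g 1 0))))%:P + (conjc a * (conjc (g 0 0))) *: 'X =
    conjc a *: ((- (conjc (g 1 0)))%:P + (conjc (g 0 0)) *: 'X).
  by rewrite scalerDr scalerA -mulrN polyCM mul_polyC.
by rewrite !exprZn -scalerAl -scalerAr scalerA -exprMn aa expr1n scale1r.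
Qed.

End Standard.

(* Main.v *)
Require Import Defs.
From HB Require Import structures.
From mathcomp Require Import all_boot all_order all_algebra.
From mathcomp Require Import all_classical all_reals all_analysis.
From mathcomp Require Import complex.
From mathcomp Require Import zify ring lra.

Set Implicit Arguments.
Unset Strict Implicit.
Unset Printing Implicit Defensive.

Import Order.TTheory GRing.Theory Num.Theory.
Import numFieldNormedType.Exports.

Local Open Scope ring_scope.

(** The idea of the proof.  Let J be the quarter turn of the fibre of V and P = - J^2 the
projector onto V, as functions on the affine chart z of the projective line, and put
Pi = (P + i J) / 2, the Hermitian projector onto one of the two isotropic complex lines of
the complexified fibre.  The hypotheses are equations on Pi.  That f is totally real means
that the line bundle im Pi is flat ([flat_affine]).  Since f is minimal and Einstein-Hermitian
with constant l, one has, with d and db the derivatives in z and in its conjugate,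
  Pi d (Pi db Pi) = - l (l + 1) (1 + |z|^2)^(-2) Pi          ([eigen_affine]):
Pi is an eigensection of the connection Laplacian of the round sphere, with the eigenvalue
of the spherical harmonics of degree l.

As for spherical harmonics, the operators [raise] and their conjugates satisfy the relations
of sl(2) ([raise_comm], [ladder_lower]).  Raising Pi l + 1 times gives a holomorphic section
of (l + 1)-st order differentials with values in a flat Hermitian bundle over the sphere; its
squared norm is subharmonic and tends to 0 at infinity, so it is 0 by the maximum principle
([ladder_top]), and likewise for lowering ([ladder_bot]).  Hence (1 + |z|^2)^l Pi is killed
by the (l + 1)-st covariant derivatives in both directions, and its finite Taylor expansion at
the origin is a parallel section ([parallel_section]).  The bundle im Pi therefore has a
parallel frame E, with E^* E = 2, and u = E^* is a row of ordinary functions to which all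
equations descend.

The functions obtained from u by raising and lowering form a chain of 2 l + 1 rows, the
lowest of which is, up to a factor, a polynomial in z.  This determines
  u = (1 + |z|^2)^(-l) sum_k c_k(z) g_k,
with constant g_k and c_k(z) the coefficients of (1 + z X)^l (X - conj z)^l, which is exactly
the weight zero vector x^l y^l moved by a unitary matrix over z ([ladder_normal_form]).
Moreover u u^T = 0, u u^* = 2 and du u^* = 0 propagate along the chain ([bil0], [her_off],
[her_diag]): the g_k are isotropic and mutually orthogonal for both products, with squared
norms proportional to the inverse binomial coefficients.  Their real and imaginary parts
form, after rescaling, an orthonormal system, the columns of a matrix O of size
(n + 2) x (4 l + 2) such that J = O J_0 O^T for the quarter turn J_0 of the standard map
([chart_frame]), first in the chart and then at infinity by continuity ([global_frame]).
Fullness makes O orthogonal, so n = 4 l, and conjugation by O^T is an isometry of the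
Grassmannian that carries f to the standard map. *)

(** * Derivations, connections and raising operators *)

(** All the differential geometry below is done over a commutative ring with derivations: only
    later is it the ring of smooth functions on the plane. *)
Record derivation (A : comNzRingType) := Derivation {
  der_fun :> {additive A -> A};
  derM : forall a b, der_fun (a * b) = der_fun a * b + a * der_fun b
}.

Section Derivations.
Variables (A : comNzRingType) (d : derivation A).

Lemma der0 : d 0 = 0. Proof. exact: raddf0. Qed.
Lemma derN a : d (- a) = - d a. Proof. exact: raddfN. Qed.
Lemma derD a b : d (a + b) = d a + d b. Proof. exact: raddfD. Qed.
Lemma derB a b : d (a - b) = d a - d b. Proof. exact: raddfB. Qed.

Lemma der1 : d 1 = 0.
Proof.
have := derM d 1 1; rewrite !mulr1 mul1r => /eqP.
by rewrite -subr_eq0 opprD addrA subrr sub0r oppr_eq0 => /eqP.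
Qed.

Lemma der_nat k : d k%:R = 0.
Proof. by rewrite raddfMn /= der1 mul0rn. Qed.

Lemma derX a k : d (a ^+ k.+1) = k.+1%:R * a ^+ k * d a.
Proof.
elim: k => [|k IH]; first by rewrite expr1 expr0 !mul1r.
rewrite exprS derM IH -(natr1 k.+1) !exprS; ring.
Qed.

Lemma der_inv a b : d a = 0 -> a * b = 1 -> d b = 0.
Proof.
move=> da ab; have := derM d a b; rewrite ab der1 da mul0r add0r => /esym h.
by rewrite -[d b]mul1r -ab mulrAC h mul0r.
Qed.

Lemma map_derM m n p (X : 'M[A]_(m, n)) (Y : 'M[A]_(n, p)) :
  map_mx d (X *m Y) = map_mx d X *m Y + X *m map_mx d Y.
Proof.
apply/matrixP => i j; rewrite !mxE raddf_sum -big_split /=.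
by apply: eq_bigr => k _; rewrite derM !mxE.
Qed.

Lemma map_derZ m n a (X : 'M[A]_(m, n)) :
  map_mx d (a *: X) = d a *: X + a *: map_mx d X.
Proof. by apply/matrixP => i j; rewrite !mxE derM. Qed.

Lemma map_der_tr m n (X : 'M[A]_(m, n)) : map_mx d X^T = (map_mx d X)^T.
Proof. by rewrite map_trmx. Qed.

End Derivations.

(** The calculus of an affine chart of the projective line: [del] and [delb] are the Wirtinger
    derivatives, [zc] is the coordinate, [zb] its conjugate, and [rho] is 1 / (1 + |z|^2).
    Conjugation is a separate structure, so that exchanging the two derivatives yields again
    an instance, and every statement has a conjugate version for free. *)
Record wirtinger (A : comNzRingType) := Wirtinger {
  del : derivation A;
  delb : derivation A;
  zc : A;
  zb : A;
  rho : A;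
  del_delb : forall a, del (delb a) = delb (del a);
  del_z : del zc = 1;
  del_zb : del zb = 0;
  delb_z : delb zc = 0;
  delb_zb : delb zb = 1;
  rhoP : rho * (1 + zc * zb) = 1
}.

Definition swapw (A : comNzRingType) (w : wirtinger A) : wirtinger A.
Proof.
refine (@Wirtinger A (delb w) (del w) (zb w) (zc w) (rho w) _
  (delb_zb w) (delb_z w) (del_zb w) (del_z w) _).
- by move=> a; rewrite del_delb.
- by rewrite [zb w * _]mulrC rhoP.
Defined.

(** The sections of the subbundle im [Pi] of a trivial bundle are the [X] with [Pi *m X = X];
    this is the connection induced on it. *)
Definition nabla (A : comNzRingType) N (Pi : 'M[A]_N) (d : derivation A) p
  (X : 'M[A]_(N, p)) : 'M[A]_(N, p) := Pi *m map_mx d X.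

Section Connection.
Variables (A : comNzRingType) (N p : nat) (Pi : 'M[A]_N).
Hypothesis PiPi : Pi *m Pi = Pi.
Implicit Types (d : derivation A) (X Y : 'M[A]_(N, p)).

Lemma nabla_sec d X : Pi *m nabla Pi d X = nabla Pi d X.
Proof. by rewrite /nabla mulmxA PiPi. Qed.

Lemma nablaD d X Y : nabla Pi d (X + Y) = nabla Pi d X + nabla Pi d Y.
Proof. by rewrite /nabla map_mxD mulmxDr. Qed.

Lemma nablaZ d a X : Pi *m X = X ->
  nabla Pi d (a *: X) = d a *: X + a *: nabla Pi d X.
Proof. by move=> sX; rewrite /nabla map_derZ mulmxDr -!scalemxAr sX. Qed.

Lemma nabla0 d : nabla Pi d (0 : 'M[_]_(N, p)) = 0.
Proof. by rewrite /nabla map_mx0 mulmx0. Qed.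

Lemma PidPiPi d : Pi *m map_mx d Pi *m Pi = 0.
Proof.
have := congr1 (mulmx Pi) (map_derM d Pi Pi); rewrite PiPi mulmxDr !mulmxA PiPi.
by move/eqP; rewrite -subr_eq0 opprD addrCA subrr addr0 oppr_eq0 => /eqP.
Qed.

(** Only the first term can fail to be symmetric in two commuting derivations: it is the part of
    the second derivative that carries the curvature, and [flat] asks for its symmetry. *)
Lemma nabla_nabla d d' X : Pi *m X = X ->
  nabla Pi d (nabla Pi d' X) =
  Pi *m map_mx d Pi *m map_mx d' Pi *m Pi *m X + Pi *m map_mx d (map_mx d' X).
Proof.
move=> sX; rewrite {1}/nabla /nabla map_derM mulmxDr; congr (_ + _); last first.
  by rewrite mulmxA PiPi.
rewrite -{1}sX map_derM !mulmxDr !mulmxA -!(mulmxA _ Pi X) sX.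
by rewrite PidPiPi !mul0mx addr0.
Qed.

End Connection.

Definition flat (A : comNzRingType) N (Pi : 'M[A]_N) (w : wirtinger A) :=
  Pi *m map_mx (del w) Pi *m map_mx (delb w) Pi *m Pi =
  Pi *m map_mx (delb w) Pi *m map_mx (del w) Pi *m Pi.

(** The spin raising operator of weight [s] on the sphere, twisted by the connection. With
    [swapw w] and the opposite weight it is the lowering operator. *)
Definition raise (A : comNzRingType) N (Pi : 'M[A]_N) (w : wirtinger A) p (s : A)
   (X : 'M[A]_(N, p)) : 'M[A]_(N, p) :=
  (1 + zc w * zb w) *: nabla Pi (del w) X + (s * zb w) *: X.

Fixpoint ladder (A : comNzRingType) N (Pi : 'M[A]_N) (w : wirtinger A) p (s : A)
   (X : 'M[A]_(N, p)) k : 'M[A]_(N, p) :=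
  if k is k'.+1 then raise Pi w (s + k'%:R) (ladder Pi w s X k') else X.

Section Ladder.
Variables (A : comNzRingType) (N p : nat) (Pi : 'M[A]_N) (w : wirtinger A).
Hypothesis PiPi : Pi *m Pi = Pi.
Hypothesis Pi_flat : flat Pi w.
Implicit Types X Y : 'M[A]_(N, p).

Local Notation nz := (@nabla A N Pi (del w) p).
Local Notation nzb := (@nabla A N Pi (delb w) p).
Local Notation q := (1 + zc w * zb w).

Lemma del_q : del w q = zb w.
Proof. by rewrite raddfD /= der1 derM del_z del_zb; ring. Qed.
Lemma delb_q : delb w q = zc w.
Proof. by rewrite raddfD /= der1 derM delb_z delb_zb; ring. Qed.

Lemma nabla_comm X : Pi *m X = X -> nz (nzb X) = nzb (nz X).
Proof.
move=> sX; rewrite !nabla_nabla //; congr (_ *m X + Pi *m _); first exact: Pi_flat.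
by apply/matrixP => i j; rewrite !mxE del_delb.
Qed.

Lemma raise_sec s X : Pi *m X = X -> Pi *m raise Pi w s X = raise Pi w s X.
Proof. by move=> sX; rewrite /raise mulmxDr -!scalemxAr nabla_sec // sX. Qed.

Lemma raiseZ s c X : del w c = 0 -> Pi *m X = X ->
  raise Pi w s (c *: X) = c *: raise Pi w s X.
Proof.
move=> dc sX; rewrite /raise nablaZ // dc scale0r add0r scalerDr !scalerA.
by congr (_ *: _ + _ *: _); ring.
Qed.

Lemma raise0 s : raise Pi w s (0 : 'M[_]_(N, p)) = 0.
Proof. by rewrite /raise nabla0 !scaler0 addr0. Qed.

(** The sl(2) relation between raising and lowering. Flatness commutes the two covariant
    derivatives, and the term 2 s is the curvature of the round metric. *)
Lemma raise_comm s X : del w s = 0 -> delb w s = 0 -> Pi *m X = X ->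
  raise Pi (swapw w) (- (s + 1)) (raise Pi w s X) =
  raise Pi w (s - 1) (raise Pi (swapw w) (- s) X) + (2 * s) *: X.
Proof.
move=> ds dbs sX; rewrite /raise /=.
have nX d := nabla_sec (p := p) PiPi d X.
have swq : 1 + zb w * zc w = q by ring.
rewrite swq !nablaD !nablaZ ?mulmxDr -?scalemxAr ?nX ?sX //.
rewrite del_q delb_q nabla_comm //.
rewrite !derM !raddfN /= ds dbs del_z delb_zb.
move: (nzb (nz X)) (nz X) (nzb X) => U V W'.
by apply/matrixP => i j; rewrite !mxE; ring.
Qed.

Lemma ladder_sec s X k : Pi *m X = X -> Pi *m ladder Pi w s X k = ladder Pi w s X k.
Proof. by move=> sX; elim: k => [|k IH] //=; exact: raise_sec. Qed.

(** Lowering undoes raising up to a scalar, determined at every rung by its value [mu] at the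
    bottom: each use of [raise_comm] adds twice the current weight. *)
Lemma ladder_lower (s mu : A) X k : del w s = 0 -> delb w s = 0 ->
  del w mu = 0 -> Pi *m X = X ->
  raise Pi (swapw w) (- (s + 1)) (raise Pi w s X) = mu *: X ->
  raise Pi (swapw w) (- (s + k.+1%:R)) (ladder Pi w s X k.+1) =
  (mu + 2 * k%:R * s + (k * k.+1)%:R) *: ladder Pi w s X k.
Proof.
move=> ds dbs dmu sX h0; elim: k => [|k IH].
  by rewrite mulr0 mul0r mul0n !addr0 -h0 /= addr0.
have dsk j : del w (s + j%:R) = 0 by rewrite raddfD /= ds der_nat addr0.
have dbsk j : delb w (s + j%:R) = 0 by rewrite raddfD /= dbs der_nat addr0.
rewrite -[ladder _ _ _ _ k.+2]/(raise Pi w (s + k.+1%:R) (ladder Pi w s X k.+1)).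
have -> : s + k.+2%:R = s + k.+1%:R + 1 by rewrite -[k.+2%:R]natr1 addrA.
rewrite raise_comm ?ladder_sec // IH raiseZ ?ladder_sec //; last first.
  by rewrite !raddfD /= !derM !der_nat ds dmu; ring.
have -> : s + k.+1%:R - 1 = s + k%:R by rewrite -[k.+1%:R]natr1; ring.
rewrite -[raise Pi w (s + k%:R) _]/(ladder Pi w s X k.+1) -scalerDl; congr (_ *: _).
rewrite !natrM -[k.+2%:R]natr1 -[k.+1%:R]natr1; ring.
Qed.

(** A product of raising operators is a power of the connection conjugated by powers of
    1 + |z|^2, because the second [del]-derivative of 1 + |z|^2 vanishes. *)
Lemma ladder_closed m X k : Pi *m X = X ->
  ladder Pi w (- m%:R) X k.+1 =
  q ^+ m.+1 *: iter k.+1 nz ((q ^+ k * rho w ^+ m) *: X).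
Proof.
move=> sX.
have sX' c : Pi *m (c *: X) = c *: X by rewrite -scalemxAr sX.
have it_sec j Y : Pi *m Y = Y -> Pi *m iter j nz Y = iter j nz Y.
  by case: j => [|j] //= _; exact: nabla_sec.
have itq j Y : Pi *m Y = Y ->
    iter j.+1 nz (q *: Y) = q *: iter j.+1 nz Y + (j.+1%:R * zb w) *: iter j nz Y.
  move=> sY; elim: j => [|j IH]; first by rewrite /= nablaZ // del_q mul1r addrC.
  rewrite iterS IH nablaD !nablaZ ?it_sec ?nabla_sec // del_q derM der_nat del_zb.
  rewrite -!iterS mulr0 mul0r addr0 scale0r add0r [_ *: _ + q *: _]addrC -addrA -scalerDl.
  by congr (_ + _ *: _); rewrite -[in RHS]natr1; ring.
have dq j : del w (q ^+ j.+1) = j.+1%:R * q ^+ j * zb w by rewrite derX del_q.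
elim: k => [|k IH].
  rewrite /= expr0 mul1r addr0; set Z := _ *: X.
  have -> : X = q ^+ m *: Z.
    by rewrite scalerA -exprMn [q * _]mulrC rhoP expr1n scale1r.
  have dqm : q * del w (q ^+ m) = m%:R * zb w * q ^+ m.
    case: m @Z => [|m'] _; first by rewrite expr0 der1; ring.
    by rewrite dq exprS; ring.
  rewrite /raise nablaZ; last exact: sX'. move: (nz Z) => U.
  apply/matrixP => i j; rewrite !mxE mulrDr mulrA dqm exprS; ring.
rewrite -[LHS]/(raise Pi w (- m%:R + k.+1%:R) (ladder Pi w (- m%:R) X k.+1)) IH.
rewrite [q ^+ k.+1]exprS -[q * _ * _]mulrA -[(q * _) *: X]scalerA itq //.
set Z := iter k.+1 nz _; rewrite /raise nablaZ; last exact: it_sec.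
rewrite dq -[nz Z]/(iter k.+2 nz _); set U := iter k.+2 nz _.
by apply/matrixP => i j; rewrite !mxE -![_.+2%:R]natr1 -![_.+1%:R]natr1 !exprS; ring.
Qed.

End Ladder.

(** * Parallel sections and parallel frames *)

(** The Taylor expansions below divide by factorials. *)
Definition natinv (A : comNzRingType) (inv : nat -> A) :=
  forall k, k.+1%:R * inv k = 1.

(** The inverse of k!. *)
Definition finv (A : comNzRingType) (inv : nat -> A) k := \prod_(i < k) inv i.

Section Taylor.
Variables (A : comNzRingType) (inv : nat -> A) (invP : natinv inv).
Variables (N p : nat) (Pi : 'M[A]_N).
Hypothesis PiPi : Pi *m Pi = Pi.
Implicit Types (w : wirtinger A) (d : derivation A) (X : 'M[A]_(N, p)).

Lemma der_invn d k : d (inv k) = 0.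
Proof. by apply: der_inv (invP k); rewrite der_nat. Qed.

Lemma finvS k : k.+1%:R * finv inv k.+1 = finv inv k.
Proof. by rewrite /finv big_ord_recr /= mulrCA mulrC invP mul1r. Qed.

Lemma der_finv d k : d (finv inv k) = 0.
Proof.
elim: k => [|k IH]; first by rewrite /finv big_ord0 der1.
by rewrite /finv big_ord_recr /= derM -/(finv inv k) IH der_invn mul0r mulr0 addr0.
Qed.

Lemma nabla_const d c X : Pi *m X = X -> d c = 0 ->
  nabla Pi d (c *: X) = c *: nabla Pi d X.
Proof. by move=> sX dc; rewrite nablaZ // dc scale0r add0r. Qed.

Lemma iter_nabla_sec d j X : Pi *m X = X ->
  Pi *m iter j (@nabla A N Pi d p) X = iter j (@nabla A N Pi d p) X.
Proof. by case: j => [|j] //= _; exact: nabla_sec. Qed.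

(** The Taylor polynomial based at the current point, read at the point where [zc] is 0. When
    the covariant derivatives of order [n.+1] vanish it does not depend on the base point. *)
Definition taylor_at0 w n X : 'M[A]_(N, p) :=
  \sum_(j < n.+1) ((- zc w) ^+ j * finv inv j) *: iter j (@nabla A N Pi (del w) p) X.

Lemma taylor_at0_sec w n X : Pi *m X = X -> Pi *m taylor_at0 w n X = taylor_at0 w n X.
Proof.
move=> sX; rewrite mulmx_sumr; apply: eq_bigr => j _.
by rewrite -scalemxAr iter_nabla_sec.
Qed.

Lemma taylor_at00 w n : taylor_at0 w n 0 = 0.
Proof.
rewrite /taylor_at0 big1 // => j _; suff -> : iter j (@nabla A N Pi (del w) p) 0 = 0.
  by rewrite scaler0.
by elim: (nat_of_ord j) => //= k ->; rewrite nabla0.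
Qed.

(** The sum telescopes. *)
Lemma nabla_taylor w n X : Pi *m X = X ->
  nabla Pi (del w) (taylor_at0 w n X) =
  ((- zc w) ^+ n * finv inv n) *: iter n.+1 (@nabla A N Pi (del w) p) X.
Proof.
move=> sX; elim: n => [|n IH].
  rewrite /taylor_at0 big_ord1 /= expr0 mul1r /finv big_ord0 !scale1r //.
rewrite /taylor_at0 big_ord_recr nablaD -/(taylor_at0 w n X) IH.
rewrite nablaZ; last exact: iter_nabla_sec.
rewrite derM der_finv mulr0 addr0 derX raddfN del_z.
rewrite addrA -scalerDl -[finv inv n]finvS.
set Y := iter n.+1 _ X; set Z := iter n.+2 _ X; rewrite -[nabla _ _ Y]/Z.
rewrite [X in X *: Y](_ : _ = 0) ?scale0r ?add0r //; by ring.
Qed.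

Lemma nabla_iter_comm w j X : flat Pi w -> Pi *m X = X ->
  nabla Pi (delb w) (iter j (@nabla A N Pi (del w) p) X) =
  iter j (@nabla A N Pi (del w) p) (nabla Pi (delb w) X).
Proof.
move=> fl sX; elim: j => //= j IH.
by rewrite -nabla_comm ?IH //; exact: iter_nabla_sec.
Qed.

Lemma nabla_taylor_comm w n X : flat Pi w -> Pi *m X = X ->
  nabla Pi (delb w) (taylor_at0 w n X) = taylor_at0 w n (nabla Pi (delb w) X).
Proof.
move=> fl sX; rewrite /taylor_at0.
have nS (F : 'I_n.+1 -> 'M[A]_(N, p)) :
    nabla Pi (delb w) (\sum_j F j) = \sum_j nabla Pi (delb w) (F j).
  by apply: (big_morph _ (nablaD Pi _)); exact: nabla0.
rewrite nS; apply: eq_bigr => j _.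
rewrite nabla_const ?nabla_iter_comm //; first exact: iter_nabla_sec.
rewrite derM der_finv mulr0 addr0; case: (nat_of_ord j) => [|k].
  by rewrite expr0 der1 mul0r.
by rewrite derX raddfN /= delb_z oppr0 mulr0 mul0r.
Qed.

Lemma ev_taylor (C : comNzRingType) (ev : {rmorphism A -> C}) w n X :
  ev (zc w) = 0 -> map_mx ev (taylor_at0 w n X) = map_mx ev X.
Proof.
move=> ez; rewrite /taylor_at0 big_ord_recl /= expr0 mul1r /finv big_ord0 scale1r.
rewrite map_mxD [X in _ + X](_ : _ = 0) ?addr0 //.
rewrite map_mx_sum big1 // => j _.
by rewrite map_mxZ rmorphM rmorphXn rmorphN /= ez oppr0 exprS !mul0r scale0r.
Qed.

Lemma flat_swap w : flat Pi w -> flat Pi (swapw w).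
Proof. by rewrite /flat /= => ->. Qed.

(** Expanding first in [zb] and then in [zc] gives a section that is parallel in both
    directions: flatness lets the covariant derivative in one direction pass through the
    expansion in the other. At the origin all terms but the constant ones vanish. *)
Lemma parallel_section w n X : flat Pi w -> Pi *m X = X ->
  iter n.+1 (@nabla A N Pi (del w) p) X = 0 ->
  iter n.+1 (@nabla A N Pi (delb w) p) X = 0 ->
  exists Y : 'M[A]_(N, p), [/\ Pi *m Y = Y, nabla Pi (del w) Y = 0,
    nabla Pi (delb w) Y = 0 & forall (C : comNzRingType) (ev : {rmorphism A -> C}),
      ev (zc w) = 0 -> ev (zb w) = 0 -> map_mx ev Y = map_mx ev X].
Proof.
move=> fl sX h hb; pose Z := taylor_at0 (swapw w) n X.
have sZ : Pi *m Z = Z by exact: taylor_at0_sec.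
have fls := flat_swap fl.
have zZ : nabla Pi (delb w) Z = 0.
  by have := nabla_taylor (swapw w) n sX; rewrite hb scaler0.
have hZ : iter n.+1 (@nabla A N Pi (del w) p) Z = 0.
  suff E k : iter k (@nabla A N Pi (del w) p) Z =
      taylor_at0 (swapw w) n (iter k (@nabla A N Pi (del w) p) X).
    by rewrite E h taylor_at00.
  elim: k => //= k ->.
  by rewrite (nabla_taylor_comm n fls) //; exact: iter_nabla_sec.
exists (taylor_at0 w n Z); split.
- exact: taylor_at0_sec.
- by rewrite nabla_taylor // hZ scaler0.
- by rewrite nabla_taylor_comm // zZ taylor_at00.
- by move=> C ev e0 e1; rewrite !ev_taylor.
Qed.

End Taylor.

Section Polynomial.
Variables (A : comNzRingType) (inv : nat -> A) (invP : natinv inv).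
Variables (N p : nat) (w : wirtinger A).
Implicit Types X : 'M[A]_(N, p).

Lemma iter_map_der k n X : map_mx (del w) X = 0 ->
  iter k (map_mx (del w)) (zc w ^+ n *: X) = ((n ^_ k)%:R * zc w ^+ (n - k)) *: X.
Proof.
move=> dX; elim: k => [|k IH]; first by rewrite /= ffactn0 mul1r subn0.
rewrite iterS IH map_derZ dX scaler0 addr0 derM der_nat mul0r add0r ffactnSr natrM.
congr (_ *: _); case E : (n - k)%N => [|m]; first by rewrite der1 !mulr0 mul0r.
by rewrite derX del_z subnS E /=; ring.
Qed.

(** Induction on the degree: the top coefficient is the derivative of highest order divided by
    a factorial. *)
Lemma holomorphic_polynomial n X : iter n (map_mx (del w)) X = 0 ->
  map_mx (delb w) X = 0 ->
  exists c : nat -> 'M[A]_(N, p),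
   [/\ forall k, map_mx (del w) (c k) = 0, forall k, map_mx (delb w) (c k) = 0
     & X = \sum_(k < n) zc w ^+ k *: c k].
Proof.
elim: n X => [|n IH] X hX hb.
  by exists (fun=> 0); split=> [k|k|]; rewrite ?map_mx0 ?big_ord0 //; exact: hX.
pose c0 := finv inv n *: iter n (map_mx (del w)) X.
have c0z : map_mx (del w) c0 = 0.
  by rewrite map_derZ der_finv // scale0r add0r -iterS hX scaler0.
have c0b : map_mx (delb w) c0 = 0.
  rewrite map_derZ der_finv // scale0r add0r.
  suff -> : map_mx (delb w) (iter n (map_mx (del w)) X) = 0 by rewrite scaler0.
  elim: (n) => //= k IHk; apply/matrixP => i j.
  by move/matrixP: IHk => /(_ i j); rewrite !mxE -del_delb => ->; rewrite raddf0.
have finvn : n`!%:R * finv inv n = 1.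
  elim: (n) => [|k IHk]; first by rewrite fact0 mul1r /finv big_ord0.
  by rewrite factS mulnC natrM -mulrA finvS.
have [|| c [cz cb cE]] := IH (X - zc w ^+ n *: c0).
- have itB k Y Z : iter k (map_mx (del w)) (Y - Z) =
     iter k (map_mx (del w)) Y - iter k (map_mx (del w)) Z :> 'M[_]_(N, p).
    by elim: k => //= k ->; rewrite map_mxB.
  rewrite itB iter_map_der // subnn mulr1 ffactnn scalerA finvn scale1r subrr //.
- rewrite map_mxB hb map_derZ c0b scaler0 addr0.
  suff -> : delb w (zc w ^+ n) = 0 by rewrite scale0r subr0.
  by case: (n) => [|k]; rewrite ?expr0 ?der1 // derX delb_z mulr0.
exists (fun k => if (k < n)%N then c k else c0); split.
- by move=> k; case: ifP.
- by move=> k; case: ifP.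
- rewrite big_ord_recr /= ltnn -[X in X = _](subrK (zc w ^+ n *: c0)) cE.
  by congr (_ + _); apply: eq_bigr => k _; rewrite ltn_ord.
Qed.

End Polynomial.

Record conjugation (A : comNzRingType) (w : wirtinger A) := Conjugation {
  cj :> {rmorphism A -> A};
  cjK : forall a, cj (cj a) = a;
  cj_del : forall a, cj (del w a) = delb w (cj a);
  cj_z : cj (zc w) = zb w
}.

Definition adj (A : comNzRingType) (w : wirtinger A) (c : conjugation w)
  m n (X : 'M[A]_(m, n)) : 'M[A]_(n, m) := (map_mx c X)^T.

Section Conjugation.
Variables (A : comNzRingType) (w : wirtinger A) (c : conjugation w).

Lemma cj_delb a : c (delb w a) = del w (c a).
Proof. by rewrite -{1}[a](cjK c) -cj_del cjK. Qed.

Lemma cj_zb : c (zb w) = zc w.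
Proof. by rewrite -(cj_z c) cjK. Qed.

Definition swapc : conjugation (swapw w).
Proof. by exists c; [exact: cjK | exact: cj_delb | exact: cj_zb]. Defined.

Lemma adjM m n p (X : 'M[A]_(m, n)) (Y : 'M[A]_(n, p)) :
  adj c (X *m Y) = adj c Y *m adj c X.
Proof. by rewrite /adj map_mxM trmx_mul. Qed.

Lemma adjK m n (X : 'M[A]_(m, n)) : adj c (adj c X) = X.
Proof. by apply/matrixP => i j; rewrite !mxE cjK. Qed.

Lemma adjD m n (X Y : 'M[A]_(m, n)) : adj c (X + Y) = adj c X + adj c Y.
Proof. by rewrite /adj map_mxD raddfD. Qed.

Lemma adjZ m n a (X : 'M[A]_(m, n)) : adj c (a *: X) = c a *: adj c X.
Proof. by apply/matrixP => i j; rewrite !mxE rmorphM. Qed.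

Lemma adj0 m n : adj c (0 : 'M[A]_(m, n)) = 0.
Proof. by apply/matrixP => i j; rewrite !mxE rmorph0. Qed.

Lemma del_adj m n (X : 'M[A]_(m, n)) : map_mx (del w) (adj c X) = adj c (map_mx (delb w) X).
Proof. by apply/matrixP => i j; rewrite !mxE cj_delb. Qed.

Lemma delb_adj m n (X : 'M[A]_(m, n)) : map_mx (delb w) (adj c X) = adj c (map_mx (del w) X).
Proof. by apply/matrixP => i j; rewrite !mxE cj_del. Qed.

Variables (N k p : nat) (Pi : 'M[A]_N) (E : 'M[A]_(N, k)).
Hypotheses (PiE : Pi *m E = E) (PiH : adj c Pi = Pi) (E_dzb : nabla Pi (delb w) E = 0).
Implicit Types X : 'M[A]_(N, p).

(** Pairing with a parallel frame turns the connection into plain differentiation, and hence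
    ([ladder_parallel]) ladders of sections into ladders of functions. *)
Lemma del_parallel X : Pi *m X = X ->
  map_mx (del w) (adj c E *m X) = adj c E *m nabla Pi (del w) X.
Proof.
move=> sX; rewrite map_derM del_adj -{1}sX mulmxA -{1}PiH -adjM.
rewrite -/(nabla Pi (delb w) E) E_dzb adj0 mul0mx add0r.
by rewrite /nabla mulmxA -PiH -adjM PiE.
Qed.

Lemma raise_parallel s X : Pi *m X = X ->
  raise 1%:M w s (adj c E *m X) = adj c E *m raise Pi w s X.
Proof.
move=> sX; rewrite /raise {1}/nabla mul1mx del_parallel //.
by rewrite mulmxDr -!scalemxAr.
Qed.

Lemma ladder_parallel s X n : Pi *m Pi = Pi -> Pi *m X = X ->
  ladder 1%:M w s (adj c E *m X) n = adj c E *m ladder Pi w s X n.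
Proof.
move=> PiPi sX; elim: n => //= n ->.
by rewrite raise_parallel //; exact: ladder_sec.
Qed.

End Conjugation.

(** * The chain of an eigenvector and its Gram matrices *)

Lemma q_cancel (A : comNzRingType) (w : wirtinger A) m n k (X : 'M[A]_(m, n)) :
  (1 + zc w * zb w) ^+ k *: X = 0 -> X = 0.
Proof.
move=> h; rewrite -[X]scale1r -(expr1n _ k) -(rhoP w) exprMn -scalerA h.
by rewrite scaler0.
Qed.

Lemma nat_cancel (A : comNzRingType) (inv : nat -> A) (invP : natinv inv)
   m n k (X : 'M[A]_(m, n)) : (0 < k)%N -> k%:R *: X = 0 -> X = 0.
Proof.
case: k => // k _ h; rewrite -[X]scale1r -(invP k) mulrC -scalerA h.
by rewrite scaler0.
Qed.

(** For [m = 0] this is what [parallel_section] needs; for [m = k] it bounds the degree in [zc]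
    of the lowest vector of the chain below. *)
Lemma ladder_iter0 (A : comNzRingType) (w : wirtinger A) N p (Pi : 'M[A]_N)
    (X : 'M[A]_(N, p)) m k : Pi *m Pi = Pi -> Pi *m X = X ->
    ladder Pi w (- m%:R) X (m + k).+1 = 0 ->
  iter (m + k).+1 (@nabla A N Pi (del w) p) ((1 + zc w * zb w) ^+ k *: X) = 0.
Proof.
move=> PiPi sX; rewrite ladder_closed // => /q_cancel.
rewrite exprD mulrAC -exprMn [(1 + _) * rho w]mulrC rhoP expr1n mul1r //.
Qed.

Lemma trmx_scale (A : comNzRingType) m n a (X : 'M[A]_(m, n)) :
  (a *: X)^T = a *: X^T.
Proof. by apply/matrixP => i j; rewrite !mxE. Qed.

Section Rigidity.
Variables (A : comNzRingType) (inv : nat -> A) (invP : natinv inv).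
Variables (N l : nat) (w : wirtinger A) (c : conjugation w).
Variable (u : 'rV[A]_N).

Local Notation q := (1 + zc w * zb w).
Local Notation up s := (raise (N := 1) 1%:M w s).
Local Notation down s := (raise (N := 1) 1%:M (swapw w) (- s)).
Local Notation lad := (ladder (N := 1) 1%:M w).
Local Notation ladb := (ladder (N := 1) 1%:M (swapw w)).

Hypothesis l_gt0 : (0 < l)%N.
Hypothesis u_eigen : down 1 (up 0 u) = - (l * l.+1)%:R *: u.
Hypothesis u_top : lad 0 u l.+1 = 0.
Hypothesis u_bot : ladb 0 u l.+1 = 0.
Hypothesis uu : u *m u^T = 0.
Hypothesis u_unit : u *m adj c u = 2%:M.
Hypothesis uz : map_mx (del w) u *m adj c u = 0.

Lemma map_der_1 d : map_mx (der_fun d) (1%:M : 'M[A]_1) = 0.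
Proof. by apply/matrixP => i j; rewrite !mxE der_nat. Qed.

Let fl1 : flat (1%:M : 'M[A]_1) w.
Proof. by rewrite /flat !map_der_1 !mulmx0 !mul0mx. Qed.
Let fl1s := flat_swap fl1.
Let one1 : 1%:M *m 1%:M = 1%:M :> 'M[A]_1. Proof. exact: mul1mx. Qed.

Lemma upE s (X : 'rV[A]_N) : q *: map_mx (del w) X = up s X - (s * zb w) *: X.
Proof. by rewrite /raise /nabla mul1mx addrK. Qed.

Lemma downE s (X : 'rV[A]_N) : q *: map_mx (delb w) X = down s X + (s * zc w) *: X.
Proof. by rewrite /raise /nabla /= mul1mx mulNr scaleNr [zb w * _]mulrC subrK. Qed.

(** [u] has weight 0, and l lowerings bring it to weight - l. *)
Definition bot := ladb 0 u l.
(** The vectors of the (2 l + 1)-dimensional representation of sl(2) generated by the lowest one.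
    Starting there, rather than at [u] in the middle, makes the chain a single ladder. *)
Definition chain k := lad (- l%:R) bot k.

Lemma chainS k : chain k.+1 = up (- l%:R + k%:R) (chain k). Proof. by []. Qed.

(** The structure constants of the representation: lowering [chain k] gives minus this multiple
    of [chain k.-1]. *)
Definition lower_coef k : nat := k * ((2 * l).+1 - k).

Lemma chain_down k : (k <= (2 * l).+1)%N ->
  down (- l%:R + k%:R) (chain k) = - (lower_coef k)%:R *: chain k.-1.
Proof.
have d0 : down (- l%:R) bot = 0.
  by rewrite opprK -u_bot /= add0r.
case: k => [|k] kl; first by rewrite addr0 d0 /lower_coef mul0n oppr0 scale0r.
rewrite /chain (@ladder_lower _ _ _ _ _ one1 fl1 (- l%:R) (- (2 * l)%:R)) //.
- congr (_ *: _); rewrite /lower_coef subSS !natrM (natrB _ (_ : k <= 2 * l)%N) //.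
  by rewrite !natrM -[k.+1%:R]natr1; ring.
- by rewrite raddfN /= der_nat oppr0.
- by rewrite raddfN /= der_nat oppr0.
- by rewrite raddfN /= der_nat oppr0.
- by rewrite mul1mx.
rewrite raise_comm ?mul1mx ?d0 ?raise0 ?raddfN /= ?der_nat ?oppr0 ?add0r //.
by rewrite natrM mulrN.
Qed.

(** The l raisings undo the l lowerings up to the product of the scalars of [ladder_lower], which
    are nonzero. Only the nonvanishing of the product matters later, so it is not computed. *)
Lemma chain_unit : exists2 m, (0 < m)%N &
  exists e : bool, chain l = ((-1) ^+ e * m%:R) *: u.
Proof.
have u_eigen' : up (- (0 + 1)) (raise 1%:M (swapw w) 0 u) = - (l * l.+1)%:R *: u.
  have := @raise_comm _ _ _ _ _ one1 fl1 0 u.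
  rewrite !raddf0 mul1mx => /(_ erefl erefl erefl).
  by rewrite !add0r u_eigen mulr0 scale0r addr0 => <-.
suff H j : (j <= l)%N -> exists2 m, (0 < m)%N & exists e : bool,
    chain j = ((-1) ^+ e * m%:R) *: ladb 0 u (l - j).
  by have [m m0 [e ->]] := H l (leqnn l); exists m => //; exists e; rewrite subnn.
elim: j => [|j IH] jl.
  by exists 1%N => //; exists false; rewrite expr0 mulr1 scale1r subn0.
have [m m0 [e E]] := IH (ltnW jl).
(* With k = l - j - 1, this is the factor l (l + 1) - k (k + 1) = (l - k) (l + k + 1). *)
exists (m * ((l - (l - j.+1)) * (l + (l - j.+1).+1)))%N.
  by rewrite !muln_gt0 m0 /=; lia.
exists (~~ e); rewrite chainS E raiseZ ?mul1mx //; last first.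
  rewrite derM der_nat mulr0 addr0; case: (e); rewrite ?expr0 ?expr1 ?raddfN /= der1 ?oppr0 mul0r //.
have lj : (l - j = (l - j.+1).+1)%N by lia.
have -> : - l%:R + j%:R = - (0 + (l - j.+1).+1%:R) :> A.
  by rewrite -lj natrB ?(ltnW jl) //; ring.
rewrite lj; set n := (l - j.+1)%N.
have -> : up (- (0 + n.+1%:R)) (ladb 0 u n.+1) =
    (- (l * l.+1)%:R + 2 * n%:R * 0 + (n * n.+1)%:R) *: ladb 0 u n.
  apply: (@ladder_lower _ _ _ _ _ one1 fl1s 0 (- (l * l.+1)%:R) u n).
  - exact: raddf0.
  - exact: raddf0.
  - by rewrite raddfN /= der_nat oppr0.
  - by rewrite mul1mx.
  - exact: u_eigen'.
rewrite {}/n.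
rewrite scalerA; congr (_ *: _).
have lk : (l - j.+1 <= l)%N by lia.
move: (l - j.+1)%N lk => k lk.
rewrite !natrM (natrB _ lk) natrD -![_.+1%:R]natr1.
by case: (e); rewrite /= ?expr0 ?expr1; ring.
Qed.

(** Above the middle the chain is, by [chain_unit], the ladder of [u], which stops. *)
Lemma chain_top k : (2 * l < k)%N -> chain k = 0.
Proof.
have [m m0 [e E]] := chain_unit.
have H n : chain (l + n) = ((-1) ^+ e * m%:R) *: lad 0 u n.
  elim: n => [|n IH]; first by rewrite addn0 E.
  rewrite addnS chainS IH raiseZ ?mul1mx //; last first.
    by rewrite derM der_nat mulr0 addr0; case: (e); rewrite ?expr0 ?expr1 ?raddfN /= der1 ?oppr0 mul0r.
  by rewrite /=; congr (_ *: up _ _); rewrite natrD; ring.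
have H0 n : lad 0 u (l.+1 + n) = 0.
  elim: n => [|n IH]; first by rewrite addn0.
  rewrite addnS; change (up (0 + (l.+1 + n)%:R) (lad 0 u (l.+1 + n)) = 0).
  by rewrite IH raise0.
move=> kl; have -> : k = (l + (l.+1 + (k - (2 * l).+1)))%N by lia.
by rewrite H H0 scaler0.
Qed.

Let s_ k : A := - l%:R + k%:R.
Definition bil j k := chain j *m (chain k)^T.
Definition her j k := chain j *m adj c (chain k).

Lemma bilC j k : bil j k = bil k j.
Proof.
apply/matrixP => a b; rewrite !mxE !ord1; apply: eq_bigr => i _.
by rewrite !mxE mulrC.
Qed.

(** The derivative of a vanishing entry; the weight terms are multiples of the entry itself. *)
Lemma bil_up j k : bil j k = 0 -> bil j.+1 k + bil j k.+1 = 0.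
Proof.
move=> h; have := congr1 (fun X => q *: map_mx (del w) X) h.
rewrite map_derM map_mx0 scaler0 scalerDr scalemxAl scalemxAr map_der_tr.
rewrite -trmx_scale (upE (s_ j)) (upE (s_ k)) -!chainS.
rewrite [(chain k.+1 - _)^T]raddfB /= trmx_scale.
rewrite mulmxBl mulmxBr -!scalemxAl -!scalemxAr -/(bil j k) h !scaler0 !subr0.
by [].
Qed.

Lemma bil_down j k : (j <= (2 * l).+1)%N -> (k <= (2 * l).+1)%N -> bil j k = 0 ->
  (lower_coef j)%:R *: bil j.-1 k + (lower_coef k)%:R *: bil j k.-1 = 0.
Proof.
move=> jl kl h; have := congr1 (fun X => q *: map_mx (delb w) X) h.
rewrite map_derM map_mx0 scaler0 scalerDr scalemxAl scalemxAr map_der_tr.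
rewrite -trmx_scale (downE (s_ j)) (downE (s_ k)) !chain_down //.
rewrite [(_ + (_ * _) *: chain k)^T]raddfD /= !trmx_scale.
rewrite mulmxDl mulmxDr -!scalemxAl -!scalemxAr -/(bil j k) h !scaler0 !addr0.
by rewrite !scaleNr -opprD => /eqP; rewrite oppr_eq0 => /eqP.
Qed.

Lemma bil_top j k : (2 * l < j)%N -> bil j k = 0.
Proof. by move=> jl; rewrite /bil chain_top // mul0mx. Qed.

Lemma lower_coef_gt0 k : (0 < k <= 2 * l)%N -> (0 < lower_coef k)%N.
Proof. by rewrite /lower_coef muln_gt0; lia. Qed.

(** In the middle, [bil_up] at (l, l) and the symmetry of the Gram matrix give twice
    [bil l.+1 l] equal to 0. From there lowering and raising in turn go down the antidiagonals
    of index sum 2 l and 2 l + 1. *)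
Lemma bil_mid i : (i <= l)%N -> bil (l + i) (l - i) = 0 /\ bil (l + i).+1 (l - i) = 0.
Proof.
elim: i => [|i IH] il.
  have [m m0 [e E]] := chain_unit.
  have h : bil l l = 0.
    rewrite /bil E trmx_scale -scalemxAl -scalemxAr uu !scaler0 //.
  rewrite addn0 subn0; split=> //.
  have := bil_up h; rewrite [bil l l.+1]bilC -mulr2n -scaler_nat.
  exact: (nat_cancel invP).
have [h1 h2] := IH (ltnW il).
have e : bil (l + i).+1 (l - i.+1) = 0.
  have := bil_down (_ : (l + i).+1 <= _)%N (_ : l - i <= _)%N h2.
  rewrite /= h1 scaler0 add0r subnS => /(_ _ _)/(nat_cancel invP); apply; try by lia.
  by apply: lower_coef_gt0; lia.
rewrite addnS; split=> //.
have := bil_up e; have -> : (l - i.+1).+1 = (l - i)%N by lia.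
by rewrite h2 addr0.
Qed.

(** All entries of index sum 2 l vanish by [bil_mid]; raising reaches the larger index sums and
    lowering the smaller ones. *)
Lemma bil0 j k : bil j k = 0.
Proof.
have H0 a b : (a + b = 2 * l)%N -> bil a b = 0.
  move=> ab; wlog le : a b ab / (l <= a)%N.
    move=> W; case: (leqP l a) => [|al]; first exact: W.
    by rewrite bilC W //; lia.
  have /bil_mid[h _] : (a - l <= l)%N by lia.
  by move: h; rewrite subnKC //; have -> : (l - (a - l) = b)%N by lia.
have Hup m a b : (a + b = 2 * l + m)%N -> bil a b = 0.
  elim: m a b => [|m IH] a b; first by rewrite addn0; exact: H0.
  elim: b a => [|b IHb] a ab; first by apply: bil_top; lia.
  have := bil_up (IH a b _); rewrite IHb; first by rewrite add0r; apply; lia.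
  by lia.
have Hdn m a b : (m <= 2 * l)%N -> (a + b + m = 2 * l)%N -> bil a b = 0.
  elim: m a b => [|m IH] a b ml; first by rewrite addn0; exact: H0.
  elim: a b => [|a IHa] b ab.
    have := bil_down (_ : 0 <= _)%N (_ : b.+1 <= _)%N (IH 0%N b.+1 _ _).
    rewrite {1}/lower_coef mul0n scale0r add0r => /(_ _ _ _ _)/(nat_cancel invP).
    by apply; try lia; apply: lower_coef_gt0; lia.
  have := bil_down (_ : a.+1 <= _)%N (_ : b.+1 <= _)%N (IH a.+1 b.+1 _ _).
  rewrite /= IHa ?scaler0 ?add0r => [/(_ _ _ _ _)/(nat_cancel invP)|]; last by lia.
  by apply; try lia; apply: lower_coef_gt0; lia.
case: (leqP (2 * l) (j + k)) => jk.
  by apply: (Hup (j + k - 2 * l)%N); lia.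
by apply: (Hdn (2 * l - (j + k))%N); lia.
Qed.

Lemma her_adj j k : her j k = adj c (her k j).
Proof. by rewrite /her adjM adjK. Qed.

Lemma cj_nat m : c m%:R = m%:R. Proof. exact: rmorph_nat. Qed.

Lemma cj_s k : c (s_ k) = s_ k.
Proof. by rewrite /s_ rmorphD rmorphN /= !cj_nat. Qed.

Lemma cj_q : c q = q.
Proof. by rewrite rmorphD rmorph1 rmorphM /= cj_z cj_zb mulrC. Qed.

Lemma her_del j k : (k <= (2 * l).+1)%N ->
  q *: map_mx (del w) (her j k) = her j.+1 k - (lower_coef k)%:R *: her j k.-1
     + ((s_ k - s_ j) * zb w) *: her j k.
Proof.
move=> kl; rewrite map_derM scalerDr scalemxAl scalemxAr del_adj.
have -> : q *: adj c (map_mx (delb w) (chain k)) = adj c (q *: map_mx (delb w) (chain k)).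
  by rewrite adjZ cj_q.
rewrite (upE (s_ j)) (downE (s_ k)) -!chainS chain_down // adjD !adjZ.
rewrite [c (- _)]rmorphN [c (s_ k * _)]rmorphM cj_s cj_z cj_nat mulmxBl mulmxDr -!scalemxAl -!scalemxAr.
rewrite -/(her j k) -/(her j.+1 k) -/(her j k.-1) mulrBl scalerBl scaleNr.
by rewrite addrACA [- (_ *: _) + _ *: _]addrC !addrA addrAC.
Qed.

Lemma her_up j k : (k <= (2 * l).+1)%N ->
  map_mx (del w) (her j k) = 0 -> j = k \/ her j k = 0 ->
  her j.+1 k = (lower_coef k)%:R *: her j k.-1.
Proof.
move=> kl h0 jk; have := her_del j kl; rewrite h0 scaler0.
have -> : ((s_ k - s_ j) * zb w) *: her j k = 0.
  by case: jk => [->|->]; rewrite ?scaler0 // subrr mul0r scale0r.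
by rewrite addr0 => /esym/eqP; rewrite subr_eq0 => /eqP.
Qed.

Lemma her_down j k : (j <= (2 * l).+1)%N -> her j k = 0 ->
  her j k.+1 = (lower_coef j)%:R *: her j.-1 k.
Proof.
move=> jl h; have h' : her k j = 0 by rewrite her_adj h adj0.
rewrite her_adj (@her_up k j) //; [|by rewrite h' map_mx0|by right].
by rewrite adjZ cj_nat -her_adj.
Qed.

Let cst (X : 'M[A]_1) := map_mx (del w) X = 0.

Lemma cst_divn m (X Y : 'M[A]_1) : (0 < m)%N -> cst X -> X = m%:R *: Y -> cst Y.
Proof.
move=> m0 + E; rewrite /cst E map_derZ der_nat scale0r add0r.
exact: (nat_cancel invP).
Qed.

(** In the middle, the norm is constant by [u_unit], and the derivative of [u] is orthogonal to
    [u] by [uz]. *)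
Lemma her_mid : cst (her l l) /\ (her l.+1 l = 0 /\ her l l.-1 = 0).
Proof.
have [m m0 [e E]] := chain_unit.
have dE : del w ((-1) ^+ e * m%:R) = 0.
  by rewrite derM der_nat mulr0 addr0; case: (e); rewrite ?expr0 ?expr1 ?raddfN /= der1 ?oppr0 mul0r.
have dbE : delb w ((-1) ^+ e * m%:R) = 0.
  by rewrite derM der_nat mulr0 addr0; case: (e); rewrite ?expr0 ?expr1 ?raddfN /= der1 ?oppr0 mul0r.
have hll : cst (her l l).
  rewrite /cst /her E adjZ -scalemxAl -scalemxAr u_unit.
  rewrite map_derZ dE scale0r add0r map_derZ.
  rewrite -cj_delb dbE rmorph0 scale0r add0r.
  have -> : map_mx (del w) (2%:M : 'M[A]_1) = 0.
    by apply/matrixP => i j; rewrite !mxE raddfMn /= der_nat mul0rn.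
  by rewrite !scaler0.
have h1 : her l.+1 l = 0.
  rewrite /her chainS addrC subrr E raiseZ ?mul1mx // adjZ -scalemxAl -scalemxAr.
  rewrite /raise mul0r scale0r addr0 /nabla mul1mx -scalemxAl uz.
  by rewrite !scaler0.
split=> //; split=> //.
have l2 : (l <= (2 * l).+1)%N by lia.
have := her_up l2 hll (or_introl erefl); rewrite h1 => /esym/(nat_cancel invP).
by apply; apply: lower_coef_gt0; lia.
Qed.

(** A constant diagonal entry makes the next off-diagonal entry a multiple of the previous
    one, and a vanishing off-diagonal entry makes the next diagonal entry constant. *)
Lemma her_high i : (i <= l)%N -> cst (her (l + i) (l + i)) /\ her (l + i).+1 (l + i) = 0.
Proof.
elim: i => [|i IH] il; first by have [? [? _]] := her_mid; rewrite addn0.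
have [h1 h2] := IH (ltnW il); rewrite addnS.
have jl : ((l + i).+1 <= (2 * l).+1)%N by lia.
have h3 : cst (her (l + i).+1 (l + i).+1).
  rewrite her_down // /cst map_derZ der_nat h1 scaler0 scale0r addr0 //.
split=> //; rewrite her_up //; last by left.
by rewrite h2 scaler0.
Qed.

Lemma her_low i : (i <= l)%N -> cst (her (l - i) (l - i)) /\ ((i < l)%N -> her (l - i) (l - i).-1 = 0).
Proof.
elim: i => [|i IH] il; first by have [? [_ ?]] := her_mid; rewrite subn0.
have [h1 h2] := IH (ltnW il); have {}h2 := h2 il.
have E : (l - i = (l - i.+1).+1)%N by lia.
rewrite E /= in h2.
have h3 : cst (her (l - i.+1) (l - i.+1)).
  have h2' : her (l - i.+1) (l - i.+1).+1 = 0 by rewrite her_adj h2 adj0.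
  have jl : ((l - i.+1).+1 <= (2 * l).+1)%N by lia.
  have := her_up jl _ (or_intror h2'); rewrite h2' map_mx0 => /(_ erefl) e.
  rewrite E in h1; apply: cst_divn h1 e.
  by apply: lower_coef_gt0; lia.
split=> // il'.
have jl : (l - i.+1 <= (2 * l).+1)%N by lia.
have := her_up jl h3 (or_introl erefl); rewrite h2 => /esym/(nat_cancel invP).
by apply; apply: lower_coef_gt0; lia.
Qed.

Lemma her_next k : her k.+1 k = 0.
Proof.
case: (leqP l k) => lk.
  case: (leqP k (2 * l)) => k2; last by rewrite /her chain_top ?mul0mx //; lia.
  have /her_high[_] : (k - l <= l)%N by lia.
  by rewrite subnKC.
have /her_low[_ +] : (l - k.+1 <= l)%N by lia.
have -> : (l - (l - k.+1) = k.+1)%N by lia.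
by apply; lia.
Qed.

Lemma her_diag k : (k <= 2 * l)%N ->
  her k.+1 k.+1 = (lower_coef k.+1)%:R *: her k k.
Proof. by move=> kl; rewrite her_down ?her_next. Qed.

(** Induction on the distance to the diagonal, then on the smaller index, with [her_next] as the
    base case. *)
Lemma her_off j k : j != k -> her j k = 0.
Proof.
wlog jk : j k / (k < j)%N.
  move=> W; case: (ltngtP j k) => // jk _; last by apply: W; rewrite // gtn_eqF.
  by rewrite her_adj W ?adj0 // gtn_eqF.
move=> _; have -> : j = (k + (j - k.+1)).+1 by lia.
move: (j - k.+1)%N => m {j jk}; elim: m k => [|m IH] k; first by rewrite addn0 her_next.
elim: k => [|k IHk].
  have h := IH 0%N; rewrite add0n in h; rewrite add0n her_up //.
  - by rewrite /lower_coef mul0n scale0r.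
  - by rewrite h map_mx0.
  - by right.
case: (leqP k.+1 (2 * l).+1) => kl.
  have h := IH k.+1; rewrite addnS her_up //.
  - by rewrite addSnnS /= IHk scaler0.
  - by rewrite h map_mx0.
  - by right.
by rewrite /her chain_top ?mul0mx //; lia.
Qed.

End Rigidity.

(** * The chain in terms of binary forms *)

Section PolyDerivation.
Variables (A : comNzRingType) (d : derivation A).

Lemma polyderM (P Q : {poly A}) :
  map_poly d (P * Q) = map_poly d P * Q + P * map_poly d Q.
Proof.
apply/polyP => k; rewrite coefD !coefM coef_map_id0 ?raddf0 // coefM raddf_sum.
rewrite -big_split /=; apply: eq_bigr => i _.
by rewrite derM !coef_map_id0 ?raddf0.
Qed.

(** Differentiation of the coefficients; the variable of the polynomials is a constant. *)
Definition polyder : derivation {poly A} :=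
  Derivation (der_fun := map_poly d) polyderM.

Lemma polyderC a : polyder a%:P = (d a)%:P.
Proof. by apply/polyP => k; rewrite coef_map_id0 ?raddf0 // !coefC; case: ifP; rewrite ?raddf0. Qed.

Lemma polyderXn : polyder 'X = 0.
Proof. by apply/polyP => k; rewrite coef_map_id0 ?raddf0 // coefX coef0 der_nat. Qed.

End PolyDerivation.

(** The binary form x^l y^l moved by the unitary matrix over the point z, up to the factor
    [rho w ^+ l], in the basis of monomials. With this factor, the coefficients are spherical
    harmonics of degree l. *)
Definition weight_poly (A : comNzRingType) (w : wirtinger A) l : {poly A} :=
  (1 + (zc w)%:P * 'X) ^+ l * ('X - (zb w)%:P) ^+ l.

Section NormalForm.
Variables (A : comNzRingType) (inv : nat -> A) (invP : natinv inv).
Variables (N l : nat) (w : wirtinger A) (c : conjugation w).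
Variable (u : 'rV[A]_N).

Local Notation q := (1 + zc w * zb w).
Local Notation up s := (raise (N := 1) 1%:M w s).
Local Notation down s := (raise (N := 1) 1%:M (swapw w) (- s)).
Local Notation lad := (ladder (N := 1) 1%:M w).
Local Notation ladb := (ladder (N := 1) 1%:M (swapw w)).

Hypothesis l_gt0 : (0 < l)%N.
Hypothesis u_eigen : down 1 (up 0 u) = - (l * l.+1)%:R *: u.
Hypothesis u_top : lad 0 u l.+1 = 0.
Hypothesis u_bot : ladb 0 u l.+1 = 0.
Hypothesis uu : u *m u^T = 0.
Hypothesis u_unit : u *m adj c u = 2%:M.
Hypothesis uz : map_mx (del w) u *m adj c u = 0.

Local Notation chain := (chain l w u).
Local Notation bot := (bot l w u).

(** The vanishing of the next lowering makes (1 + |z|^2)^l [bot] holomorphic, and the vanishing of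
    [chain] above 2 l bounds its degree. The binomial coefficients are extracted so that the
    coefficients [g k] correspond to monomials. *)
Lemma bot_polynomial : exists g : nat -> 'rV[A]_N,
  [/\ forall k, map_mx (del w) (g k) = 0, forall k, map_mx (delb w) (g k) = 0
   & q ^+ l *: bot = \sum_(k < (2 * l).+1) (zc w ^+ k * 'C(2 * l, k)%:R) *: g k].
Proof.
have one1 : 1%:M *m 1%:M = 1%:M :> 'M[A]_1 by exact: mul1mx.
have h1 : iter (l + l).+1 (map_mx (del w)) (q ^+ l *: bot) = 0.
  have := @ladder_iter0 A w 1 N 1%:M bot l l one1.
  rewrite mul1mx => /(_ erefl); rewrite -[ladder _ _ _ _ _]/(chain (l + l).+1).
  rewrite (chain_top l_gt0 u_eigen u_top) //; last by lia.
  move=> /(_ erefl) <-; apply: eq_iter => X; by rewrite /nabla mul1mx.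
have h2 : map_mx (delb w) (q ^+ l *: bot) = 0.
  apply: (@q_cancel _ w _ _ 1); rewrite expr1 map_derZ scalerDr scalerA.
  have -> : q * delb w (q ^+ l) = l%:R * zc w * q ^+ l.
    case: (l) => [|k]; first by rewrite expr0 der1; ring.
    by rewrite derX delb_q exprS; ring.
  have -> : q *: (q ^+ l *: map_mx (delb w) bot) = q ^+ l *: (q *: map_mx (delb w) bot).
    by rewrite !scalerA mulrC.
  rewrite (downE w (- l%:R)).
  have -> : down (- l%:R) bot = 0 by rewrite opprK -u_bot /= add0r.
  by rewrite add0r scalerA -scalerDl [X in X *: _](_ : _ = 0) ?scale0r //; ring.
have [g0 [g0z g0b ->]] := holomorphic_polynomial invP h1 h2.
exists (fun k => inv ('C(2 * l, k)).-1 *: g0 k); split=> [k|k|].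
- by rewrite map_derZ der_invn // scale0r g0z scaler0 addr0.
- by rewrite map_derZ der_invn // scale0r g0b scaler0 addr0.
rewrite addnn -mul2n; apply: eq_bigr => k _; rewrite scalerA -mulrA.
rewrite -{1}(prednK (_ : 0 < 'C(2 * l, k))%N) ?invP ?mulr1 //.
by rewrite bin_gt0 -ltnS.
Qed.

Variable g : nat -> 'rV[A]_N.
Hypothesis g_z : forall k, map_mx (del w) (g k) = 0.
Hypothesis botE :
  q ^+ l *: bot = \sum_(k < (2 * l).+1) (zc w ^+ k * 'C(2 * l, k)%:R) *: g k.

(** The linear map from binary forms of degree 2 l that sends the k-th monomial to [g k]. *)
Definition Phi (P : {poly A}) := \sum_(k < (2 * l).+1) P`_k *: g k.

(** The weight vectors x^(2l-i) y^i moved by the unitary matrix over the point. *)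
Definition gen i : {poly A} :=
  (1 + (zc w)%:P * 'X) ^+ (2 * l - i) * ('X - (zb w)%:P) ^+ i.

Lemma PhiD P Q : Phi (P + Q) = Phi P + Phi Q.
Proof. by rewrite /Phi -big_split; apply: eq_bigr => k _; rewrite coefD scalerDl. Qed.

Lemma PhiZ a P : Phi (a *: P) = a *: Phi P.
Proof. by rewrite /Phi scaler_sumr; apply: eq_bigr => k _; rewrite coefZ scalerA. Qed.

Lemma del_Phi P : map_mx (del w) (Phi P) = Phi (polyder (del w) P).
Proof.
rewrite /Phi map_mx_sum; apply: eq_bigr => k _.
by rewrite map_derZ g_z scaler0 addr0 /= coef_map_id0 ?raddf0.
Qed.

Lemma gen_step i : (i < 2 * l)%N ->
  q *: polyder (del w) (gen i) - ((2 * l - i)%:R * zb w) *: gen i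
  = (2 * l - i)%:R *: gen i.+1.
Proof.
move=> il; have [n n1 n2] : exists2 n, (2 * l - i = n.+1)%N & (2 * l - i.+1 = n)%N.
  by exists (2 * l - i.+1)%N; lia.
rewrite /gen n1 n2 derM derX.
set D := polyder (del w); set a := 1 + (zc w)%:P * 'X; set b : {poly A} := 'X - (zb w)%:P.
have Da : D a = 'X.
  by rewrite /a derD der1 derM polyderC polyderXn del_z; ring.
have Db : D b = 0.
  by rewrite /b derB polyderXn polyderC del_zb subr0.
have Dbi : D (b ^+ i) = 0.
  by case: (i) => [|k]; rewrite ?expr0 ?der1 // derX Db mulr0.
rewrite Da Dbi mulr0 addr0 !exprS -!mul_polyC.
rewrite !rmorphM !rmorphD /= !rmorph1 rmorphM !rmorph_nat /= /a /b.
by ring.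
Qed.

Lemma del_rho : del w (rho w) = - (rho w ^+ 2 * zb w).
Proof.
have := congr1 (del w) (rhoP w); rewrite der1 derM del_q => h.
transitivity ((del w (rho w) * q + rho w * zb w) * rho w - rho w ^+ 2 * zb w
   + del w (rho w) * (1 - rho w * q)); first by ring.
by rewrite h rhoP; ring.
Qed.

(** [Phi] intertwines raising with the passage from [gen i] to [gen i.+1] (which is [gen_step]),
    so that the lowest vector determines the whole chain. *)
Lemma chain_gen i : (i <= 2 * l)%N ->
  chain i = ((2 * l) ^_ i)%:R *: (rho w ^+ l *: Phi (gen i)).
Proof.
have rl : rho w ^+ l * q ^+ l = 1 by rewrite -exprMn rhoP expr1n.
elim: i => [|i IH] il.
  rewrite ffactn0 scale1r -[LHS]scale1r -rl -scalerA; congr (_ *: _).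
  rewrite botE; apply: eq_bigr => k _; congr (_ *: _).
  rewrite /gen subn0 mulr1 exprDn.
  rewrite coef_sum (bigD1 (inord k)) //= inordK // big1 => [|j jk].
    by rewrite expr1n mul1r exprMn -polyC_exp coefMn coefCM coefXn eqxx mulr1 mulr_natr addr0.
  rewrite expr1n mul1r exprMn -polyC_exp coefMn coefCM coefXn.
  suff -> : (k == j :> nat) = false by rewrite mulr0 mul0rn.
  by apply: contraNF jk => /eqP E; apply/eqP/val_inj; rewrite /= inordK ?E ?ltn_ord // -E.
rewrite chainS IH ?(ltnW il) // raiseZ ?der_nat ?mul1mx //.
rewrite ffactnSr natrM -scalerA; congr (_ *: _).
rewrite /raise /nabla mul1mx map_derZ del_Phi.
have -> : del w (rho w ^+ l) = - (l%:R * zb w) * (rho w * rho w ^+ l).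
  case: (l) => [|k]; first by rewrite expr0 der1; ring.
  by rewrite derX del_rho !exprS; ring.
have -> : (2 * l - i)%:R *: (rho w ^+ l *: Phi (gen i.+1)) = rho w ^+ l *:
   (q *: Phi (polyder (del w) (gen i)) - ((2 * l - i)%:R * zb w) *: Phi (gen i)).
  rewrite -!PhiZ scalerA mulrC -scalerA PhiZ; congr (_ *: _).
  by rewrite -gen_step // PhiD -scaleNr !PhiZ scaleNr.
have -> : (2 * l - i)%:R = 2 * l%:R - i%:R :> A by rewrite natrB ?natrM // ltnW.
move: (Phi _) (Phi _) => Y X; apply/matrixP => a b; rewrite !mxE.
move: (rho w ^+ l) => r; have rq := rhoP w.
transitivity (q * r * Y a b + (- l%:R * (rho w * q) + (- l%:R + i%:R)) * zb w * r * X a b).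
  by ring.
by rewrite rq; ring.
Qed.

(** At the origin [gen i] is a monomial, so the constant vectors [g i] inherit the Gram relations
    of the chain. *)
Lemma ev_gen (C : comNzRingType) (ev : {rmorphism A -> C}) i :
  ev (zc w) = 0 -> ev (zb w) = 0 -> (i <= 2 * l)%N ->
  map_mx ev (chain i) = ((2 * l) ^_ i)%:R *: map_mx ev (g i).
Proof.
move=> e0 e1 il; have er : ev (rho w) = 1.
  by have := congr1 ev (rhoP w); rewrite rmorphM rmorphD rmorphM /= e0 e1 rmorph1 mulr0 addr0 mulr1.
rewrite chain_gen // !map_mxZ rmorph_nat rmorphXn er expr1n scale1r; congr (_ *: _).
rewrite /Phi map_mx_sum (bigD1 (inord i)) //= inordK // big1 ?addr0 => [|k ki].
  rewrite map_mxZ -coef_map /gen rmorphM !rmorphXn rmorphD rmorphB rmorphM /= !map_polyC !map_polyX /=.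
  by rewrite e0 e1 rmorph1 mul0r addr0 subr0 expr1n mul1r coefXn eqxx scale1r.
rewrite map_mxZ -coef_map /gen rmorphM !rmorphXn rmorphD rmorphB rmorphM /= !map_polyC !map_polyX /=.
rewrite e0 e1 rmorph1 mul0r addr0 subr0 expr1n mul1r coefXn.
suff -> : (k == i :> nat) = false by rewrite scale0r.
by apply: contraNF ki => /eqP E; apply/eqP/val_inj; rewrite /= inordK ?E.
Qed.

End NormalForm.

(** [u] is a nonzero multiple of [chain l], which [chain_gen] expresses through the constants, and
    the Gram matrices of the chain are known and can be read at the origin. The ring morphism
    [ev] is the evaluation there; it is only asked to kill both coordinates and to be
    compatible with conjugation. *)
Theorem ladder_normal_form (A : comNzRingType) (inv : nat -> A) (invP : natinv inv)
  (N l : nat) (w : wirtinger A) (c : conjugation w) (u : 'rV[A]_N)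
  (l_gt0 : (0 < l)%N)
  (u_eigen : raise (N := 1) 1%:M (swapw w) (- 1) (raise (N := 1) 1%:M w 0 u) =
     - (l * l.+1)%:R *: u)
  (u_top : ladder (N := 1) 1%:M w 0 u l.+1 = 0)
  (u_bot : ladder (N := 1) 1%:M (swapw w) 0 u l.+1 = 0)
  (uu : u *m u^T = 0)
  (u_unit : u *m adj c u = 2%:M)
  (uz : map_mx (del w) u *m adj c u = 0) :
  exists g : nat -> 'rV[A]_N,
  [/\ forall k, map_mx (del w) (g k) = 0, forall k, map_mx (delb w) (g k) = 0,
      u = rho w ^+ l *: \sum_(k < (2 * l).+1) (weight_poly w l)`_k *: g k
    & forall (C : comNzRingType) (ev : {rmorphism A -> C}) (cC : {rmorphism C -> C}),
      ev (zc w) = 0 -> ev (zb w) = 0 -> (forall a, ev (c a) = cC (ev a)) ->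
      let G k := map_mx ev (g k) in
      [/\ forall j k, (j <= 2 * l)%N -> (k <= 2 * l)%N -> G j *m (G k)^T = 0,
          forall j k, (j <= 2 * l)%N -> (k <= 2 * l)%N -> j != k ->
            G j *m (map_mx cC (G k))^T = 0
        & forall k, (k < 2 * l)%N ->
            'C(2 * l, k.+1)%:R *: (G k.+1 *m (map_mx cC (G k.+1))^T) =
            'C(2 * l, k)%:R *: (G k *m (map_mx cC (G k))^T)]].
Proof.
have [g0 [g0z g0b botE]] := bot_polynomial invP l_gt0 u_eigen u_top u_bot.
have [m m0 [e E]] := chain_unit l_gt0 u_eigen.
(* The constant relating u to chain l is absorbed into the vectors g k. *)
pose kap : A := (-1) ^+ e * ((2 * l) ^_ l)%:R * inv m.-1.
have dkap (d : derivation A) : d kap = 0.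
  rewrite /kap !derM der_nat (der_invn invP).
  by case: (e) => /=; rewrite ?expr0 ?expr1 ?derN der1; ring.
exists (fun k => kap *: g0 k); split=> [k|k||].
- by rewrite map_derZ dkap g0z scale0r scaler0 addr0.
- by rewrite map_derZ dkap g0b scale0r scaler0 addr0.
- have l2 : (l <= 2 * l)%N by lia.
  have h := chain_gen l_gt0 g0z botE l2; rewrite E in h; have {h} := congr1 (fun X => ((-1) ^+ e * inv m.-1) *: X) h.
  rewrite scalerA; have -> : (-1) ^+ e * inv m.-1 * ((-1) ^+ e * m%:R) = 1.
    rewrite mulrACA -expr2 sqrr_sign mul1r mulrC -[X in X%:R](prednK m0).
    by rewrite mulrC mulrC invP.
  rewrite scale1r => uE; rewrite [LHS]uE.
  transitivity (rho w ^+ l *: (kap *: Phi l g0 (gen l w l))).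
    by rewrite !scalerA; congr (_ *: _); rewrite /kap; ring.
  congr (_ *: _); rewrite /Phi scaler_sumr; apply: eq_bigr => k _.
  rewrite !scalerA /gen /weight_poly; have -> : (2 * l - l = l)%N by lia.
  by rewrite mulrC.
move=> C ev cC e0 e1 ec G.
pose G0 k := map_mx ev (g0 k).
have GE k : G k = ev kap *: G0 k by rewrite /G map_mxZ.
have invC : natinv (ev \o inv).
  by move=> k /=; rewrite -(rmorph_nat ev) -rmorphM invP rmorph1.
pose F k : nat := (2 * l) ^_ k.
have F0 k : (k <= 2 * l)%N -> (0 < F k)%N by rewrite /F ffact_gt0.
have evchain k : (k <= 2 * l)%N -> map_mx ev (chain l w u k) = (F k)%:R *: G0 k.
  by move=> kl; rewrite (ev_gen l_gt0 g0z botE e0 e1 kl).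
have evadj X : map_mx ev (adj c X) = (map_mx cC (map_mx ev X))^T :> 'M[C]_(N, 1).
  by apply/matrixP => i j; rewrite !mxE ec.
have cCnat k : cC k%:R = k%:R by rewrite rmorph_nat.
have ccZ a (X : 'rV[C]_N) : (map_mx cC (a *: X))^T = cC a *: (map_mx cC X)^T.
  by apply/matrixP => i j; rewrite !mxE rmorphM.
have evher j k : (j <= 2 * l)%N -> (k <= 2 * l)%N ->
    map_mx ev (her l c u j k) = ((F j) * (F k))%:R *: (G0 j *m (map_mx cC (G0 k))^T).
  move=> jl kl; rewrite /her map_mxM evadj !evchain // ccZ cCnat.
  by rewrite -scalemxAl -scalemxAr scalerA natrM.
have G0her j k : (j <= 2 * l)%N -> (k <= 2 * l)%N -> j != k ->
    G0 j *m (map_mx cC (G0 k))^T = 0.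
  move=> jl kl jk; have := evher j k jl kl.
  rewrite (her_off invP l_gt0 u_eigen u_top u_bot u_unit uz) // map_mx0 => /esym/(nat_cancel invC); apply.
  by rewrite muln_gt0 !F0.
split.
- move=> j k jl kl; rewrite !GE trmx_scale -scalemxAl -scalemxAr.
  suff -> : G0 j *m (G0 k)^T = 0 by rewrite !scaler0.
  have : map_mx ev (bil l w u j k) = 0 by rewrite (bil0 invP l_gt0 u_eigen u_top u_bot) // map_mx0.
  rewrite /bil map_mxM -map_trmx !evchain // trmx_scale -scalemxAl -scalemxAr scalerA.
  by rewrite -natrM => /(nat_cancel invC); apply; rewrite muln_gt0 !F0.
- move=> j k jl kl jk; rewrite !GE ccZ -scalemxAl -scalemxAr.
  by rewrite G0her // !scaler0.
move=> k kl; rewrite !GE !ccZ -!scalemxAl -!scalemxAr.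
have := congr1 (map_mx ev) (her_diag invP l_gt0 u_eigen u_top u_bot u_unit uz (ltnW kl)).
rewrite map_mxZ rmorph_nat !evher // ?(ltnW kl) //.
move: (G0 k.+1 *m _) (G0 k *m _) => X Y; rewrite !scalerA => HX.
have binE := mul_bin_left (2 * l) k.
(* F k is the factor between the chain and the constant vectors at the origin; multiplying by
   these positive integers avoids divisions. *)
have M0 : (0 < F k * F k * (2 * l - k) * (2 * l - k))%N.
  by rewrite !muln_gt0 !F0 ?(ltnW kl) // subn_gt0 kl.
apply/eqP; rewrite -subr_eq0; apply/eqP; apply: (nat_cancel invC M0).
have FS : F k.+1 = (F k * (2 * l - k))%N by rewrite /F ffactnSr.
rewrite scalerBr; apply/eqP; rewrite subr_eq0; apply/eqP; rewrite !scalerA.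
have -> : (F k * F k * (2 * l - k) * (2 * l - k))%:R *
   ('C(2 * l, k.+1)%:R * ev kap * cC (ev kap)) =
   ('C(2 * l, k.+1)%:R * ev kap * cC (ev kap)) * (F k.+1 * F k.+1)%:R.
  by rewrite FS !natrM; ring.
rewrite -[LHS]scalerA HX scalerA; congr (_ *: _).
rewrite /lower_coef subSS !natrM.
have := congr1 (fun n => n%:R : C) binE; rewrite !natrM => bE.
transitivity (k.+1%:R * 'C(2 * l, k.+1)%:R * (2 * l - k)%:R * ev kap * cC (ev kap) *
   (F k)%:R * (F k)%:R); first by ring.
by rewrite bE; ring.
Qed.

(** * Normal form of a flat line bundle *)

Lemma del_rhoX (A : comNzRingType) (w : wirtinger A) n :
  del w (rho w ^+ n) = - (n%:R * zb w * rho w ^+ n.+1).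
Proof.
case: n => [|n]; first by rewrite expr0 der1; ring.
by rewrite derX del_rho !exprS; ring.
Qed.

Section Tensor.
Variables (A : comNzRingType) (w : wirtinger A) (N p : nat) (Pi : 'M[A]_N).
Variables (X : 'M[A]_(N, p)) (sX : Pi *m X = X).

(** A section of weight [n] times rho^n is the coefficient of a differential of order [n]. In this
    form the correction term has the factor rho zb, which vanishes at infinity. *)
Lemma tensor_raise n : rho w ^+ n.+1 *: raise Pi w n%:R X =
  nabla Pi (del w) (rho w ^+ n *: X) + (2 * n%:R * rho w * zb w) *: (rho w ^+ n *: X).
Proof.
rewrite /raise nablaZ // del_rhoX; move: (nabla _ _ _) => Y.
apply/matrixP => i j; rewrite !mxE; have rq := rhoP w.
transitivity (rho w ^+ n * (rho w * (1 + zc w * zb w)) * Y i j + rho w ^+ n.+1 * n%:R * zb w * X i j).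
  by rewrite !exprS; ring.
by rewrite rq !exprS; ring.
Qed.

Lemma tensor_holomorphic n : raise Pi (swapw w) (- n%:R) X = 0 ->
  nabla Pi (delb w) (rho w ^+ n *: X) = 0.
Proof.
move=> h; rewrite nablaZ //.
have -> : delb w (rho w ^+ n) = - (n%:R * zc w * rho w ^+ n.+1) := del_rhoX (swapw w) n.
transitivity (rho w ^+ n.+1 *: raise Pi (swapw w) (- n%:R) X); last by rewrite h scaler0.
rewrite /raise /=; move: (nabla _ _ _) => Y.
apply/matrixP => i j; rewrite !mxE; have rq := rhoP w.
transitivity (rho w ^+ n * (rho w * (1 + zc w * zb w)) * Y i j - rho w ^+ n.+1 * n%:R * zc w * X i j).
  by rewrite rq; ring.
by rewrite !exprS; ring.
Qed.

End Tensor.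

Section Frame.
Variables (A : comNzRingType) (inv : nat -> A) (invP : natinv inv).
Variables (N l : nat) (w : wirtinger A) (c : conjugation w) (Pi : 'M[A]_N).
Hypothesis PiPi : Pi *m Pi = Pi.
Hypothesis PiH : adj c Pi = Pi.
Hypothesis Pi_iso : Pi *m Pi^T = 0.
Hypothesis Pi_rank1 : forall X, Pi *m X *m Pi = \tr (Pi *m X) *: Pi.
Hypothesis Pi_flat : flat Pi w.
Hypothesis Pi_eigen : nabla Pi (del w) (nabla Pi (delb w) Pi) =
  - ((l * l.+1)%:R * rho w ^+ 2) *: Pi.

Lemma Pi_eigen_swap : nabla Pi (delb w) (nabla Pi (del w) Pi) =
  - ((l * l.+1)%:R * rho w ^+ 2) *: Pi.
Proof. by rewrite -nabla_comm. Qed.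

Lemma raise_Pi : raise Pi (swapw w) (- 1) (raise Pi w 0 Pi) = - (l * l.+1)%:R *: Pi.
Proof.
rewrite /raise /= mul0r scale0r addr0 nablaZ ?nabla_sec //.
rewrite delb_q Pi_eigen_swap; move: (nabla _ _ _) => X.
apply/matrixP => i j; rewrite !mxE; have rq := rhoP w.
transitivity (- ((rho w * (1 + zc w * zb w)) ^+ 2 * (l * l.+1)%:R) * Pi i j).
  by ring.
by rewrite rq expr1n mul1r.
Qed.

(** Lowering [ladder k.+1] gives the multiple - l (l + 1) + k (k + 1) of [ladder k], which is zero
    for [k = l]. *)
Lemma Pi_tensor_holomorphic :
  nabla Pi (delb w) (rho w ^+ l.+1 *: ladder Pi w 0 Pi l.+1) = 0.
Proof.
apply: tensor_holomorphic; first exact: ladder_sec.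
have := @ladder_lower _ _ _ _ _ PiPi Pi_flat 0 (- (l * l.+1)%:R) Pi l.
rewrite !der0 derN der_nat oppr0 !add0r raise_Pi => -> //.
by rewrite mulr0 addr0 addNr scale0r.
Qed.

Variables (C : comNzRingType) (ev : {rmorphism A -> C}).
Hypothesis ev_z : ev (zc w) = 0.
Hypothesis ev_zb : ev (zb w) = 0.
Hypothesis ev_const : forall a, del w a = 0 -> delb w a = 0 -> ev a = 0 -> a = 0.
Hypothesis Pi_top : ladder Pi w 0 Pi l.+1 = 0.
Hypothesis Pi_bot : ladder Pi (swapw w) 0 Pi l.+1 = 0.
Variable E0 : 'cV[A]_N.
Hypothesis E0z : map_mx (del w) E0 = 0.
Hypothesis E0zb : map_mx (delb w) E0 = 0.
Hypothesis E0_sec : map_mx ev (Pi *m E0) = map_mx ev E0.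
Hypothesis E0_norm : map_mx ev (adj c E0 *m E0) = 2%:M.
Hypothesis ev_cj : forall a b, ev a = ev b -> ev (c a) = ev (c b).

(** The section (1 + |z|^2)^l Pi satisfies the hypotheses of [parallel_section] since both ladders
    stop; the resulting parallel section is applied to a vector of the fibre over the origin. Its norm
    is constant, hence equal to its value there. *)
Lemma parallel_frame : exists E : 'cV[A]_N,
  [/\ Pi *m E = E, nabla Pi (del w) E = 0, nabla Pi (delb w) E = 0,
      adj c E *m E = 2%:M & E *m adj c E = 2%:R *: Pi].
Proof.
have oppr0' : - 0%:R = 0 :> A by rewrite oppr0.
have sZ : Pi *m ((1 + zc w * zb w) ^+ l *: Pi) = (1 + zc w * zb w) ^+ l *: Pi.
  by rewrite -scalemxAr PiPi.
have top : iter l.+1 (@nabla A N Pi (del w) N) ((1 + zc w * zb w) ^+ l *: Pi) = 0.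
  by have := @ladder_iter0 A w N N Pi Pi 0 l PiPi PiPi; rewrite oppr0'; apply.
have bot : iter l.+1 (@nabla A N Pi (delb w) N) ((1 + zc w * zb w) ^+ l *: Pi) = 0.
  have := @ladder_iter0 A (swapw w) N N Pi Pi 0 l PiPi PiPi.
  by rewrite oppr0' [zc w * _]mulrC; apply.
have [Y [sY Yz Yzb evY]] := parallel_section invP PiPi Pi_flat sZ top bot.
pose E := Y *m E0.
have sE : Pi *m E = E by rewrite /E mulmxA sY.
have nE d : map_mx (der_fun d) E0 = 0 -> nabla Pi d Y = 0 -> nabla Pi d E = 0.
  by move=> h0 h; rewrite /nabla /E map_derM h0 mulmx0 addr0 mulmxA -/(nabla Pi d Y) h mul0mx.
have Ez := nE _ E0z Yz; have Ezb := nE _ E0zb Yzb.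
have evE : map_mx ev E = map_mx ev E0.
  rewrite map_mxM (evY _ ev) // map_mxZ rmorphXn rmorphD rmorphM /= ev_z mul0r addr0.
  by rewrite rmorph1 expr1n scale1r -map_mxM E0_sec.
clearbody E.
have EE : adj c E *m E = 2%:M.
  have h1 : map_mx (del w) (adj c E *m E) = 0.
    by rewrite (del_parallel sE PiH Ezb sE) Ez mulmx0.
  have h2 : map_mx (delb w) (adj c E *m E) = 0.
    by rewrite (@del_parallel _ _ (swapc c) _ _ _ _ _ sE PiH Ez _ sE) Ezb mulmx0.
  have ev2 : map_mx ev (adj c E *m E) = 2%:M.
    rewrite -E0_norm !map_mxM evE; congr (_ *m _).
    apply/matrixP => i j; rewrite !mxE; apply: ev_cj.
    by have /matrixP/(_ j i) := evE; rewrite !mxE.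
  rewrite [LHS]mx11_scalar; congr (_%:M).
  apply/eqP; rewrite -subr_eq0; apply/eqP; apply: ev_const.
  - by rewrite derB der_nat subr0; have /matrixP/(_ 0 0) := h1; rewrite !mxE.
  - by rewrite derB der_nat subr0; have /matrixP/(_ 0 0) := h2; rewrite !mxE.
  - have /matrixP/(_ 0 0) := ev2; rewrite [LHS]mxE [RHS]mxE eqxx mulr1n => h.
    by rewrite rmorphB /= h rmorph_nat subrr.
exists E; split => //.
have EPi : adj c E *m Pi = adj c E by rewrite -{2}sE adjM PiH.
have := Pi_rank1 (E *m adj c E); rewrite !mulmxA sE -mulmxA EPi => ->.
by rewrite mxtrace_mulC EE mxtrace_scalar mulr1n.
Qed.

(** The adjoint of a parallel frame is a row of functions which inherits the eigenvalue equation,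
    the vanishing ladders and the isotropy of Pi: [ladder_normal_form] applies to it. *)
Theorem parallel_normal_form : (0 < l)%N ->
  exists (u : 'rV[A]_N) (g : nat -> 'rV[A]_N),
  [/\ adj c u *m u = 2%:R *: Pi,
      [/\ forall k, map_mx (del w) (g k) = 0, forall k, map_mx (delb w) (g k) = 0
        & u = rho w ^+ l *: \sum_(k < (2 * l).+1) (weight_poly w l)`_k *: g k],
      u *m adj c u = 2%:M, u *m u^T = 0
    & forall (C : comNzRingType) (ev : {rmorphism A -> C}) (cC : {rmorphism C -> C}),
      ev (zc w) = 0 -> ev (zb w) = 0 -> (forall a, ev (c a) = cC (ev a)) ->
      let G k := map_mx ev (g k) in
      [/\ forall j k, (j <= 2 * l)%N -> (k <= 2 * l)%N -> G j *m (G k)^T = 0,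
          forall j k, (j <= 2 * l)%N -> (k <= 2 * l)%N -> j != k ->
            G j *m (map_mx cC (G k))^T = 0
        & forall k, (k < 2 * l)%N ->
            'C(2 * l, k.+1)%:R *: (G k.+1 *m (map_mx cC (G k.+1))^T) =
            'C(2 * l, k)%:R *: (G k *m (map_mx cC (G k))^T)]].
Proof.
move=> l_gt0; have [E [sE Ez Ezb EE EPi]] := parallel_frame.
pose u := adj c E.
have uPi : u *m Pi = u by rewrite /u -{2}sE adjM PiH.
have one1 : 1%:M *m 1%:M = 1%:M :> 'M[A]_1 by exact: mul1mx.
have uu : u *m u^T = 0.
  by rewrite -uPi trmx_mul !mulmxA -[X in X *m _]mulmxA Pi_iso mulmx0 mul0mx.
have u_unit : u *m adj c u = 2%:M by rewrite /u adjK.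
have uz : map_mx (del w) u *m adj c u = 0.
  rewrite /u adjK del_adj -{2}sE mulmxA -{1}PiH -adjM -/(nabla Pi (delb w) E) Ezb.
  by rewrite adj0 mul0mx.
have rE s (X : 'M[A]_N) : Pi *m X = X -> raise 1%:M w s (u *m X) = u *m raise Pi w s X.
  by move=> sX; exact: (raise_parallel sE PiH Ezb).
have rEs s (X : 'M[A]_N) : Pi *m X = X ->
   raise 1%:M (swapw w) s (u *m X) = u *m raise Pi (swapw w) s X.
  by move=> sX; exact: (@raise_parallel _ _ (swapc c) _ _ _ _ _ sE PiH Ez).
have u_eigen : raise (N := 1) 1%:M (swapw w) (- 1) (raise (N := 1) 1%:M w 0 u) =
     - (l * l.+1)%:R *: u.
  by rewrite -{1}uPi rE // rEs ?raise_sec // raise_Pi -scalemxAr uPi.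
have u_top : ladder (N := 1) 1%:M w 0 u l.+1 = 0.
  by rewrite -uPi /u (ladder_parallel sE PiH Ezb) // Pi_top mulmx0.
have u_bot : ladder (N := 1) 1%:M (swapw w) 0 u l.+1 = 0.
  rewrite -uPi /u (@ladder_parallel _ _ (swapc c) _ _ _ _ _ sE PiH Ez) //.
  by rewrite Pi_bot mulmx0.
have [g [gz gzb uE H]] := ladder_normal_form invP l_gt0 u_eigen u_top u_bot uu u_unit uz.
by exists u, g; split=> //; rewrite /u adjK.
Qed.

End Frame.

(** * Isotropic line bundles *)

Section IsotropicLine.
Variables (A : comNzRingType) (N : nat) (Pi : 'M[A]_N).

(** Projectors onto an isotropic line. If the line has a generator, both sides of the symmetry
    clauses are multiples of a symmetric matrix of rank one; they are part of the definition
    because a line bundle need not have a global generator. *)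
Record isotropic_line : Prop := IsotropicLine {
  line_idem : Pi *m Pi = Pi;
  line_iso : Pi *m Pi^T = 0;
  line_iso' : Pi^T *m Pi = 0;
  line_sym : forall X, Pi^T *m X^T *m Pi = Pi^T *m X *m Pi;
  line_sym' : forall X, Pi *m X^T *m Pi^T = Pi *m X *m Pi^T;
  line_rank1 : forall X, Pi *m X *m Pi = \tr (Pi *m X) *: Pi
}.
End IsotropicLine.

Section IsotropicLine2.
Variables (A : comNzRingType) (inv : nat -> A) (invP : natinv inv).
Variables (N : nat) (Pi : 'M[A]_N) (HPi : isotropic_line Pi).
Implicit Types d e : derivation A.
Let P := Pi + Pi^T.

Lemma PiP : Pi *m P = Pi.
Proof. by rewrite mulmxDr (line_idem HPi) (line_iso HPi) addr0. Qed.
Lemma PPi : P *m Pi = Pi.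
Proof. by rewrite mulmxDl (line_idem HPi) (line_iso' HPi) addr0. Qed.
Lemma PT : P^T = P.
Proof. by rewrite /P raddfD /= trmxK addrC. Qed.
Lemma PiTP : Pi^T *m P = Pi^T.
Proof. by rewrite -{1}PT -trmx_mul PPi. Qed.
Lemma PPiT : P *m Pi^T = Pi^T.
Proof. by rewrite -{1}PT -trmx_mul PiP. Qed.
Lemma PP : P *m P = P.
Proof. by rewrite {1}/P mulmxDl PiP PiTP. Qed.

Lemma PdPP d : P *m map_mx d P *m P = 0.
Proof. exact: (PidPiPi PP). Qed.

Lemma double_cancel m n (X : 'M[A]_(m, n)) : X + X = 0 -> X = 0.
Proof. by rewrite -mulr2n -scaler_nat; exact: (nat_cancel invP). Qed.

(** With P = Pi + Pi^T, the matrix P dP P vanishes. Its component here is the sum of the left hand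
    side and a transpose, which [line_sym] identifies with it. *)
Lemma iso_second d : Pi^T *m map_mx d Pi *m Pi = 0.
Proof.
have := congr1 (fun X => Pi^T *m X *m Pi) (PdPP d).
rewrite mulmx0 mul0mx !mulmxA PiTP -!mulmxA PPi {1}/P map_mxD mulmxDl mulmxDr !mulmxA.
by rewrite -[in X in _ + X]map_trmx (line_sym HPi) => /double_cancel.
Qed.

Lemma iso_second' d : Pi *m map_mx d Pi^T *m Pi^T = 0.
Proof.
have := congr1 (fun X => Pi *m X *m Pi^T) (PdPP d).
rewrite mulmx0 mul0mx !mulmxA PiP -!mulmxA PPiT {1}/P map_mxD mulmxDl mulmxDr !mulmxA.
by rewrite -map_trmx (line_sym' HPi) => /double_cancel.
Qed.

(** The connection of the real plane bundle im (Pi + Pi^T) commutes with its rotation: metric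
    connections on oriented plane bundles are unitary. *)
Lemma Pi_dPiT d : Pi *m map_mx d Pi^T = 0.
Proof.
have E : Pi *m map_mx d Pi^T = - (map_mx d Pi *m Pi^T).
  have := congr1 (map_mx d) (line_iso HPi); rewrite map_derM map_mx0 addrC.
  by move=> /eqP; rewrite addr_eq0 => /eqP.
have idT : Pi^T *m Pi^T = Pi^T by rewrite -trmx_mul (line_idem HPi).
have E2 : Pi *m map_mx d Pi^T = Pi *m map_mx d Pi^T *m Pi^T.
  by rewrite {2}E mulNmx -mulmxA idT.
by rewrite E2 iso_second'.
Qed.

Lemma PiT_dPi d : Pi^T *m map_mx d Pi = 0.
Proof.
have E : Pi^T *m map_mx d Pi = - (map_mx d Pi^T *m Pi).
  have := congr1 (map_mx d) (line_iso' HPi); rewrite map_derM map_mx0 addrC.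
  by move=> /eqP; rewrite addr_eq0 => /eqP.
have E2 : Pi^T *m map_mx d Pi = Pi^T *m map_mx d Pi *m Pi.
  by rewrite {2}E mulNmx -mulmxA (line_idem HPi).
by rewrite E2 iso_second.
Qed.

Lemma Pi_dP d : Pi *m map_mx d P = Pi *m map_mx d Pi.
Proof. by rewrite map_mxD mulmxDr Pi_dPiT addr0. Qed.

Lemma dP_Pi d : map_mx d P *m Pi = map_mx d Pi *m Pi.
Proof.
rewrite map_mxD mulmxDl [X in _ + X](_ : _ = 0) ?addr0 //.
by apply: trmx_inj; rewrite trmx_mul map_trmx trmxK PiT_dPi trmx0.
Qed.

Lemma tr_Pi_dd d e : \tr (Pi *m map_mx d P *m map_mx e P) =
  \tr (Pi *m (map_mx d Pi *m map_mx e Pi)).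
Proof.
rewrite Pi_dP -{1}(line_idem HPi) -!mulmxA mxtrace_mulC -!mulmxA dP_Pi.
by rewrite [LHS]mxtrace_mulC [RHS]mxtrace_mulC -!mulmxA (line_idem HPi).
Qed.

(** By the rank one clause the curvature is a trace, and transposition exchanges the traces for the
    two conjugate lines, so that their difference measures the asymmetry. *)
Lemma line_flat d e :
  \tr ((Pi - Pi^T) *m map_mx d P *m map_mx e P) = 0 ->
  Pi *m map_mx d Pi *m map_mx e Pi *m Pi = Pi *m map_mx e Pi *m map_mx d Pi *m Pi.
Proof.
move=> h; have dPT d' : (map_mx (der_fun d') P)^T = map_mx d' P by rewrite map_trmx PT.
have E : \tr (Pi^T *m map_mx d P *m map_mx e P) = \tr (Pi *m map_mx e P *m map_mx d P).
  by rewrite -mxtrace_tr !trmx_mul trmxK !dPT mulmxA mxtrace_mulC mulmxA.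
move: h; rewrite !mulmxBl raddfB /= E !tr_Pi_dd => /eqP; rewrite subr_eq0 => /eqP h.
by rewrite -![Pi *m _ *m map_mx _ Pi]mulmxA !(line_rank1 HPi) h.
Qed.

Lemma dPP_P d : map_mx d (P *m map_mx d P) *m P = - (P *m map_mx d P *m map_mx d P).
Proof.
have := congr1 (map_mx d) (PdPP d); rewrite map_derM map_mx0 => /eqP.
by rewrite addr_eq0 => /eqP.
Qed.

(** P d (P dP) is decomposed along P and 1 - P. The first hypothesis kills the normal component
    and the second one evaluates the tangential component; Pi then projects onto one line. *)
Lemma line_laplacian d e (kappa : A) :
  P *m map_mx d (P *m map_mx d P *m (1%:M - P)) *m (1%:M - P) +
  P *m map_mx e (P *m map_mx e P *m (1%:M - P)) *m (1%:M - P) = 0 ->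
  P *m map_mx d P *m map_mx d P *m P + P *m map_mx e P *m map_mx e P *m P = kappa *: P ->
  nabla Pi d (nabla Pi d Pi) + nabla Pi e (nabla Pi e Pi) = - kappa *: Pi.
Proof.
move=> H K.
have HE d' : P *m map_mx (der_fun d') P *m (1%:M - P) = P *m map_mx d' P.
  by rewrite mulmxBr mulmx1 PdPP subr0.
rewrite !HE in H.
pose Q d' := P *m map_mx (der_fun d') (P *m map_mx d' P).
have QP d' : Q d' *m P = - (P *m map_mx (der_fun d') P *m map_mx d' P *m P).
  have idP : P *m (P *m map_mx d' P *m map_mx d' P) = P *m map_mx d' P *m map_mx d' P.
    by rewrite !mulmxA PP.
  have e1 : Q d' *m P = - (P *m map_mx d' P *m map_mx d' P).
    by rewrite /Q -mulmxA dPP_P mulmxN idP.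
  by rewrite -[Q d' *m P]mulmx1 -{1}PP mulmxA mulmx1 e1 mulNmx.
have QE : Q d + Q e = - (kappa *: P).
  have Q1 d' : Q d' = Q d' *m (1%:M - P) + Q d' *m P.
    by rewrite mulmxBr mulmx1 subrK.
  rewrite (Q1 d) (Q1 e) addrACA /Q H add0r -!/(Q _) !QP -K opprD //.
have PiQ d' : Pi *m Q d' = nabla Pi d' (nabla Pi d' Pi).
  rewrite /Q mulmxA PiP {1}/P mulmxDl.
  have -> : Pi^T *m map_mx d' P = Pi^T *m map_mx d' Pi^T.
    by rewrite map_mxD mulmxDr PiT_dPi add0r.
  rewrite Pi_dP map_mxD mulmxDr [X in _ + X](_ : _ = 0) ?addr0 //.
  by rewrite map_derM mulmxDr !mulmxA Pi_dPiT (line_iso HPi) !mul0mx addr0.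
have := congr1 (mulmx Pi) QE; rewrite mulmxDr !PiQ => ->.
by rewrite mulmxN -scalemxAr PiP scaleNr.
Qed.

End IsotropicLine2.

(** * Calculus of smooth real functions *)

Local Open Scope classical_set_scope.
Local Open Scope ring_scope.

Section SmoothReal.
Variables (R : realType) (U : normedModType R).
Implicit Types (f g : U -> R^o) (k : nat) (x v : U).

Lemma Ck_pred (V : normedModType R) (D : set U) k (f : U -> V) : Ck D k.+1 f -> Ck D k f.
Proof.
elim: k f => [|k IH] f [df hf] /=; last by split=> // v; exact: IH.
by move=> x Dx; exact/differentiable_continuous/df.
Qed.

Lemma Ck_cst (V : normedModType R) (D : set U) k (a : V) : Ck D k (fun _ : U => a).
Proof.
elim: k a => [|k IH] a /=; first by move=> x _; exact: cst_continuous.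
split=> [x _|v]; first exact: differentiable_cst.
by have -> : (fun x => 'D_v (fun=> a) x) = fun=> 0; [apply/funext => x; exact: derive_cst|].
Qed.

Lemma CkD (V : normedModType R) k (f g : U -> V) : Ck setT k f -> Ck setT k g -> Ck setT k (f + g).
Proof.
elim: k f g => [|k IH] f g /=.
  by move=> cf cg x _; apply: continuousD; [exact: cf|exact: cg].
move=> [df hf] [dg hg]; split=> [x _|v].
  by apply: differentiableD; [exact: df|exact: dg].
have -> : (fun x => 'D_v (f + g) x) = (fun x => 'D_v f x) + (fun x => 'D_v g x).
  by apply/funext => x; rewrite deriveD //; apply: diff_derivable; [exact: df|exact: dg].
by apply: IH.
Qed.

Lemma CkM k f g : Ck setT k f -> Ck setT k g -> Ck setT k (f * g : U -> R^o).
Proof.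
elim: k f g => [|k IH] f g.
  by move=> cf cg x _; apply: continuousM; [exact: cf|exact: cg].
move=> Cf Cg; have [df hf] := Cf; have [dg hg] := Cg; split=> [x _|v].
  by apply: differentiableM; [exact: df|exact: dg].
have -> : (fun x => 'D_v (f * g : U -> R^o) x) =
   (f * (fun x => 'D_v g x)) + (g * (fun x => 'D_v f x)) :> (U -> R^o).
  by apply/funext => x; rewrite deriveM //; apply: diff_derivable; [exact: df|exact: dg].
by apply: CkD; apply: IH; do ?[exact: Ck_pred|exact: hf|exact: hg].
Qed.

Lemma CkV k f : (forall x, f x != 0) -> Ck setT k f -> Ck setT k (fun x => (f x)^-1 : R^o).
Proof.
move=> f0; elim: k => [|k IH].
  by move=> cf x _; apply: continuousV; [exact: f0|exact: cf].
move=> Cf; have [df hf] := Cf; split=> [x _|v].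
  by apply: differentiableV; [exact: df|].
have -> : (fun x => 'D_v (fun x => (f x)^-1 : R^o) x) =
   ((fun=> - 1) * ((fun x => (f x)^-1) * (fun x => (f x)^-1))) * (fun x => 'D_v f x) :> (U -> R^o).
  apply/funext => x; rewrite deriveV //; last by apply: diff_derivable; exact: df.
  by rewrite -exprVn expr2 /GRing.scale /= !fctE mulN1r.
have fV := IH (Ck_pred Cf).
apply: CkM; last exact: hf.
by apply: CkM; [exact: Ck_cst|exact: CkM].
Qed.

Lemma Ck_linear (V : normedModType R) k (f : {linear U -> V}) : continuous f -> Ck setT k f.
Proof.
move=> cf; case: k => [|k] /=; first by move=> x _; exact: cf.
split=> [x _|v]; first exact: linear_differentiable.
have -> : (fun x => 'D_v f x) = fun=> f v.
  by apply/funext => x; rewrite deriveE ?diff_lin //; exact: linear_differentiable.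
exact: Ck_cst.
Qed.

End SmoothReal.

Section Coordinates.
Variables (R : realType) (U : normedModType R) (m n : nat).

(** Entries of matrices are real functions, to which the closure properties above apply. *)
Lemma Ck_mx k (M : U -> 'M[R]_(m, n)) i j : Ck setT k M -> Ck setT k (fun x => M x i j : R^o).
Proof.
elim: k M => [|k IH] M /=.
  move=> cM x Dx; pose pr (N : 'M[R]_(m, n)) : R^o := N i j.
  apply: (@continuous_comp U 'M[R]_(m, n) R^o M pr x (cM x Dx)).
  exact/differentiable_continuous/differentiable_coord.
move=> [dM hM]; split=> [x _|v].
  pose pr (N : 'M[R]_(m, n)) : R^o := N i j.
  apply: (@differentiable_comp R U 'M[R]_(m, n) R^o M pr x (dM x I)).
  exact: differentiable_coord.
have -> : (fun x => 'D_v (fun y => M y i j : R^o) x) = fun x => ('D_v M x) i j.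
  apply/funext => x; rewrite derive_mx ?mxE //; apply: diff_derivable; exact: dM.
exact: IH.
Qed.

End Coordinates.

Section Line.
Variables (R : realType) (U : normedModType R).

Lemma is_derive_line (u : U -> R^o) (p v : U) (t : R) :
  differentiable u (p + t *: v) ->
  is_derive (t : R^o) 1 (fun s : R^o => u (p + s *: v)) ('D_v u (p + t *: v)).
Proof.
move=> du; pose L (s : R^o) : U := p + s *: v.
have dL : is_diff t L (0 + ( *:%R^~ v)).
  have -> : L = (cst p : R^o -> U) + ( *:%R^~ v : R^o -> U) by [].
  apply: is_diffD.
have dL' : differentiable L t by case: dL.
have duL : differentiable (u \o L) t by apply: differentiable_comp.
apply: DeriveDef; first exact: diff_derivable.
rewrite deriveE // (diff_comp dL' du) /= (diff_val (is_diff_def := dL)).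
by rewrite /= !fctE add0r scale1r deriveE.
Qed.

Lemma line_MVT (u : U -> R^o) (p v : U) (a b : R) : a < b ->
  (forall x, differentiable u x) ->
  exists2 c : R, a < c < b & u (p + b *: v) - u (p + a *: v) = 'D_v u (p + c *: v) * (b - a).
Proof.
move=> ab du; pose f (s : R^o) := u (p + s *: v).
have df (s : R) : is_derive (s : R^o) 1 f ('D_v u (p + s *: v)) by exact: is_derive_line.
have [|c cab ->] := @MVT R f (fun s => 'D_v u (p + s *: v)) a b ab (fun s _ => df s).
  apply: continuous_subspaceT => s.
  by apply: differentiable_continuous; apply/derivable1_diffP; case: (df s).
by exists c => //; move: cab; rewrite in_itv.
Qed.

End Line.

(** * Symmetry of second derivatives *)

Lemma subr_swap (V : zmodType) (p a b c : V) : p - a - (b - c) = p - b - (a - c).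
Proof. by rewrite !opprB [LHS]addrCA [RHS]addrCA addrAC. Qed.

Section Schwarz.
Variables (R : realType) (U : normedModType R).

(** The mean value theorem, once in each direction, for the second difference of [u] over a
    square of side [e]. *)
Lemma square_MVT (u : U -> R^o) (v w x : U) (e : R) : 0 < e ->
  (forall y, differentiable u y) -> (forall y, differentiable ('D_v u : U -> R^o) y) ->
  exists a b : R, [/\ 0 < a < e, 0 < b < e &
    u (x + e *: w + e *: v) - u (x + e *: w) - (u (x + e *: v) - u x) =
    'D_w ('D_v u : U -> R^o) (x + a *: v + b *: w) * (e * e)].
Proof.
move=> e0 du ddu.
pose f (s : R^o) : R^o := u (x + e *: w + s *: v) - u (x + s *: v).
pose df (s : R) : R := 'D_v u (x + e *: w + s *: v) - 'D_v u (x + s *: v).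
have fD (s : R) : is_derive (s : R^o) 1 f (df s).
  have h1 := @is_derive_line R U u (x + e *: w) v s (du _).
  have h2 := @is_derive_line R U u x v s (du _).
  by have := is_deriveB h1 h2.
have cf : {within `[0, e], continuous f}.
  apply: continuous_subspaceT => s.
  by apply: differentiable_continuous; apply/derivable1_diffP; case: (fD s).
have [a a0 E] := @MVT R f df 0 e e0 (fun s _ => fD s) cf.
have [b b0 E'] := @line_MVT R U ('D_v u) (x + a *: v) w 0 e e0 ddu.
exists a, b; split; [by move: a0; rewrite in_itv|exact: b0|].
move: E; rewrite /f /df !scale0r !addr0 subr0 => E.
have -> : u (x + e *: w + e *: v) - u (x + e *: w) - (u (x + e *: v) - u x) =
   u (x + e *: w + e *: v) - u (x + e *: v) - (u (x + e *: w) - u x).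
  exact: subr_swap.
rewrite E mulrA; congr (_ * _); rewrite scale0r addr0 subr0 in E'.
by rewrite -E' addrAC.
Qed.

Lemma near_continuous (g : U -> R^o) (x v w : U) (eps : R) : 0 < eps ->
  {for x, continuous g} -> exists2 d : R, 0 < d &
   forall a b : R, 0 < a < d -> 0 < b < d -> `|g x - g (x + a *: v + b *: w)| < eps.
Proof.
move=> eps0 cg; have /cvgrPdist_lt/(_ _ eps0)/nbhs_ballP[r /= r0 H] := cg.
pose M := `|v| + `|w| + 1.
have M0 : 0 < M by rewrite ltr_wpDl // addr_ge0.
exists (r / M); first by rewrite divr_gt0.
move=> a b /andP[a0 a1] /andP[b0 b1]; apply: H.
rewrite -ball_normE /= opprD addrA opprD addrA subrr sub0r -opprD normrN.
rewrite (le_lt_trans (ler_normD _ _)) // !normrZ !gtr0_norm //.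
have av : a * `|v| <= r / M * `|v| by rewrite ler_wpM2r // ltW.
have bw : b * `|w| <= r / M * `|w| by rewrite ler_wpM2r // ltW.
rewrite (le_lt_trans (lerD av bw)) // -mulrDr mulrAC ltr_pdivrMr // ltr_pM2l //.
by rewrite ltrDl.
Qed.

(** Both sides are within e of the common value as the square shrinks. *)
Lemma eq_of_mean_values (A B : U -> R^o) (x v w : U) :
  {for x, continuous A} -> {for x, continuous B} ->
  (forall d : R, 0 < d -> exists a b a' b' : R,
    [/\ 0 < a < d, 0 < b < d, 0 < a' < d, 0 < b' < d &
      A (x + a *: v + b *: w) = B (x + a' *: w + b' *: v)]) -> A x = B x.
Proof.
move=> cA cB H; apply/eqP; rewrite -subr_eq0 -normr_le0.
apply/ler_addgt0Pr => e e0; rewrite add0r.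
have e2 : 0 < e / 2 by rewrite divr_gt0.
have [d1 d10 H1] := @near_continuous A x v w (e / 2) e2 cA.
have [d2 d20 H2] := @near_continuous B x w v (e / 2) e2 cB.
have d0 : 0 < Num.min d1 d2 by rewrite lt_min d10 d20.
have lt12 (a : R) : 0 < a < Num.min d1 d2 -> (0 < a < d1) /\ (0 < a < d2).
  by rewrite lt_min => /and3P[-> -> ->].
have [a [b [a' [b' [/lt12[a0 _] /lt12[b0 _] /lt12[_ a0'] /lt12[_ b0'] EE]]]]] := H _ d0.
have := H1 _ _ a0 b0; have := H2 _ _ a0' b0'; rewrite EE.
move: (B (_ + _)) => C; rewrite (distrC (B x)) => h2 h1.
rewrite -(subrKA C) (splitr e); apply: (le_trans (ler_normD _ _)).
by apply: lerD; exact: ltW.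
Qed.

Definition square_mean (u : U -> R^o) (v w x : U) (B : U -> R^o) := forall e : R, 0 < e ->
  exists a b : R, [/\ 0 < a < e, 0 < b < e &
    u (x + e *: w + e *: v) - u (x + e *: w) - (u (x + e *: v) - u x) =
    B (x + a *: v + b *: w) * (e * e)].

Lemma square_mean_eq (u : U -> R^o) (v w x : U) (A B : U -> R^o) :
  {for x, continuous A} -> {for x, continuous B} ->
  square_mean u w v x A -> square_mean u v w x B -> A x = B x.
Proof.
move=> cA cB Hwv Hvw; apply: (@eq_of_mean_values A B x w v) => // d d0.
have [a [b [a0 b0 E]]] := Hvw d d0; have [a' [b' [a0' b0' E']]] := Hwv d d0.
exists a', b', a, b; split=> //.
have dd : d * d != 0 by rewrite mulf_neq0 ?gt_eqF.
apply: (mulIf dd); rewrite -E -E' [x + d *: w + _]addrAC; exact: subr_swap.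
Qed.

(** The second difference over a square is symmetric in the two directions, and [square_MVT]
    approximates both mixed derivatives by it. *)
Lemma Schwarz (u : U -> R^o) (v w x : U) : Ck setT 2 u ->
  'D_v ('D_w u : U -> R^o) x = 'D_w ('D_v u : U -> R^o) x.
Proof.
move=> [du hu]; have [dv hv] := hu v; have [dw hw] := hu w.
have Hvw d d0 := @square_MVT u v w x d d0 (fun y => du y I) (fun y => dv y I).
have Hwv d d0 := @square_MVT u w v x d d0 (fun y => du y I) (fun y => dw y I).
exact: (@square_mean_eq u v w x ('D_v ('D_w u)) ('D_w ('D_v u))
  (hw v x I) (hv w x I) Hwv Hvw).
Qed.

End Schwarz.

(** * The second derivative test *)

Section SecondDerivative.
Variable R : realType.

(** If the second derivative were positive, the first one would be positive just after the
    maximum. *)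
Lemma second_derivative_at_max (f df : R -> R) (c d : R) : 0 < d ->
  (forall s : R, is_derive (s : R^o) 1 (f : R^o -> R^o) (df s)) ->
  is_derive (0 : R^o) 1 (df : R^o -> R^o) c ->
  (forall s, `|s| < d -> f s <= f 0) -> c <= 0.
Proof.
move=> d0 Df Ddf fmax; rewrite leNgt; apply/negP => c0.
have df0 : df 0 = 0.
  have [|t tI||t tI|] := @derive1_at_max R f (- d) d 0.
  - by rewrite ge0_cp // ltW.
  - by case: (Df t).
  - by rewrite in_itv /= oppr_lt0 d0.
  - by apply: fmax; rewrite ltr_norml; move: tI; rewrite in_itv.
  - by move=> _ E; have [_ E'] := Df 0; exact: etrans (esym E') E.
have [ex val] := Ddf.
have cv : (h^-1 *: (df (h *: 1 + 0) - df 0) @[h --> (0 : R)^']) --> (c : R^o).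
  by rewrite -val; exact: ex.
have nb : nbhs (0 : R) (fun h : R => h != 0 -> 0 < h^-1 *: (df (h *: 1 + 0) - df 0)).
  exact: (cvgr_gt _ cv _ c0).
have /nbhs_ballP[r /= r0 H] := nb.
pose h := Num.min r d / 2.
have m0 : 0 < Num.min r d by rewrite lt_min r0 d0.
have h0 : 0 < h by rewrite divr_gt0.
have hm : h < Num.min r d by rewrite /h ltr_pdivrMr // ltr_pMr // ltr1n.
have dfpos t : 0 < t < r -> 0 < df t.
  move=> /andP[t0 tr]; have := H t; rewrite /= df0 subr0 addr0.
  rewrite -ball_normE /= sub0r normrN gtr0_norm // => /(_ tr).
  rewrite gt_eqF // => /(_ isT); rewrite /GRing.scale /= mulr1.
  by rewrite pmulr_rgt0 ?invr_gt0.
have cf : {within `[0, h], continuous f}.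
  apply: continuous_subspaceT => s.
  by apply: differentiable_continuous; apply/derivable1_diffP; case: (Df s).
have [t] := @MVT R f df 0 h h0 (fun s _ => Df s) cf.
rewrite in_itv /= subr0 => /andP[t0 th] E.
have dft : 0 < df t.
  by apply: dfpos; rewrite t0 (lt_trans th) // (lt_le_trans hm) // ge_min lexx.
have : f h <= f 0.
  by apply: fmax; rewrite gtr0_norm // (lt_le_trans hm) // ge_min lexx orbT.
by rewrite -subr_le0 E leNgt mulr_gt0.
Qed.

Lemma second_derivative_along (U : normedModType R) (k : U -> R^o) (z v : U) (r : R) :
  Ck setT 2 k -> 0 < r -> (forall y, `|y - z| < r -> k y <= k z) ->
  'D_v ('D_v k : U -> R^o) z <= 0.
Proof.
move=> [dk hk] r0 kmax; have [dv _] := hk v.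
pose f (s : R) : R := k (z + s *: v).
have M0 : 0 < `|v| + 1 by rewrite ltr_wpDl.
apply: (@second_derivative_at_max f (fun s => 'D_v k (z + s *: v)) _ (r / (`|v| + 1))).
- by rewrite divr_gt0.
- by move=> s; exact: is_derive_line (dk _ I).
- have := @is_derive_line R U ('D_v k) z v 0 (dv _ I).
  by rewrite scale0r addr0.
move=> s sr; rewrite /f scale0r addr0; apply: kmax.
rewrite addrC addKr normrZ; move: sr; rewrite ltr_pdivlMr // mulrDr mulr1.
by apply: le_lt_trans; rewrite lerDl.
Qed.

End SecondDerivative.

(** * Rules of differentiation *)

Section Rules.
Variables (R : realType) (U : normedModType R).
Implicit Types f g : U -> R^o.
Definition diffble f := forall x, differentiable f x.

Lemma smooth_diffble f : smooth_on setT f -> diffble f.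
Proof. by move=> /(_ 1%N)[df _] x; exact: df. Qed.

Lemma derivefD v f g : diffble f -> diffble g -> 'D_v (f + g : U -> R^o) = 'D_v f + 'D_v g :> (U -> R^o).
Proof.
by move=> df dg; apply/funext => x; rewrite deriveD //; exact: diff_derivable.
Qed.

Lemma derivefM v f g : diffble f -> diffble g ->
  'D_v (f * g : U -> R^o) = f * 'D_v g + g * 'D_v f :> (U -> R^o).
Proof.
by move=> df dg; apply/funext => x; rewrite deriveM //; exact: diff_derivable.
Qed.

Lemma derivef_cst v (a : R) : 'D_v (cst a : U -> R^o) = 0 :> (U -> R^o).
Proof. by apply/funext => x; exact: derive_cst. Qed.

Lemma derivefDx v f g x : diffble f -> diffble g ->
  'D_v (f + g : U -> R^o) x = 'D_v f x + 'D_v g x.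
Proof. by move=> df dg; rewrite deriveD //; exact: diff_derivable. Qed.

Lemma derivefMx v f g x : diffble f -> diffble g ->
  'D_v (f * g : U -> R^o) x = f x * 'D_v g x + g x * 'D_v f x.
Proof. by move=> df dg; rewrite deriveM //; exact: diff_derivable. Qed.

Lemma derivefZ v (a : R) f : diffble f ->
  'D_v ((cst a : U -> R^o) * f : U -> R^o) = (cst a : U -> R^o) * 'D_v f :> (U -> R^o).
Proof.
move=> df; rewrite (derivefM v (smooth_diffble (fun k => Ck_cst setT k (a : R^o))) df).
by rewrite derivef_cst mulr0 addr0.
Qed.

Lemma derivefZx v (a : R) f x : diffble f ->
  'D_v ((cst a : U -> R^o) * f : U -> R^o) x = a * 'D_v f x.
Proof.
move=> df; rewrite (derivefMx v x (smooth_diffble (fun k => Ck_cst setT k (a : R^o))) df).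
by rewrite derive_cst mulr0 addr0.
Qed.

Lemma smoothD f g : smooth_on setT f -> smooth_on setT g -> smooth_on setT (f + g : U -> R^o).
Proof. by move=> sf sg k; apply: CkD; [exact: sf|exact: sg]. Qed.

Lemma smoothM f g : smooth_on setT f -> smooth_on setT g -> smooth_on setT (f * g : U -> R^o).
Proof. by move=> sf sg k; apply: CkM; [exact: sf|exact: sg]. Qed.

Lemma smooth_cst (a : R) : smooth_on setT (cst a : U -> R^o).
Proof. by move=> k; exact: Ck_cst. Qed.

Lemma smooth_derive v f : smooth_on setT f -> smooth_on setT ('D_v f : U -> R^o).
Proof. by move=> sf k; have [_ h] := sf k.+1; exact: h. Qed.

Lemma smoothN f : smooth_on setT f -> smooth_on setT (- f : U -> R^o).
Proof.
move=> sf; have -> : - f = (cst (-1) : U -> R^o) * f.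
  by apply/funext => x; rewrite /GRing.mul /= mulN1r.
exact: smoothM (smooth_cst _) sf.
Qed.

End Rules.

Lemma ord2P (i : 'I_2) : i = 0 \/ i = 1.
Proof. by case: i => [[|[|//]] hi]; [left|right]; apply/val_inj. Qed.

(** * The maximum principle in the plane *)

Section Plane.
Variable R : realType.
Notation T := 'rV[R]_2.

Definition co (i : 'I_2) : T -> R^o := fun z => z 0 i.

Lemma smooth_co i : smooth_on setT (co i).
Proof.
move=> k; apply: (@Ck_mx R T 1 2 k idfun 0 i).
apply: (@Ck_linear R T T k idfun) => x; exact: cvg_id.
Qed.

Lemma D_co v i : 'D_v (co i) = cst (v 0 i) :> (T -> R^o).
Proof.
apply/funext => z; have := derive_mx (@derivable_id R T z v); rewrite derive_id.
by move=> /matrixP/(_ 0 i); rewrite mxE => <-.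
Qed.

Definition rsq : T -> R^o := co 0 * co 0 + co 1 * co 1.

Lemma rsqE z : rsq z = z 0 0 ^+ 2 + z 0 1 ^+ 2. Proof. by []. Qed.

Lemma smooth_rsq : smooth_on setT rsq.
Proof. by apply: smoothD; apply: smoothM; exact: smooth_co. Qed.

Lemma D_rsq v : 'D_v rsq = (cst (2 * v 0 0) : T -> R^o) * co 0 + cst (2 * v 0 1) * co 1 :> (T -> R^o).
Proof.
have dc i := smooth_diffble (smooth_co i).
have dcc i := smooth_diffble (smoothM (smooth_co i) (smooth_co i)).
rewrite (derivefD v (dcc 0) (dcc 1)) (derivefM v (dc 0) (dc 0)) (derivefM v (dc 1) (dc 1)) (D_co v 0) (D_co v 1).
apply/funext => z; change (z 0 0 * v 0 0 + z 0 0 * v 0 0 + (z 0 1 * v 0 1 + z 0 1 * v 0 1)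
  = 2 * v 0 0 * z 0 0 + 2 * v 0 1 * z 0 1); ring.
Qed.

Lemma DD_rsq v z : 'D_v ('D_v rsq : T -> R^o) z = 2 * (v 0 0 ^+ 2 + v 0 1 ^+ 2).
Proof.
have dc i := smooth_diffble (smooth_co i).
have dcc a i := smooth_diffble (smoothM (@smooth_cst R T a) (smooth_co i)).
have D_co' i : 'D_v (co i) z = v 0 i by have := congr1 (fun F : T -> R^o => F z) (D_co v i).
rewrite D_rsq (derivefDx v z (dcc _ 0) (dcc _ 1)) (derivefZx v _ z (dc 0)) (derivefZx v _ z (dc 1)) !D_co'; ring.
Qed.

Definition vanishes_at_infinity (g : T -> R) :=
  forall e : R, 0 < e -> exists2 M : R, 0 < M & forall z, M <= rsq z -> `|g z| < e.

(** If g is positive at a point, then for small e > 0 the function g + e |z|^2 has a maximum in the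
    interior of a large square; there its Laplacian, which is at least 4 e, would be at most 0. *)
Theorem maximum_principle (g : T -> R^o) : smooth_on setT g -> vanishes_at_infinity g ->
  (forall z, 0 <= 'D_(dz R 0) ('D_(dz R 0) g : T -> R^o) z
               + 'D_(dz R 1) ('D_(dz R 1) g : T -> R^o) z) ->
  forall z, g z <= 0.
Proof.
move=> sg g0 lap z0; rewrite leNgt; apply/negP => gz0.
have [M M0 HM] := g0 _ (divr_gt0 gz0 (ltr0n _ 2)).
pose B := Num.max M 1.
have B1 : 1 <= B by rewrite le_max lexx orbT.
have BM : M <= B by rewrite le_max lexx.
have B0 : 0 < B by exact: lt_le_trans B1.
(* On the square of half side B one has e |z|^2 <= g z0 / 4; outside it g < g z0 / 2. *)
pose e := g z0 / (8 * B ^+ 2).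
have e0 : 0 < e by rewrite divr_gt0 // mulr_gt0 // exprn_gt0.
pose k : T -> R^o := g + (cst e : T -> R^o) * rsq.
have sk : smooth_on setT k.
  by apply: smoothD => //; apply: smoothM; [exact: smooth_cst|exact: smooth_rsq].
pose A := [set v : T | forall i, `[- B, B]%classic (v ord0 i)].
have out (z : T) : (exists i, B <= `|z 0 i|) -> g z < g z0 / 2.
  move=> [i zi]; apply: (le_lt_trans (ler_norm _)); apply: HM.
  apply: (le_trans BM); apply: (@le_trans _ _ (B ^+ 2)).
    by rewrite expr2 ler_peMl // ltW.
  have zi2 : B ^+ 2 <= z 0 i ^+ 2 by rewrite -[leRHS]real_normK ?num_real // lerXn2r // nnegrE // ltW.
  apply: (le_trans zi2); rewrite rsqE.
  by case: (ord2P i) => ->; rewrite ?lerDl ?lerDr sqr_ge0.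
have inA (z : T) : (A z -> False) -> exists i, B <= `|z 0 i|.
  move=> nA; apply: contrapT => h; apply: nA => i /=.
  rewrite in_itv /= -ler_norml leNgt; apply/negP => Bz; apply: h.
  by exists i; exact: ltW.
have Az0 : A z0.
  apply: contrapT => /inA/out; rewrite ltNge ler_pdivrMr // ler_peMr ?ler1n //.
  exact: ltW.
have cA : compact A.
  exact: (@rV_compact R 2 (fun=> `[- B, B]%classic) (fun=> @segment_compact R _ _)).
have [z1] : exists2 c, c \in A & forall t, t \in A -> k t <= k c.
  apply: (@EVT_max_rV R 2 k A) => //; first by exists z0.
  have ck : continuous k.
    by move=> x; apply: differentiable_continuous; exact: (smooth_diffble sk).
  exact: continuous_subspaceT.
rewrite inE => Az1 kmax.
have kz1 : g z0 <= k z1.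
  apply: (@le_trans _ _ (k z0)); last by apply: kmax; rewrite inE.
  rewrite /k; change (g z0 <= g z0 + e * rsq z0); rewrite lerDl mulr_ge0 ?(ltW e0) //.
  by rewrite rsqE addr_ge0 ?sqr_ge0.
have interior i : `|z1 0 i| < B.
  rewrite ltNge; apply/negP => zi.
  have g1 : g z1 < g z0 / 2 by apply: out; exists i.
  have r1 : rsq z1 <= 2 * B ^+ 2.
    have zB j : z1 0 j ^+ 2 <= B ^+ 2.
      have := Az1 j; rewrite /= in_itv /= -ler_norml => h.
      by rewrite -[leLHS]real_normK ?num_real // lerXn2r // nnegrE // ltW.
    by rewrite rsqE mulr_natl mulr2n lerD.
  have er : e * rsq z1 <= g z0 / 4.
    apply: (@le_trans _ _ (e * (2 * B ^+ 2))); first by rewrite ler_pM2l.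
    rewrite /e le_eqVlt; apply/orP; left; apply/eqP.
    by field; rewrite gt_eqF.
  have : g z0 <= g z1 + e * rsq z1 by exact: kz1.
  by rewrite leNgt => /negP; apply; lra.
(* The ball of radius r around the maximum z1 lies inside the square. *)
pose r := Num.min (B - `|z1 0 0|) (B - `|z1 0 1|).
have r0 : 0 < r by rewrite lt_min !subr_gt0 !interior.
have loc y : `|y - z1| < r -> k y <= k z1.
  move=> yr; apply: kmax; rewrite inE => i /=; rewrite in_itv /= -ler_norml.
  have yi : `|y 0 i - z1 0 i| < r.
    apply: le_lt_trans yr; rewrite [leRHS]/Num.Def.normr /= mx_normrE.
    apply: le_trans; last exact: (@le_bigmax _ _ _ _ (fun ij => `|(y - z1) ij.1 ij.2|) (0, i)).
    by rewrite /= !mxE.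
  have rB : r <= B - `|z1 0 i|.
    by case: (ord2P i) => ->; rewrite ge_min lexx ?orbT.
  rewrite -[y 0 i](subrK (z1 0 i)); apply: (le_trans (ler_normD _ _)).
  by rewrite -lerBrDr; exact: le_trans (ltW yi) rB.
have DDk v : 'D_v ('D_v k : T -> R^o) z1 =
    'D_v ('D_v g : T -> R^o) z1 + e * (2 * (v 0 0 ^+ 2 + v 0 1 ^+ 2)).
  have dg := smooth_diffble sg; have dc := smooth_diffble (@smooth_cst R T e).
  have dq := smooth_diffble smooth_rsq.
  have dg' := smooth_diffble (smooth_derive v sg).
  have dq' := smooth_diffble (smooth_derive v smooth_rsq).
  have dcq := smooth_diffble (smoothM (@smooth_cst R T e) smooth_rsq).
  have dcq' := smooth_diffble (smoothM (@smooth_cst R T e) (smooth_derive v smooth_rsq)).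
  rewrite /k (derivefD v dg dcq) (derivefZ v e dq) (derivefDx v z1 dg' dcq') (derivefZx v e z1 dq').
  by rewrite DD_rsq.
have le0 v : 'D_v ('D_v k : T -> R^o) z1 <= 0.
  exact: second_derivative_along (sk 2%N) r0 loc.
have := lerD (le0 (dz R 0)) (le0 (dz R 1)); rewrite !DDk !mxE /=.
have := lap z1; move: ('D_(dz R 0) _ _) ('D_(dz R 1) _ _) => a b.
rewrite !expr1n !expr0n /= !addr0 !add0r => ab h.
by move: (lt_le_trans e0 (le_refl e)); lra.
Qed.

Lemma constant_of_D0 (u : T -> R^o) : diffble u ->
  (forall v z, 'D_v u z = 0) -> forall z, u z = u 0.
Proof.
move=> du D0 z; have [c _] := @line_MVT R T u 0 z 0 1 ltr01 du.
by rewrite D0 mul0r scale0r scale1r !add0r => /eqP; rewrite subr_eq0 => /eqP.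
Qed.

Lemma D_basis (u : T -> R^o) v z : differentiable u z ->
  'D_v u z = v 0 0 * 'D_(dz R 0) u z + v 0 1 * 'D_(dz R 1) u z.
Proof.
move=> du; rewrite !deriveE //.
have {1}-> : v = v 0 0 *: dz R 0 + v 0 1 *: dz R 1.
  apply/rowP => j; rewrite !mxE /=.
  by case: (ord2P j) => ->; rewrite /= ?mulr1 ?mulr0 ?addr0 ?add0r.
by rewrite linearD !linearZ.
Qed.

End Plane.

(** * The ring of smooth complex functions on the plane *)

Local Open Scope complex_scope.

Section SmoothComplex.
Variable R : realType.
Notation T := 'rV[R]_2.
Notation C := R[i].

Definition re_fun (u : T -> C) : T -> R^o := fun z => complex.Re (u z).
Definition im_fun (u : T -> C) : T -> R^o := fun z => complex.Im (u z).

Definition smoothC (u : T -> C) : Prop :=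
  smooth_on setT (re_fun u) /\ smooth_on setT (im_fun u).

Lemma Re_mul (x y : C) : complex.Re (x * y) = complex.Re x * complex.Re y - complex.Im x * complex.Im y.
Proof. by case: x; case: y. Qed.
Lemma Im_mul (x y : C) : complex.Im (x * y) = complex.Re x * complex.Im y + complex.Im x * complex.Re y.
Proof. by case: x; case: y. Qed.
Lemma Re_add (x y : C) : complex.Re (x + y) = complex.Re x + complex.Re y.
Proof. by case: x; case: y. Qed.
Lemma Im_add (x y : C) : complex.Im (x + y) = complex.Im x + complex.Im y.
Proof. by case: x; case: y. Qed.
Lemma Re_opp (x : C) : complex.Re (- x) = - complex.Re x. Proof. by case: x. Qed.
Lemma Im_opp (x : C) : complex.Im (- x) = - complex.Im x. Proof. by case: x. Qed.

Lemma re_funM u v : re_fun (u * v) = re_fun u * re_fun v + - (im_fun u * im_fun v) :> (T -> R^o).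
Proof. by apply/funext => z; exact: Re_mul. Qed.
Lemma im_funM u v : im_fun (u * v) = re_fun u * im_fun v + im_fun u * re_fun v :> (T -> R^o).
Proof. by apply/funext => z; exact: Im_mul. Qed.
Lemma re_funD u v : re_fun (u + v) = re_fun u + re_fun v :> (T -> R^o).
Proof. by apply/funext => z; exact: Re_add. Qed.
Lemma im_funD u v : im_fun (u + v) = im_fun u + im_fun v :> (T -> R^o).
Proof. by apply/funext => z; exact: Im_add. Qed.
Lemma re_funN u : re_fun (- u) = - re_fun u :> (T -> R^o).
Proof. by apply/funext => z; exact: Re_opp. Qed.
Lemma im_funN u : im_fun (- u) = - im_fun u :> (T -> R^o).
Proof. by apply/funext => z; exact: Im_opp. Qed.

(** Smooth functions are bundled so that they form a commutative ring on which differentiation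
    is a total operation. *)
Record smooth_fun := SmoothFun { ev_fun : T -> C; ev_smooth : smoothC ev_fun }.
HB.instance Definition _ := gen_eqMixin smooth_fun.
HB.instance Definition _ := gen_choiceMixin smooth_fun.

Definition ev (z : T) (u : smooth_fun) : C := ev_fun u z.

Lemma ev_inj (u v : smooth_fun) : (forall z, ev z u = ev z v) -> u = v.
Proof.
case: u v => [u hu] [v hv] h; have e : u = v by apply/funext => z; exact: h.
by case: _ / e hv {h} => hv; congr SmoothFun; exact: Prop_irrelevance.
Qed.

Lemma addS_subproof (u v : smooth_fun) : smoothC (ev_fun u + ev_fun v).
Proof.
case: u v => [u [ru iu]] [v [rv iv]]; split; rewrite ?re_funD ?im_funD; exact: smoothD.
Qed.
Definition addS u v := SmoothFun (addS_subproof u v).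

Lemma oppS_subproof (u : smooth_fun) : smoothC (- ev_fun u).
Proof. by case: u => [u [ru iu]]; split; rewrite ?re_funN ?im_funN; exact: smoothN. Qed.
Definition oppS u := SmoothFun (oppS_subproof u).

Lemma mulS_subproof (u v : smooth_fun) : smoothC (ev_fun u * ev_fun v).
Proof.
case: u v => [u [ru iu]] [v [rv iv]]; split; rewrite ?re_funM ?im_funM.
  by apply: smoothD; [exact: smoothM|apply: smoothN; exact: smoothM].
by apply: smoothD; exact: smoothM.
Qed.
Definition mulS u v := SmoothFun (mulS_subproof u v).

Lemma cstS_subproof (c : C) : smoothC (fun=> c).
Proof.
split; [exact: (@smooth_cst R T (complex.Re c))|exact: (@smooth_cst R T (complex.Im c))].
Qed.
Definition cS c := SmoothFun (cstS_subproof c).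

Lemma addSA : associative addS. Proof. by move=> u v w; apply: ev_inj => z; exact: addrA. Qed.
Lemma addSC : commutative addS. Proof. by move=> u v; apply: ev_inj => z; exact: addrC. Qed.
Lemma add0S : left_id (cS 0) addS. Proof. by move=> u; apply: ev_inj => z; exact: add0r. Qed.
Lemma addNS : left_inverse (cS 0) oppS addS. Proof. by move=> u; apply: ev_inj => z; exact: addNr. Qed.
HB.instance Definition _ := GRing.isZmodule.Build smooth_fun addSA addSC add0S addNS.

Lemma mulSA : associative mulS. Proof. by move=> u v w; apply: ev_inj => z; exact: mulrA. Qed.
Lemma mulSC : commutative mulS. Proof. by move=> u v; apply: ev_inj => z; exact: mulrC. Qed.
Lemma mul1S : left_id (cS 1) mulS. Proof. by move=> u; apply: ev_inj => z; exact: mul1r. Qed.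
Lemma mulSDl : left_distributive mulS addS.
Proof. by move=> u v w; apply: ev_inj => z; exact: mulrDl. Qed.
Lemma oneS_neq0 : cS 1 != cS 0.
Proof. by apply/eqP => /(congr1 (ev 0)) /eqP; rewrite oner_eq0. Qed.
HB.instance Definition _ :=
  GRing.Zmodule_isComNzRing.Build smooth_fun mulSA mulSC mul1S mulSDl oneS_neq0.

Lemma ev_additive z : zmod_morphism (ev z). Proof. by []. Qed.
Lemma ev_multiplicative z : monoid_morphism (ev z). Proof. by []. Qed.
HB.instance Definition _ z := GRing.isZmodMorphism.Build smooth_fun C (ev z) (ev_additive z).
HB.instance Definition _ z := GRing.isMonoidMorphism.Build smooth_fun C (ev z) (ev_multiplicative z).

Lemma ev_cS c z : ev z (cS c) = c. Proof. by []. Qed.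

Lemma cS_additive : zmod_morphism cS. Proof. by move=> a b; exact: ev_inj. Qed.
Lemma cS_multiplicative : monoid_morphism cS. Proof. by split=> [|a b]; exact: ev_inj. Qed.
HB.instance Definition _ := GRing.isZmodMorphism.Build C smooth_fun cS cS_additive.
HB.instance Definition _ := GRing.isMonoidMorphism.Build C smooth_fun cS cS_multiplicative.

End SmoothComplex.

(** * Wirtinger calculus *)

Section DerComb.
Variables (A : comNzRingType) (a b : A) (d e : derivation A).
Definition comb_fun x := a * d x + b * e x.
Lemma comb_additive : zmod_morphism comb_fun.
Proof. by move=> x y; rewrite /comb_fun !derB; ring. Qed.
HB.instance Definition _ := GRing.isZmodMorphism.Build A A comb_fun comb_additive.
Lemma comb_leibniz x y : comb_fun (x * y) = comb_fun x * y + x * comb_fun y.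
Proof. by rewrite /comb_fun !derM; ring. Qed.
Definition der_comb : derivation A := Derivation (der_fun := comb_fun) comb_leibniz.
End DerComb.

Section Calculus.
Variable R : realType.
Notation T := 'rV[R]_2.
Notation C := R[i].
Notation S := (smooth_fun R).

Definition reS (u : S) : T -> R^o := re_fun (ev_fun u).
Definition imS (u : S) : T -> R^o := im_fun (ev_fun u).

Lemma smooth_reS u : smooth_on setT (reS u).
Proof. by have [] := ev_smooth u. Qed.
Lemma smooth_imS u : smooth_on setT (imS u).
Proof. by have [] := ev_smooth u. Qed.

Definition pd_val v (u : S) : T -> C := fun z => 'D_v (reS u) z +i* 'D_v (imS u) z.

Lemma pd_smooth v u : smoothC (pd_val v u).
Proof.
split.
- exact: (smooth_derive v (smooth_reS u)).
- exact: (smooth_derive v (smooth_imS u)).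
Qed.

Definition pd v (u : S) : S := SmoothFun (pd_smooth v u).

Lemma ev_pd v u z : ev z (pd v u) = 'D_v (reS u) z +i* 'D_v (imS u) z.
Proof. by []. Qed.

Lemma reS_pd v u : reS (pd v u) = 'D_v (reS u). Proof. by []. Qed.
Lemma imS_pd v u : imS (pd v u) = 'D_v (imS u). Proof. by []. Qed.

Lemma reS_B u v : reS (u - v) = reS u + - reS v.
Proof. by apply/funext => z; rewrite (_ : reS (u - v) z = complex.Re (ev z u - ev z v)) // Re_add Re_opp. Qed.
Lemma imS_B u v : imS (u - v) = imS u + - imS v.
Proof. by apply/funext => z; rewrite (_ : imS (u - v) z = complex.Im (ev z u - ev z v)) // Im_add Im_opp. Qed.
Lemma reS_M u v : reS (u * v) = reS u * reS v + - (imS u * imS v).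
Proof. by apply/funext => z; exact: Re_mul. Qed.
Lemma imS_M u v : imS (u * v) = reS u * imS v + imS u * reS v.
Proof. by apply/funext => z; exact: Im_mul. Qed.

Let dre u := smooth_diffble (smooth_reS u).
Let dim u := smooth_diffble (smooth_imS u).

Lemma D_sub v (f g : T -> R^o) z : diffble f -> diffble g ->
  'D_v (f + - g : T -> R^o) z = 'D_v f z - 'D_v g z.
Proof. by move=> df dg; rewrite (deriveB (diff_derivable (df z)) (diff_derivable (dg z))). Qed.

Lemma diffbleM (f g : T -> R^o) : diffble f -> diffble g -> diffble (f * g : T -> R^o).
Proof. by move=> df dg x; apply: differentiableM. Qed.

Lemma pd_additive v : zmod_morphism (pd v).
Proof.
move=> a b; apply: ev_inj => z; rewrite raddfB !ev_pd reS_B imS_B.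
by rewrite (D_sub v z (dre a) (dre b)) (D_sub v z (dim a) (dim b)).
Qed.
HB.instance Definition _ v := GRing.isZmodMorphism.Build S S (pd v) (pd_additive v).

Lemma complexP (x y : C) : complex.Re x = complex.Re y -> complex.Im x = complex.Im y -> x = y.
Proof. by case: x => a b; case: y => c d /= -> ->. Qed.

Lemma pd_leibniz v a b : pd v (a * b) = pd v a * b + a * pd v b.
Proof.
apply: ev_inj => z.
change (ev z (pd v (a * b)) = ev z (pd v a) * ev z b + ev z a * ev z (pd v b)).
rewrite !ev_pd reS_M imS_M.
have d1 := diffbleM (dre a) (dre b); have d2 := diffbleM (dim a) (dim b).
have d3 := diffbleM (dre a) (dim b); have d4 := diffbleM (dim a) (dre b).
rewrite (D_sub v z d1 d2) (derivefDx v z d3 d4).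
rewrite (derivefMx v z (dre a) (dre b)) (derivefMx v z (dim a) (dim b)).
rewrite (derivefMx v z (dre a) (dim b)) (derivefMx v z (dim a) (dre b)).
move: ('D_v (reS a) z) ('D_v (reS b) z) ('D_v (imS a) z) ('D_v (imS b) z) => a1 b1 a2 b2.
rewrite -[reS a z]/(complex.Re (ev z a)) -[reS b z]/(complex.Re (ev z b)).
rewrite -[imS a z]/(complex.Im (ev z a)) -[imS b z]/(complex.Im (ev z b)).
case: (ev z a) => x1 x2; case: (ev z b) => y1 y2.
by apply: complexP => /=; ring.
Qed.

Definition pder v : derivation S := Derivation (der_fun := pd v) (pd_leibniz v).

Lemma pd_comm v w (u : S) : pd v (pd w u) = pd w (pd v u).
Proof.
apply: ev_inj => z; rewrite !ev_pd !reS_pd !imS_pd.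
by rewrite (Schwarz v w z (smooth_reS u 2%N)) (Schwarz v w z (smooth_imS u 2%N)).
Qed.

Lemma pd_cS v c : pd v (cS c) = 0.
Proof.
apply: ev_inj => z; rewrite ev_pd rmorph0.
by apply: complexP => /=; exact: derive_cst.
Qed.

Lemma conj_smooth (u : S) : smoothC (fun z => conjc (ev z u)).
Proof.
split.
- have -> : re_fun (fun z => conjc (ev z u)) = reS u.
    by apply/funext => z; rewrite /reS /re_fun /ev; case: (ev_fun u z).
  exact: smooth_reS.
- have -> : im_fun (fun z => conjc (ev z u)) = - imS u.
    by apply/funext => z; rewrite /imS /im_fun /ev /GRing.opp /=; case: (ev_fun u z).
  exact: smoothN (smooth_imS u).
Qed.
Definition conjS (u : S) : S := SmoothFun (conj_smooth u).
Lemma ev_conjS u z : ev z (conjS u) = conjc (ev z u). Proof. by []. Qed.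

Lemma conjS_additive : zmod_morphism conjS.
Proof. by move=> a b; apply: ev_inj => z; exact: (rmorphB (@conjc R)). Qed.
Lemma conjS_multiplicative : monoid_morphism conjS.
Proof.
split=> [|a b]; apply: ev_inj => z; first exact: (rmorph1 (@conjc R)).
exact: (rmorphM (@conjc R)).
Qed.
HB.instance Definition _ := GRing.isZmodMorphism.Build S S conjS conjS_additive.
HB.instance Definition _ := GRing.isMonoidMorphism.Build S S conjS conjS_multiplicative.

Lemma conjSK u : conjS (conjS u) = u.
Proof. by apply: ev_inj => z; rewrite !ev_conjS conjcK. Qed.

Lemma pd_conjS v u : pd v (conjS u) = conjS (pd v u).
Proof.
apply: ev_inj => z; rewrite ev_conjS !ev_pd.
have -> : reS (conjS u) = reS u.
  by apply/funext => x; rewrite /reS /re_fun /= /ev; case: (ev_fun u x).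
have -> : imS (conjS u) = - imS u.
  by apply/funext => x; rewrite /imS /im_fun /= /ev /GRing.opp /=; case: (ev_fun u x).
by congr (_ +i* _); rewrite (deriveN (diff_derivable (dim u z))).
Qed.

Lemma z_smooth : smoothC (fun z : T => z 0 0 +i* z 0 1).
Proof. split; [exact (@smooth_co R 0)|exact (@smooth_co R 1)]. Qed.
Definition zS : S := SmoothFun z_smooth.

Lemma qrho_neq0 (z : T) : 1 + rsq z != 0.
Proof. by rewrite gt_eqF // rsqE ltr_pwDl // addr_ge0 ?sqr_ge0. Qed.

Lemma rho_smooth : smoothC (fun z : T => ((1 + rsq z)^-1)%:C).
Proof.
have h : smooth_on setT (cst 1 + @rsq R : T -> R^o).
  by apply: smoothD; [exact: smooth_cst|exact: smooth_rsq].
split; last exact (@smooth_cst R T 0).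
exact (fun k => @CkV R T k (cst 1 + @rsq R : T -> R^o) qrho_neq0 (h k)).
Qed.
Definition rhoS : S := SmoothFun rho_smooth.

Lemma pd_zS v : pd v zS = cS (v 0 0 +i* v 0 1).
Proof.
apply: ev_inj => z; rewrite ev_pd ev_cS.
have h i := congr1 (fun F : T -> R^o => F z) (D_co v i).
by congr (_ +i* _); [exact: (h 0)|exact: (h 1)].
Qed.

Definition half : C := (2^-1)%:C.
Definition ii : C := 0 +i* 1.
Definition dzS : derivation S :=
  der_comb (cS half) (cS (- (half * ii))) (pder (dz R 0)) (pder (dz R 1)).
Definition dzbS : derivation S :=
  der_comb (cS half) (cS (half * ii)) (pder (dz R 0)) (pder (dz R 1)).

Lemma pd_mulc v c u : pd v (cS c * u) = cS c * pd v u.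
Proof. by rewrite pd_leibniz pd_cS mul0r add0r. Qed.

Lemma dz_dzbS u : dzS (dzbS u) = dzbS (dzS u).
Proof.
rewrite /= /comb_fun /= !raddfD /= !pd_mulc [pd (dz R 1) (pd (dz R 0) u)]pd_comm.
by ring.
Qed.

Lemma conj_dzS u : conjS (dzS u) = dzbS (conjS u).
Proof.
rewrite /= /comb_fun /= rmorphD !rmorphM /= -!pd_conjS.
have -> : conjS (cS half) = cS half.
  by apply: ev_inj => z; rewrite ev_conjS ev_cS; apply: complexP => //=; rewrite oppr0.
have -> : conjS (cS (- (half * ii))) = cS (half * ii) => //.
by apply: ev_inj => z; rewrite ev_conjS !ev_cS; apply: complexP => /=; ring.
by rewrite rmorphM.
Qed.

Lemma dzS_z : dzS zS = 1.
Proof.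
rewrite /= /comb_fun /= !pd_zS !mxE /= -!rmorphM -rmorphD -(rmorph1 (@cS R)); congr (cS _).
by apply: complexP => /=; field.
Qed.

Lemma dzbS_z : dzbS zS = 0.
Proof.
rewrite /= /comb_fun /= !pd_zS !mxE /= -!rmorphM -rmorphD -(rmorph0 (@cS R)); congr (cS _).
by apply: complexP => /=; field.
Qed.

Lemma dzS_zb : dzS (conjS zS) = 0.
Proof.
have := conj_dzS (conjS zS); rewrite conjSK dzbS_z => /(congr1 conjS).
by rewrite conjSK rmorph0.
Qed.

Lemma dzbS_zb : dzbS (conjS zS) = 1.
Proof. by rewrite -conj_dzS dzS_z rmorph1. Qed.

Lemma rhoSP : rhoS * (1 + zS * conjS zS) = 1.
Proof.
apply: ev_inj => z; have := qrho_neq0 z; rewrite rsqE => q0.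
change (((1 + rsq z)^-1)%:C *
  (1 + (z 0 0 +i* z 0 1) * conjc (z 0 0 +i* z 0 1)) = 1).
by rewrite rsqE; apply: complexP => /=; field.
Qed.

Definition affine_calculus : wirtinger S :=
  Wirtinger dz_dzbS dzS_z dzS_zb dzbS_z dzbS_zb rhoSP.

Definition affine_conj : conjugation affine_calculus :=
  @Conjugation S affine_calculus conjS conjSK conj_dzS erefl.

Definition invS (k : nat) : S := cS (k.+1%:R^-1).
Lemma invSP : natinv invS.
Proof.
by move=> k; rewrite /invS -(rmorph_nat (@cS R)) -rmorphM mulfV ?rmorph1 // pnatr_eq0.
Qed.

Lemma pd0E u : pd (dz R 0) u = dzS u + dzbS u.
Proof.
rewrite /= /comb_fun /= -[X in X = _]mul1r -(rmorph1 (@cS R)).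
have -> : (1 : C) = half + half by apply: complexP => /=; field.
by rewrite rmorphD rmorphN /=; ring.
Qed.

Lemma pd1E u : pd (dz R 1) u = cS ii * (dzS u - dzbS u).
Proof.
rewrite /= /comb_fun /=; set a := pd _ u; set b := pd _ u.
have -> : cS half * b + cS (- (half * ii)) * a - (cS half * b + cS (half * ii) * a) =
   - cS (half * ii + half * ii) * a by rewrite rmorphN rmorphD /=; ring.
rewrite mulrA -rmorphN -rmorphM -[LHS]mul1r -(rmorph1 (@cS R)); congr (cS _ * _).
by apply: complexP => /=; field.
Qed.

(** The derivatives along all directions are combinations of the two Wirtinger derivatives. *)
Lemma const_S (u : S) : dzS u = 0 -> dzbS u = 0 -> u = cS (ev 0 u).
Proof.
move=> h1 h2; have h0 : pd (dz R 0) u = 0 by rewrite pd0E h1 h2 addr0.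
have h1' : pd (dz R 1) u = 0 by rewrite pd1E h1 h2 subr0 mulr0.
have E0 z : ev z (pd (dz R 0) u) = 0 by rewrite h0 rmorph0.
have E1 z : ev z (pd (dz R 1) u) = 0 by rewrite h1' rmorph0.
apply: ev_inj => z; rewrite ev_cS; apply: complexP.
- apply: (constant_of_D0 (dre u)) => v x; rewrite (D_basis v (dre u x)).
  have := congr1 (@complex.Re R) (E0 x); have := congr1 (@complex.Re R) (E1 x).
  by rewrite !ev_pd /= => -> ->; rewrite !mulr0 addr0.
- apply: (constant_of_D0 (dim u)) => v x; rewrite (D_basis v (dim u x)).
  have := congr1 (@complex.Im R) (E0 x); have := congr1 (@complex.Im R) (E1 x).
  by rewrite !ev_pd /= => -> ->; rewrite !mulr0 addr0.
Qed.

Lemma ev0_const (u : S) : dzS u = 0 -> dzbS u = 0 -> ev 0 u = 0 -> u = 0.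
Proof. by move=> h1 h2 h; rewrite (const_S h1 h2) h rmorph0. Qed.

Lemma ev_zS z : ev z zS = z 0 0 +i* z 0 1. Proof. by []. Qed.
Lemma ev_rhoS z : ev z rhoS = ((1 + rsq z)^-1)%:C. Proof. by []. Qed.

End Calculus.

(** * The point at infinity and vanishing of holomorphic sections *)

Lemma laplacian_del (A : comNzRingType) (d e : derivation A) (I h : A) :
  (forall a, d (e a) = e (d a)) -> d I = 0 -> e I = 0 -> I * I = -1 ->
  d (d h + e h) + e (d h + e h) +
   I * (d (I * (d h - e h)) - e (I * (d h - e h))) = 4%:R * e (d h).
Proof.
move=> de dI eI II; rewrite !derM dI eI !derB !derD de.
transitivity (d (d h) + e (d h) + (e (d h) + e (e h)) + (I * I) * (d (d h) - e (d h) - (e (d h) - e (e h)))).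
  by ring.
by rewrite II; ring.
Qed.

Section NormLaplacian.
Variables (A : comNzRingType) (w : wirtinger A) (c : conjugation w).
Variables (N p : nat) (Pi : 'M[A]_N) (W : 'M[A]_(N, p)).
Hypotheses (PiPi : Pi *m Pi = Pi) (PiH : adj c Pi = Pi) (Pi_flat : flat Pi w).
Hypotheses (sW : Pi *m W = W) (W_hol : nabla Pi (delb w) W = 0).

(** For a holomorphic section of a flat Hermitian bundle, flatness and holomorphy leave only
    |nabla W|^2 in the mixed derivative of |W|^2. *)
Lemma del_norm : delb w (del w (\tr (adj c W *m W))) =
  \tr (adj c (nabla Pi (del w) W) *m nabla Pi (del w) W).
Proof.
have trD (d : derivation A) n (X : 'M[A]_n) : d (\tr X) = \tr (map_mx d X).
  by rewrite /mxtrace raddf_sum; apply: eq_bigr => i _; rewrite mxE.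
rewrite !trD; congr (\tr _).
rewrite (del_parallel sW PiH W_hol sW); set V := nabla Pi (del w) W.
have sV : Pi *m V = V by exact: nabla_sec.
rewrite map_derM delb_adj.
have -> : adj c (map_mx (del w) W) *m V = adj c V *m V.
  by rewrite -{1}sV mulmxA -{1}PiH -adjM.
rewrite -{1}sW adjM PiH -mulmxA -/(nabla Pi (delb w) V) /V -nabla_comm // W_hol.
by rewrite nabla0 mulmx0 addr0.
Qed.

End NormLaplacian.

Section Inversion.
Variable R : realType.
Notation T := 'rV[R]_2.
Notation C := R[i].
Notation S := (smooth_fun R).

Lemma evM z (u v : S) : ev z (u * v) = ev z u * ev z v. Proof. by []. Qed.
Lemma evD z (u v : S) : ev z (u + v) = ev z u + ev z v. Proof. by []. Qed.
Lemma evN z (u : S) : ev z (- u) = - ev z u. Proof. by []. Qed.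
Lemma evB z (u v : S) : ev z (u - v) = ev z u - ev z v. Proof. by []. Qed.
Lemma ev0 z : ev z (0 : S) = 0. Proof. by []. Qed.

Lemma ev_sum z (I : Type) (r : seq I) (P : pred I) (F : I -> S) :
  ev z (\sum_(i <- r | P i) F i) = \sum_(i <- r | P i) ev z (F i).
Proof. exact: (big_morph (ev z) (evD z) (ev0 z)). Qed.

Definition invx (z : T) : R^o := z 0 0 * (rsq z)^-1.
Definition invy (z : T) : R^o := - (z 0 1 * (rsq z)^-1).
(** The change of charts z |-> 1 / z. *)
Definition invT (z : T) : T := invx z *: dz R 0 + invy z *: dz R 1.

Lemma invT0 z : invT z 0 0 = invx z.
Proof. by rewrite !mxE /= mulr1 mulr0 addr0. Qed.
Lemma invT1 z : invT z 0 1 = invy z.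
Proof. by rewrite !mxE /= mulr1 mulr0 add0r. Qed.

Lemma rsq_gt0 (z : T) : z != 0 -> 0 < rsq z.
Proof.
move=> z0; rewrite rsqE lt_neqAle addr_ge0 ?sqr_ge0 // andbT eq_sym.
apply: contraNneq z0 => /eqP; rewrite paddr_eq0 ?sqr_ge0 // !sqrf_eq0.
move=> /andP[/eqP h0 /eqP h1]; apply/eqP/rowP => i; rewrite mxE.
by case: (ord2P i) => ->.
Qed.

Lemma rsq_neq0 (z : T) : z != 0 -> rsq z != 0.
Proof. by move/rsq_gt0/gt_eqF/negbT. Qed.

Lemma rsq_inv z : z != 0 -> rsq (invT z) = (rsq z)^-1.
Proof.
move=> z0; have := rsq_neq0 z0; rewrite [LHS]rsqE invT0 invT1 /invx /invy !rsqE => q0.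
by field.
Qed.

Lemma invT_neq0 z : z != 0 -> invT z != 0.
Proof.
move=> z0; apply/eqP => h; have := rsq_inv z0; rewrite h rsqE !mxE !expr0n addr0.
by move/esym/eqP; rewrite invr_eq0 (negbTE (rsq_neq0 z0)).
Qed.

Lemma invTK z : z != 0 -> invT (invT z) = z.
Proof.
move=> z0; have q0 := rsq_neq0 z0; apply/rowP => i; case: (ord2P i) => ->.
  by rewrite invT0 /invx rsq_inv // invT0 /invx invrK -mulrA mulVf ?mulr1.
by rewrite invT1 /invy rsq_inv // invT1 /invy invrK mulNr opprK -mulrA mulVf ?mulr1.
Qed.

Lemma diff_quot i z : z != 0 ->
  differentiable ((co i : T -> R^o) * (fun y => (rsq y)^-1) : T -> R^o) z.
Proof.
move=> z0; apply: differentiableM; first exact: (smooth_diffble (@smooth_co R i)).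
apply: differentiableV; last exact: rsq_neq0.
exact: (smooth_diffble (@smooth_rsq R)).
Qed.

Lemma diff_invT z : z != 0 -> differentiable invT z.
Proof.
move=> z0; apply: differentiableD; apply: differentiableZl.
  exact: (diff_quot 0 z0).
exact: (differentiableN (diff_quot 1 z0)).
Qed.

Lemma D_rsqx v (z : T) : 'D_v (@rsq R) z = 2 * (v 0 0 * z 0 0 + v 0 1 * z 0 1).
Proof.
have -> := congr1 (fun F : T -> R^o => F z) (D_rsq v).
by change (2 * v 0 0 * z 0 0 + 2 * v 0 1 * z 0 1 = 2 * (v 0 0 * z 0 0 + v 0 1 * z 0 1)); ring.
Qed.

Lemma D_quot v i z : z != 0 ->
  'D_v ((co i : T -> R^o) * (fun y => (rsq y)^-1) : T -> R^o) z =
  v 0 i / rsq z - z 0 i * (2 * (v 0 0 * z 0 0 + v 0 1 * z 0 1)) / rsq z ^+ 2.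
Proof.
move=> z0; have q0 := rsq_neq0 z0.
have dq := smooth_diffble (@smooth_rsq R) z; have dc := smooth_diffble (@smooth_co R i) z.
have dV := differentiableV dq q0.
rewrite (deriveM (diff_derivable dc) (diff_derivable dV)) (deriveV q0 (diff_derivable dq)).
rewrite D_rsqx; have -> := congr1 (fun F : T -> R^o => F z) (D_co v i).
change (z 0 i * (- (rsq z) ^- 2 * (2 * (v 0 0 * z 0 0 + v 0 1 * z 0 1))) + (rsq z)^-1 * v 0 i =
  v 0 i / rsq z - z 0 i * (2 * (v 0 0 * z 0 0 + v 0 1 * z 0 1)) / rsq z ^+ 2).
by field.
Qed.

(** The differential v |-> - v y^2 of z |-> 1 / z, in terms of y = 1 / z. *)
Definition jac (v y : T) : T :=
  (- (v 0 0 * (y 0 0 ^+ 2 - y 0 1 ^+ 2) - v 0 1 * (2 * y 0 0 * y 0 1))) *: dz R 0 +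
  (- (v 0 0 * (2 * y 0 0 * y 0 1) + v 0 1 * (y 0 0 ^+ 2 - y 0 1 ^+ 2))) *: dz R 1.

Lemma D_invT v z : z != 0 -> 'D_v invT z = jac v (invT z).
Proof.
move=> z0; have q0 := rsq_neq0 z0.
rewrite (derive_mx (diff_derivable (diff_invT z0))); apply/rowP => i; rewrite mxE.
case: (ord2P i) => ->.
  have -> : (fun t => invT t 0 0) = invx by apply/funext => t; exact: invT0.
  rewrite (D_quot v 0 z0) /jac [RHS]mxE ![(_ *: dz R _) 0 0]mxE ![(dz R _) 0 0]mxE /=.
  rewrite invT0 invT1 /invx /invy; move: q0; rewrite rsqE => q0.
  by field.
have -> : (fun t => invT t 0 1) = - ((co 1 : T -> R^o) * (fun y => (rsq y)^-1)).
  by apply/funext => t; exact: invT1.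
rewrite (deriveN (diff_derivable (diff_quot 1 z0))) (D_quot v 1 z0) /jac [RHS]mxE ![(_ *: dz R _) 0 1]mxE ![(dz R _) 0 1]mxE /=.
rewrite invT0 invT1 /invx /invy; move: q0; rewrite rsqE => q0.
by field.
Qed.

Lemma chain_inv (g : T -> R^o) v z : diffble g -> z != 0 ->
  'D_v (fun y => g (invT y) : R^o) z =
  jac v (invT z) 0 0 * 'D_(dz R 0) g (invT z) + jac v (invT z) 0 1 * 'D_(dz R 1) g (invT z).
Proof.
move=> dg z0; have di := diff_invT z0.
have dgi : differentiable (g \o invT) z by apply: differentiable_comp.
rewrite -(D_basis _ (dg _)) -(D_invT v z0) deriveE // [X in X v](diff_comp di (dg _)).
by rewrite (deriveE _ (dg (invT z))) (deriveE v di).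
Qed.

Lemma near_neq0 (z : T) : z != 0 -> \forall y \near z, y != 0.
Proof.
move=> z0; apply/nbhs_ballP; exists `|z|; first by rewrite /= normr_gt0.
by move=> y; rewrite -ball_normE /= => zy; apply: contraTneq zy => ->; rewrite subr0 ltxx.
Qed.

Definition extends (u G : S) := forall z, z != 0 -> ev z u = ev (invT z) G.

(** Smooth extension over the point at infinity; in [van] the extension vanishes there. *)
Definition reg (u : S) := exists G, extends u G.
Definition van (u : S) := exists2 G, extends u G & ev 0 G = 0.

Lemma van_reg u : van u -> reg u. Proof. by case=> G h _; exists G. Qed.

Lemma reg_cS c : reg (cS c). Proof. by exists (cS c). Qed.

Lemma regM u v : reg u -> reg v -> reg (u * v).
Proof. by move=> [G hG] [H hH]; exists (G * H) => z z0; rewrite !evM hG ?hH. Qed.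
Lemma vanM u v : van u -> reg v -> van (u * v).
Proof.
move=> [G hG G0] [H hH]; exists (G * H) => [z z0|]; rewrite !evM ?hG ?hH //.
by rewrite G0 mul0r.
Qed.
Lemma vanMl u v : reg u -> van v -> van (u * v).
Proof. by move=> ru vv; rewrite mulrC; exact: vanM. Qed.
Lemma vanD u v : van u -> van v -> van (u + v).
Proof.
move=> [G hG G0] [H hH H0]; exists (G + H) => [z z0|]; rewrite !evD ?hG ?hH //.
by rewrite G0 H0 addr0.
Qed.
Lemma regD u v : reg u -> reg v -> reg (u + v).
Proof. by move=> [G hG] [H hH]; exists (G + H) => z z0; rewrite !evD hG ?hH. Qed.
Lemma van0 : van 0.
Proof. by exists 0 => // z z0; rewrite !ev0. Qed.
Lemma van_sum (I : Type) (r : seq I) (F : I -> S) : (forall i, van (F i)) -> van (\sum_(i <- r) F i).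
Proof. by move=> h; elim/big_ind: _ => //; [exact: van0|exact: vanD]. Qed.
Lemma van_conj u : van u -> van (conjS u).
Proof. by move=> [G hG G0]; exists (conjS G) => [z z0|]; rewrite !ev_conjS ?hG // G0 rmorph0. Qed.

Lemma co_smooth i : smoothC (fun z : T => (z 0 i)%:C).
Proof. by split; [exact (@smooth_co R i)|exact (@smooth_cst R T 0)]. Qed.
Definition coS i : S := SmoothFun (co_smooth i).
Lemma ev_coS i z : ev z (coS i) = (z 0 i)%:C. Proof. by []. Qed.

(** In the coordinate y = 1 / z, differentiation in z is - y^2 times differentiation in y. *)
Lemma van_pd v u : reg u -> van (pd v u).
Proof.
move=> [G hG].
pose J0 : S := - (cS (v 0 0)%:C * (coS 0 * coS 0 - coS 1 * coS 1) - cS (v 0 1)%:C * (cS 2%:R * coS 0 * coS 1)).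
pose J1 : S := - (cS (v 0 0)%:C * (cS 2%:R * coS 0 * coS 1) + cS (v 0 1)%:C * (coS 0 * coS 0 - coS 1 * coS 1)).
have evJ0 y : ev y J0 = (jac v y 0 0)%:C.
  rewrite /J0 !(evN, evB, evD, evM) !ev_coS !ev_cS /jac !mxE /=.
  by apply: complexP => /=; ring.
have evJ1 y : ev y J1 = (jac v y 0 1)%:C.
  rewrite /J1 !(evN, evB, evD, evM) !ev_coS !ev_cS /jac !mxE /=.
  by apply: complexP => /=; ring.
exists (J0 * pd (dz R 0) G + J1 * pd (dz R 1) G) => [z z0|]; last first.
  have j0 i : jac v 0 0 i = 0.
    by rewrite /jac !mxE !(mul0r, mulr0, expr0n, subr0, oppr0, addr0).
  by rewrite evD !evM evJ0 evJ1 !j0 !mul0r addr0.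
rewrite evD !evM evJ0 evJ1 !ev_pd.
have dr := smooth_diffble (smooth_reS G); have di := smooth_diffble (smooth_imS G).
have near_re : \near z, reS u z = reS G (invT z).
  apply: filterS (near_neq0 z0) => y y0.
  by have := congr1 (@complex.Re R) (hG y y0).
have near_im : \near z, imS u z = imS G (invT z).
  apply: filterS (near_neq0 z0) => y y0.
  by have := congr1 (@complex.Im R) (hG y y0).
rewrite (near_eq_derive v near_re) (near_eq_derive v near_im).
rewrite (chain_inv v dr z0) (chain_inv v di z0).
move: (jac v (invT z) 0 0) (jac v (invT z) 0 1) => a b.
move: ('D_(dz R 0) (reS G) _) ('D_(dz R 1) (reS G) _) => r1 r2.
move: ('D_(dz R 0) (imS G) _) ('D_(dz R 1) (imS G) _) => i1 i2.
by apply: complexP => /=; ring.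
Qed.

Lemma van_vanishes u : van u -> vanishes_at_infinity (reS u).
Proof.
move=> [G hG G0] e e0.
have cG : {for 0, continuous (reS G)}.
  by apply: differentiable_continuous; exact: (smooth_diffble (smooth_reS G)).
have /cvgrPdist_lt/(_ _ e0)/nbhs_ballP[d /= d0 H] := cG.
have d20 : 0 < d ^+ 2 by rewrite exprn_gt0.
exists (2 / d ^+ 2); first by rewrite divr_gt0.
move=> z zM; have q0 : 0 < rsq z by apply: lt_le_trans zM; rewrite divr_gt0.
have z0 : z != 0.
  by apply: contraTneq q0 => ->; rewrite rsqE !mxE !expr0n addr0 ltxx.
have -> : reS u z = reS G (invT z) by have := congr1 (@complex.Re R) (hG z z0).
have RG0 : reS G 0 = 0 by have := congr1 (@complex.Re R) G0.
have := H (invT z); rewrite RG0 sub0r normrN; apply.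
rewrite -ball_normE /= sub0r normrN [ltLHS]/Num.Def.normr /= mx_normrE.
have sm i : invT z 0 i ^+ 2 < d ^+ 2.
  have : rsq (invT z) < d ^+ 2.
    rewrite rsq_inv // -[X in X < _]mul1r ltr_pdivrMr //.
    have := ler_pM2l d20 (2 / d ^+ 2) (rsq z); rewrite zM mulrCA divff ?gt_eqF // mulr1 => h.
    by apply: lt_le_trans h; rewrite ltr1n.
  rewrite rsqE; apply: le_lt_trans.
  by case: (ord2P i) => ->; rewrite ?lerDl ?lerDr sqr_ge0.
apply/bigmax_ltP; split=> // -[i j] _ /=; rewrite (ord1 i).
have := sm j; rewrite -[X in X < _ -> _]real_normK ?num_real //.
by rewrite ltr_pXn2r // ?nnegrE // ltW.
Qed.

Variables (N p : nat) (Pi : 'M[S]_N) (W : 'M[S]_(N, p)).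
Let w := affine_calculus R.
Let c := affine_conj R.

(** The squared norm of W is subharmonic, nonnegative and tends to 0 at infinity. *)
Lemma subharmonic_vanishing (V : 'M[S]_(N, p)) :
  delb w (del w (\tr (adj c W *m W))) = \tr (adj c V *m V) ->
  (forall i j, van (W i j)) -> W = 0.
Proof.
move=> hV vW.
pose h : S := \tr (adj c W *m W).
have Re_tr q m (X : 'M[S]_(q, m)) z : complex.Re (ev z (\tr (adj c X *m X))) =
    \sum_j \sum_i (complex.Re (ev z (X i j)) ^+ 2 + complex.Im (ev z (X i j)) ^+ 2).
  have ReS (I : finType) (F : I -> C) : complex.Re (\sum_i F i) = \sum_i complex.Re (F i).
    by apply: (big_morph (@complex.Re R)) => // x y; exact: Re_add.
  rewrite /mxtrace ev_sum ReS; apply: eq_bigr => j _.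
  rewrite mxE ev_sum ReS; apply: eq_bigr => i _; rewrite !mxE evM.
  rewrite [ev z (c _)]ev_conjS; case: (ev z (X i j)) => a b /=; ring.
have h_van : van h.
  apply: van_sum => j; rewrite mxE; apply: van_sum => i.
  by rewrite !mxE; apply: vanMl => //; apply: van_reg; exact: van_conj.
have lap : pd (dz R 0) (pd (dz R 0) h) + pd (dz R 1) (pd (dz R 1) h) =
   cS 4%:R * delb w (del w h).
  have cS0 (d : derivation S) : d = dzS R \/ d = dzbS R -> d (cS (ii R)) = 0.
    by case=> ->; rewrite /= /comb_fun /= !pd_cS !mulr0 addr0.
  have ii2 : cS (ii R) * cS (ii R) = -1.
    by rewrite -rmorphM -(rmorph1 (@cS R)) -rmorphN; congr (cS _); apply: complexP => /=; ring.
  rewrite !pd0E !pd1E rmorph_nat; apply: laplacian_del => //.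
  - exact: dz_dzbS.
  - by apply: cS0; left.
  - by apply: cS0; right.
have lap0 z : 0 <= 'D_(dz R 0) ('D_(dz R 0) (reS h) : T -> R^o) z
               + 'D_(dz R 1) ('D_(dz R 1) (reS h) : T -> R^o) z.
  have E : 'D_(dz R 0) ('D_(dz R 0) (reS h) : T -> R^o) z
      + 'D_(dz R 1) ('D_(dz R 1) (reS h) : T -> R^o) z =
      complex.Re (ev z (cS 4%:R * delb w (del w h))).
    by rewrite -lap evD Re_add.
  rewrite E /h hV evM ev_cS.
  have -> : 4%:R = (4%:R)%:C :> C by rewrite rmorph_nat.
  rewrite Re_mul Re_tr [complex.Im _]/= mul0r subr0 [complex.Re _]/=.
  apply: mulr_ge0 => //; apply: sumr_ge0 => j _; apply: sumr_ge0 => i _.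
  by rewrite addr_ge0 ?sqr_ge0.
have hle := maximum_principle (smooth_reS h) (van_vanishes h_van) lap0.
apply/matrixP => i j; rewrite [RHS]mxE; apply: ev_inj => z; rewrite ev0.
have := hle z; rewrite /reS /re_fun -/(ev z h) Re_tr => le0.
have sq0 i' j' : 0 <= complex.Re (ev z (W i' j')) ^+ 2 + complex.Im (ev z (W i' j')) ^+ 2.
  by rewrite addr_ge0 ?sqr_ge0.
have : complex.Re (ev z (W i j)) ^+ 2 + complex.Im (ev z (W i j)) ^+ 2 <= 0.
  apply: le_trans le0; rewrite (bigD1 j) //= (bigD1 i) //=.
  rewrite -addrA lerDl addr_ge0 //; first by apply: sumr_ge0.
  by apply: sumr_ge0 => j' _; apply: sumr_ge0.
rewrite le_eqVlt ltNge sq0 orbF paddr_eq0 ?sqr_ge0 // !sqrf_eq0.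
by move=> /andP[/eqP h1 /eqP h2]; apply: complexP.
Qed.

Hypotheses (PiPi : Pi *m Pi = Pi) (PiH : adj c Pi = Pi) (Pi_flat : flat Pi w).
Hypotheses (sW : Pi *m W = W) (W_van : forall i j, van (W i j)).

Theorem holomorphic_vanishing : nabla Pi (delb w) W = 0 -> W = 0.
Proof.
move=> hW; apply: (subharmonic_vanishing _ W_van).
exact: (del_norm PiPi PiH Pi_flat sW hW).
Qed.

Theorem antiholomorphic_vanishing : nabla Pi (del w) W = 0 -> W = 0.
Proof.
move=> hW; apply: (subharmonic_vanishing _ W_van).
rewrite -del_delb.
exact: (@del_norm _ _ (swapc c) _ _ _ _ PiPi PiH (esym Pi_flat) sW hW).
Qed.

End Inversion.

(** * Smooth families of matrices *)

Section Lifts.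
Variable R : realType.
Notation T := 'rV[R]_2.
Notation C := R[i].
Notation S := (smooth_fun R).

(** Real matrix-valued functions as matrices over the ring of smooth functions. Equations between
    them may be established on either side, pointwise or algebraically. *)
Definition lifts m k (MS : 'M[S]_(m, k)) (M : T -> 'M[R]_(m, k)) :=
  forall z i j, ev z (MS i j) = (M z i j)%:C.

Lemma lifts_mul m k p (AS : 'M[S]_(m, k)) (BS : 'M[S]_(k, p)) F G :
  lifts AS F -> lifts BS G -> lifts (AS *m BS) (fun z => F z *m G z).
Proof.
move=> hA hB z i j; rewrite !mxE ev_sum rmorph_sum; apply: eq_bigr => l _.
by rewrite evM hA hB rmorphM.
Qed.

Lemma lifts_opp m k (AS : 'M[S]_(m, k)) F : lifts AS F -> lifts (- AS) (fun z => - F z).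
Proof. by move=> hA z i j; rewrite !mxE evN hA rmorphN. Qed.

Lemma lifts_add m k (AS BS : 'M[S]_(m, k)) F G :
  lifts AS F -> lifts BS G -> lifts (AS + BS) (fun z => F z + G z).
Proof. by move=> hA hB z i j; rewrite !mxE evD hA hB rmorphD. Qed.

Lemma lifts_1 m : lifts (1%:M : 'M[S]_m) (fun=> 1%:M).
Proof. by move=> z i j; rewrite !mxE; case: eqP => _; rewrite ?mulr1n ?mulr0n //. Qed.

Lemma lifts_eq m k (AS BS : 'M[S]_(m, k)) F G :
  lifts AS F -> lifts BS G -> (forall z, F z = G z) -> AS = BS.
Proof.
move=> hA hB h; apply/matrixP => i j; apply: ev_inj => z.
by rewrite hA hB h.
Qed.

Lemma lifts_reS m k (AS : 'M[S]_(m, k)) F i j : lifts AS F ->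
  reS (AS i j) = (fun z => F z i j).
Proof. by move=> hA; apply/funext => z; rewrite /reS /re_fun -/(ev z (AS i j)) hA. Qed.

Lemma lifts_imS m k (AS : 'M[S]_(m, k)) F i j : lifts AS F -> imS (AS i j) = cst 0.
Proof. by move=> hA; apply/funext => z; rewrite /imS /im_fun -/(ev z (AS i j)) hA. Qed.

Lemma lifts_entry_diff m k (AS : 'M[S]_(m, k)) F i j : lifts AS F ->
  diffble ((fun z => F z i j) : T -> R^o).
Proof. by move=> hA; rewrite -(lifts_reS i j hA); exact: smooth_diffble (smooth_reS _). Qed.

Lemma lifts_derivable m k (AS : 'M[S]_(m, k)) F z v : lifts AS F -> derivable F z v.
Proof.
move=> hA; apply/derivable_mxP => i j.
exact: diff_derivable (lifts_entry_diff i j hA z).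
Qed.

Lemma lifts_pd m k (AS : 'M[S]_(m, k)) F v : lifts AS F ->
  lifts (map_mx (pder v) AS) (fun z => 'D_v F z).
Proof.
move=> hA z i j; rewrite !mxE (derive_mx (lifts_derivable hA)) mxE.
change (ev z (pd v (AS i j)) = ('D_v (fun t => F t i j) z)%:C).
by rewrite ev_pd (lifts_reS i j hA) (lifts_imS i j hA) derive_cst.
Qed.

Lemma lifts_D_basis m k (AS : 'M[S]_(m, k)) F v z : lifts AS F ->
  'D_v F z = v 0 0 *: 'D_(dz R 0) F z + v 0 1 *: 'D_(dz R 1) F z.
Proof.
move=> hA; rewrite !(derive_mx (lifts_derivable hA)).
apply/matrixP => i j; rewrite [LHS]mxE [RHS]mxE.
rewrite [X in _ = X + _]mxE [X in _ = _ + X]mxE.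
rewrite [X in _ = _ * X + _]mxE [X in _ = _ + _ * X]mxE.
exact: D_basis (lifts_entry_diff i j hA z).
Qed.

End Lifts.

Section Chart.
Variables (R : realType) (n : nat) (f : CP1 R -> Gr R n).
Hypothesis f_smooth : smooth_map f.
Notation T := 'rV[R]_2.
Notation C := R[i].
Notation S := (smooth_fun R).

Lemma chart_inv (z : T) : z != 0 -> chart 0 z = chart 1 (invT z).
Proof.
move=> z0; apply/val_inj => /=.
have zeta0 : (z 0 0 +i* z 0 1) != 0 :> C.
  apply: contraNneq z0 => -[h0 h1]; apply/eqP/rowP => i; rewrite mxE.
  by case: (ord2P i) => ->.
have -> : affine 0 z = (z 0 0 +i* z 0 1) *: affine 1 (invT z).
  have q0 := rsq_neq0 z0; rewrite rsqE in q0.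
  apply/colP => i; rewrite [RHS]mxE; case: (ord2P i) => ->.
    have -> : affine 1 (invT z) 0 0 = invx z +i* invy z by rewrite mxE /= invT0 invT1.
    by rewrite mxE /invx /invy rsqE; apply: complexP => /=; field.
  have -> : affine 1 (invT z) 1 0 = 1 by rewrite mxE.
  by rewrite mulr1 mxE.
apply/eqP; rewrite eqEdim -memvE memvZ ?memv_line //=.
by rewrite !dim_vline scaler_eq0 (negbTE zeta0) /=.
Qed.

Lemma J_smooth c i j : smoothC (fun z => (Jmx (local f c z) i j)%:C).
Proof.
split; last exact (@smooth_cst R T 0).
move=> k; exact: (@Ck_mx R T n.+2 n.+2 k (fun z => Jmx (local f c z)) i j (f_smooth c k)).
Qed.

Definition JS c : 'M[S]_n.+2 := \matrix_(i, j) SmoothFun (J_smooth c i j).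

Lemma lifts_JS c : lifts (JS c) (fun z => Jmx (local f c z)).
Proof. by move=> z i j; rewrite mxE. Qed.

Definition PS c : 'M[S]_n.+2 := - (JS c *m JS c).

Lemma lifts_PS c : lifts (PS c) (fun z => piQ (local f c z)).
Proof. exact: lifts_opp (lifts_mul (lifts_JS c) (lifts_JS c)). Qed.

Lemma lifts_piS c : lifts (1%:M - PS c) (fun z => piS (local f c z)).
Proof. exact (lifts_add (@lifts_1 R n.+2) (lifts_opp (lifts_PS c))). Qed.

(** Around infinity the same map is described by the other chart. *)
Lemma JS_reg i j : reg (JS 0 i j).
Proof.
exists (JS 1 i j) => z z0; rewrite !lifts_JS /local.
by rewrite chart_inv.
Qed.

End Chart.

(** * The isotropic line of an oriented plane *)

Lemma isotropic_line_of_vector (A : comNzRingType) (h : A) N (E : 'cV[A]_N) (F : 'rV[A]_N) :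
  2 * h = 1 -> F *m E = 2%:M -> E^T *m E = 0 -> F *m F^T = 0 ->
  isotropic_line (h *: (E *m F)).
Proof.
move=> h2 FE EE FF.
have hh (x : A) : h * (h * (2 * x)) = h * x by rewrite [2 * x]mulrC mulrCA [h * (x * 2)]mulrC -mulrA h2 mulr1 mulrC.
have tE : (h *: (E *m F))^T = h *: (F^T *m E^T) by rewrite trmx_scale trmx_mul.
split; rewrite ?tE.
- rewrite -scalemxAl -scalemxAr -!mulmxA (mulmxA F) FE scalerA.
  rewrite mul_scalar_mx -scalemxAr scalerA; congr (_ *: _).
  by rewrite -mulrA [h * 2]mulrC h2 mulr1.
- by rewrite -scalemxAl -scalemxAr -!mulmxA (mulmxA F) FF mul0mx mulmx0 !scaler0.
- by rewrite -scalemxAl -scalemxAr -!mulmxA (mulmxA E^T) EE mul0mx mulmx0 !scaler0.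
- move=> X; rewrite -!scalemxAl -!scalemxAr; congr (_ *: (_ *: _)).
  rewrite -!mulmxA !(mulmxA E^T) (mulmxA (E^T *m X^T)) (mulmxA (E^T *m X)).
  have -> // : E^T *m X^T *m E = E^T *m X *m E.
  rewrite [RHS]mx11_scalar -[in RHS]tr_scalar_mx -[in RHS]mx11_scalar.
  by rewrite !trmx_mul trmxK mulmxA.
- move=> X; rewrite -!scalemxAl -!scalemxAr; congr (_ *: (_ *: _)).
  rewrite -!mulmxA !(mulmxA F) (mulmxA (F *m X^T)) (mulmxA (F *m X)).
  have -> // : F *m X^T *m F^T = F *m X *m F^T.
  rewrite [RHS]mx11_scalar -[in RHS]tr_scalar_mx -[in RHS]mx11_scalar.
  by rewrite !trmx_mul trmxK mulmxA.
move=> X; rewrite -!scalemxAl -!scalemxAr mxtraceZ; pose s := F *m X *m E.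
have -> : E *m F *m X *m (E *m F) = (s 0 0) *: (E *m F).
  rewrite -[E *m F *m X]mulmxA -mulmxA (mulmxA (F *m X)) -/s [s]mx11_scalar.
  by rewrite mul_scalar_mx -scalemxAr ?mxE ?mulr1n.
have -> : \tr (E *m F *m X) = s 0 0 by rewrite -mulmxA mxtrace_mulC trace_mx11.
by rewrite !scalerA; congr (_ *: _); ring.
Qed.

Section Pointwise.
Variable R : realType.
Notation C := R[i].
Variables (m : nat) (e1 e2 : 'cV[R]_m) (h : orthonormal2 e1 e2).
Notation rc := (real_complex R).

(** A generator of the isotropic line attached to the oriented plane of the frame e1, e2. *)
Definition cvec : 'cV[C]_m := map_mx rc e1 + ii R *: map_mx rc e2.
Definition cvec_adj : 'rV[C]_m := (map_mx rc e1)^T - ii R *: (map_mx rc e2)^T.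

Lemma dotE (u v : 'cV[R]_m) : (map_mx rc u)^T *m map_mx rc v = ((dot u v)%:C)%:M.
Proof. by rewrite map_trmx -map_mxM [X in map_mx _ X]mx11_scalar map_scalar_mx. Qed.

Lemma dotC (u v : 'cV[R]_m) : dot u v = dot v u.
Proof. by rewrite /dot !mxE; apply: eq_bigr => k _; rewrite !mxE mulrC. Qed.

Lemma iiii : ii R * ii R = -1.
Proof. by apply: complexP => /=; ring. Qed.

Lemma cvec_adjT : cvec_adj = (map_mx conjc cvec)^T.
Proof.
apply/matrixP => i j; rewrite !mxE; apply: complexP => /=; ring.
Qed.

Lemma cvec_norm : cvec_adj *m cvec = 2%:M.
Proof.
have [h1 h2 h3] := h; have h4 : dot e2 e1 = 0 by rewrite dotC.
rewrite /cvec /cvec_adj mulmxDr !mulmxBl -!scalemxAl -!scalemxAr !dotE h1 h2 h3 h4.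
by rewrite rmorph0 rmorph1 !scaler0 subr0 sub0r scalerA iiii scaleN1r opprK [RHS]raddfD.
Qed.

Lemma cvec_iso : cvec^T *m cvec = 0.
Proof.
have [h1 h2 h3] := h; have h4 : dot e2 e1 = 0 by rewrite dotC.
rewrite /cvec [(_ + _)^T]raddfD /= trmx_scale mulmxDr !mulmxDl -!scalemxAl -!scalemxAr !dotE h1 h2 h3 h4.
by rewrite rmorph0 rmorph1 !scaler0 addr0 add0r scalerA iiii scaleN1r subrr.
Qed.

Lemma quarter_turn_tr : (quarter_turn e1 e2)^T = - quarter_turn e1 e2.
Proof. by rewrite /quarter_turn raddfB /= !trmx_mul !trmxK opprB. Qed.

Lemma quarter_turn_sq : - (quarter_turn e1 e2 *m quarter_turn e1 e2) = e1 *m e1^T + e2 *m e2^T.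
Proof.
have E (u v : 'cV[R]_m) : u^T *m v = (dot u v)%:M by rewrite [LHS]mx11_scalar.
have [h1 h2 h3] := h; have h4 : dot e2 e1 = 0 by rewrite dotC.
rewrite /quarter_turn mulmxBl !mulmxBr !mulmxA.
rewrite -!(mulmxA _ e1^T) -!(mulmxA _ e2^T) !E h1 h2 h3 h4.
by rewrite !mul_mx_scalar !scale0r !scale1r !mul0mx sub0r subr0 -opprD opprK addrC.
Qed.

Lemma quarter_turn_trace : \tr (- (quarter_turn e1 e2 *m quarter_turn e1 e2)) = 2.
Proof.
have [h1 h2 _] := h.
rewrite quarter_turn_sq mxtraceD mxtrace_mulC [\tr (e2 *m _)]mxtrace_mulC.
by rewrite !trace_mx11 -/(dot e1 e1) -/(dot e2 e2) h1 h2.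
Qed.

(** Up to the factor 1/2, the projector onto the isotropic line is P + i J. It depends only on
    the oriented plane, while the generator depends on the frame. *)
Lemma cvec_projector : half R *: (cvec *m cvec_adj) =
  half R *: (map_mx rc (- (quarter_turn e1 e2 *m quarter_turn e1 e2)) +
             ii R *: map_mx rc (quarter_turn e1 e2)).
Proof.
congr (_ *: _); rewrite quarter_turn_sq /quarter_turn map_mxD map_mxB !map_mxM -!map_trmx.
rewrite /cvec /cvec_adj mulmxBr !mulmxDl -!scalemxAr -!scalemxAl.
move: (map_mx rc e1 *m (map_mx rc e1)^T) (map_mx rc e2 *m (map_mx rc e1)^T)
  (map_mx rc e1 *m (map_mx rc e2)^T) (map_mx rc e2 *m (map_mx rc e2)^T) => a b c d.
have := iiii; move: (ii R) => I II; apply/matrixP => i j; rewrite !mxE.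
apply/eqP; rewrite -subr_eq0; apply/eqP.
by transitivity (- (I * I + 1) * d i j); [ring|rewrite II addNr oppr0 mul0r].
Qed.

End Pointwise.

(** * Minimality in a conformal coordinate *)

Section Conformal.
Variable R : realType.
Notation T := 'rV[R]_2.

(** The metric is conformal to the Euclidean one, and in dimension two such coordinates are
    harmonic. *)
Lemma christoffel_trace (z : T) (k : 'I_2) : \sum_(i < 2) christoffel z k i i = 0.
Proof.
pose rr (x : T) : R^o := (pi * (1 + x 0 0 ^+ 2 + x 0 1 ^+ 2) ^+ 2)^-1.
have FSE i j v : 'D_v (fun x => FS x i j : R^o) z = (i == j)%:R * 'D_v rr z.
  case: eqP => [->|ij].
    by rewrite mul1r; congr ('D_v _ z); apply/funext => x; rewrite /FS mxE eqxx mulr1n.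
  rewrite mul0r -[RHS](@derive_cst R T R^o 0 z v); congr ('D_v _ z); apply/funext => x.
  by rewrite /FS mxE (introF eqP ij) mulr0n.
rewrite /christoffel -mulr_sumr exchange_big /= [X in _ * X]big1 ?mulr0 // => m _.
rewrite -mulr_sumr; under eq_bigr do rewrite !FSE eqxx mul1r.
rewrite sumrB sumr_const card_ord big_split /= mulr2n.
have -> : \sum_(i < 2) (i == m)%:R * 'D_(dz R i) rr z = 'D_(dz R m) rr z.
  rewrite (bigD1 m) //= eqxx mul1r big1 ?addr0 // => i im.
  by rewrite (negbTE im) mul0r.
by rewrite subrr mulr0.
Qed.

Lemma LC_trace (z : T) (a : R) :
  \sum_(i < 2) LC z (a *: dz R i) (a *: dz R i) = 0.
Proof.
apply/rowP => k; rewrite summxE [RHS]mxE.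
transitivity (\sum_(i < 2) (a * a) * christoffel z k i i).
  apply: eq_bigr => i _; rewrite mxE (bigD1 i) //= [X in _ + X]big1 ?addr0 => [|j ji].
    rewrite (bigD1 i) //= big1 ?addr0 => [|j ji].
      by rewrite !mxE !eqxx /= !mulr1.
    by rewrite !mxE (negbTE ji) /= !mulr0 mul0r.
  by rewrite big1 // => j' _; rewrite !mxE (negbTE ji) /= !mulr0 !mul0r.
by rewrite -mulr_sumr christoffel_trace mulr0.
Qed.

End Conformal.

Lemma mulmx_sandwich (A : comNzRingType) k m p q a b (X Y : 'M[A]_(m, p))
    (L : 'M[A]_(k, m)) (K : 'M[A]_(p, q)) :
  L *m (a *: X + b *: Y) *m K = a *: (L *m X *m K) + b *: (L *m Y *m K).
Proof. by rewrite mulmxDr mulmxDl -!scalemxAr -!scalemxAl. Qed.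

Lemma mulmx_sandwichZ (A : comNzRingType) k m p q a (X : 'M[A]_(m, p))
    (L : 'M[A]_(k, m)) (K : 'M[A]_(p, q)) :
  L *m (a *: X) *m K = a *: (L *m X *m K).
Proof. by rewrite -scalemxAr -scalemxAl. Qed.

Lemma basis_pick (R : realType) (V : lmodType R) (a : R) i (X : 'I_2 -> V) :
  (a *: dz R i) 0 0 *: X 0 + (a *: dz R i) 0 1 *: X 1 = a *: X i.
Proof.
by case: (ord2P i) => ->; rewrite !mxE /= ?mulr0 ?mulr1 scale0r ?addr0 ?add0r.
Qed.

Lemma sum2 (V : nmodType) (G : 'I_2 -> V) : \sum_(i < 2) G i = G 0 + G 1.
Proof.
rewrite !big_ord_recl big_ord0 addr0; congr (G _ + G _); exact/val_inj.
Qed.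

Lemma cancel_scaled_sum (R : realType) (V : lmodType R) (a : R) (G L : 'I_2 -> V) :
  a != 0 -> \sum_(i < 2) ((a * a) *: G i - L i) = 0 -> L 0 + L 1 = 0 -> G 0 + G 1 = 0.
Proof.
move=> a0; rewrite sum2 addrACA -opprD => + L0; rewrite L0 subr0 -scalerDr => /eqP.
by rewrite scaler_eq0 mulf_eq0 orbb (negbTE a0) /= => /eqP.
Qed.

Lemma linear_sum0 (R : realType) (V : lmodType R) (H : 'rV[R]_2 -> V) (X0 X1 : V) a b :
  (forall v, H v = v 0 0 *: X0 + v 0 1 *: X1) -> a + b = 0 -> H a + H b = 0.
Proof.
move=> E /rowP ab; have h0 := ab 0; have h1 := ab 1; rewrite !mxE in h0 h1.
by rewrite !E addrACA -!scalerDl h0 h1 !scale0r addr0.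
Qed.

Section Extract.
Variables (R : realType) (n : nat) (f : CP1 R -> Gr R n).
Hypothesis f_smooth : smooth_map f.
Notation T := 'rV[R]_2.
Notation S := (smooth_fun R).
Local Notation F := (local f 0).
Local Notation P := (PS f_smooth 0).
Local Notation J := (JS f_smooth 0).
Local Notation d i := (pder (dz R i)).

Definition FS_scale (z : T) : R := Num.sqrt pi * (1 + z 0 0 ^+ 2 + z 0 1 ^+ 2).

Lemma FS_scale_neq0 z : FS_scale z != 0.
Proof.
rewrite mulf_neq0 // ?gt_eqF ?sqrtr_gt0 ?pi_gt0 //.
by rewrite -addrA ltr_pwDl // addr_ge0 ?sqr_ge0.
Qed.

Lemma FS_scale_sq z : FS_scale z ^+ 2 = pi * (1 + rsq z) ^+ 2.
Proof. by rewrite /FS_scale exprMn sqr_sqrtr ?pi_ge0 // rsqE addrA. Qed.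

Definition HS i := P *m map_mx (d i) (1%:M - P) *m (1%:M - P).
Definition KS i := (1%:M - P) *m map_mx (d i) P *m P.

Lemma lifts_HS i : lifts (HS i) (fun z => Hform F z (dz R i)).
Proof.
exact: (lifts_mul (lifts_mul (lifts_PS f_smooth 0) (lifts_pd (dz R i) (lifts_piS f_smooth 0)))
  (lifts_piS f_smooth 0)).
Qed.

Lemma lifts_KS i : lifts (KS i) (fun z => Kform F z (dz R i)).
Proof.
exact: (lifts_mul (lifts_mul (lifts_piS f_smooth 0) (lifts_pd (dz R i) (lifts_PS f_smooth 0)))
  (lifts_PS f_smooth 0)).
Qed.

Lemma HformE z v : Hform F z v = v 0 0 *: Hform F z (dz R 0) + v 0 1 *: Hform F z (dz R 1).
Proof.
rewrite /Hform (lifts_D_basis v z (lifts_piS f_smooth 0)).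
exact: mulmx_sandwich.
Qed.

Lemma HformZ z a i : Hform F z (a *: dz R i) = a *: Hform F z (dz R i).
Proof.
by rewrite HformE; exact: (basis_pick a i (fun i => Hform F z (dz R i))).
Qed.

Lemma KformZ z a i : Kform F z (a *: dz R i) = a *: Kform F z (dz R i).
Proof.
rewrite /Kform (lifts_D_basis (a *: dz R i) z (lifts_PS f_smooth 0)).
rewrite (basis_pick a i (fun i => 'D_(dz R i) (fun x => piQ (F x)) z)).
exact: mulmx_sandwichZ.
Qed.

Lemma D_Hform z a i :
  'D_(a *: dz R i) (fun x => Hform F x (a *: dz R i)) z =
  (a * a) *: 'D_(dz R i) (fun x => Hform F x (dz R i)) z.
Proof.
pose H x := Hform F x (dz R i).
have E : (fun x => Hform F x (a *: dz R i)) = a \*: H.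
  by apply/funext => x; exact: HformZ.
apply: (etrans (congr1 (fun G : T -> 'M[R]_n.+2 => 'D_(a *: dz R i) G z) E)).
apply: (etrans (deriveZ a (lifts_derivable (lifts_HS i)))).
rewrite -scalerA; congr (_ *: _).
apply: (etrans (lifts_D_basis (a *: dz R i) z (lifts_HS i))).
exact: (basis_pick a i (fun j => 'D_(dz R j) H z)).
Qed.

(** In a conformal coordinate the connection of the domain drops out of the trace
    ([LC_trace]), and what is left is the Euclidean trace times the square of [FS_scale]. *)
Lemma minimal_eq : minimal f ->
  P *m map_mx (d 0) (HS 0) *m (1%:M - P) + P *m map_mx (d 1) (HS 1) *m (1%:M - P) = 0.
Proof.
move=> fmin.
have L i : lifts (P *m map_mx (d i) (HS i) *m (1%:M - P)) (fun z =>
     piQ (F z) *m 'D_(dz R i) (fun x => Hform F x (dz R i)) z *m piS (F z)).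
  exact: (lifts_mul (lifts_mul (lifts_PS f_smooth 0) (lifts_pd (dz R i) (lifts_HS i)))
    (lifts_piS f_smooth 0)).
have L0 : lifts (0 : 'M[S]_n.+2) (fun=> (0 : 'M[R]_n.+2)).
  by move=> z i j; rewrite !mxE.
apply: (lifts_eq (lifts_add (L 0) (L 1)) L0) => z.
(* Both arguments are the frame vector, whence the square of the scale. *)
have sff i : second_fundamental_form F z (FS_frame z i) (FS_frame z i) =
   (FS_scale z * FS_scale z) *: (piQ (F z) *m 'D_(dz R i) (fun x => Hform F x (dz R i)) z *m piS (F z))
   - Hform F z (LC z (FS_scale z *: dz R i) (FS_scale z *: dz R i)).
  have e1 := congr1 (fun X => piQ (F z) *m X *m piS (F z)) (D_Hform z (FS_scale z) i).
  have e2 := etrans e1 (mulmx_sandwichZ _ _ _ _).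
  exact: (congr1 (fun X => X - Hform F z (LC z (FS_scale z *: dz R i) (FS_scale z *: dz R i))) e2).
have L1 := LC_trace z (FS_scale z); rewrite sum2 in L1.
apply: (@cancel_scaled_sum R _ (FS_scale z)
  (fun i => piQ (F z) *m 'D_(dz R i) (fun x => Hform F x (dz R i)) z *m piS (F z))
  (fun i => Hform F z (LC z (FS_scale z *: dz R i) (FS_scale z *: dz R i))) (FS_scale_neq0 z)).
  exact: (etrans (esym (eq_bigr _ (fun i _ => sff i))) (fmin 0 z)).
exact: (linear_sum0 (HformE z) L1).
Qed.

End Extract.

(** * The isotropic line bundle of a map *)

Section Line.
Variables (R : realType) (n : nat) (f : CP1 R -> Gr R n).
Hypothesis f_smooth : smooth_map f.
Notation T := 'rV[R]_2.
Notation S := (smooth_fun R).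
Local Notation F := (local f 0).
Local Notation P := (PS f_smooth 0).
Local Notation J := (JS f_smooth 0).
Local Notation d i := (pder (dz R i)).

Lemma evmx_inj m k (X Y : 'M[S]_(m, k)) :
  (forall z, map_mx (ev z) X = map_mx (ev z) Y) -> X = Y.
Proof.
move=> h; apply/matrixP => i j; apply: ev_inj => z.
by have /matrixP/(_ i j) := h z; rewrite !mxE.
Qed.

(** The projector (P + i J) / 2 onto the isotropic line of the fibre of V. *)
Definition PiS : 'M[S]_n.+2 := cS (half R) *: (P + cS (ii R) *: J).

Lemma ev_lift m k (AS : 'M[S]_(m, k)) M z : lifts AS M ->
  map_mx (ev z) AS = map_mx (real_complex R) (M z).
Proof. by move=> h; apply/matrixP => i j; rewrite !mxE h. Qed.

Lemma ev_PiS z : map_mx (ev z) PiS = half R *: (map_mx (real_complex R) (piQ (F z)) +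
   ii R *: map_mx (real_complex R) (Jmx (F z))).
Proof.
have hP := ev_lift z (lifts_PS f_smooth 0); have hJ := ev_lift z (lifts_JS f_smooth 0).
apply: (etrans (map_mxZ _ _ _)); congr (_ *: _).
apply: (etrans (map_mxD _ _ _)); congr (_ + _) => //.
by apply: (etrans (map_mxZ _ _ _)); congr (_ *: _).
Qed.

Lemma GrP (K : Gr R n) : exists e1 e2, orthonormal2 e1 e2 /\ Jmx K = quarter_turn e1 e2.
Proof. by case: K. Qed.

Lemma ev_PiS_cvec z : exists e1 e2, [/\ orthonormal2 e1 e2, Jmx (F z) = quarter_turn e1 e2 &
  map_mx (ev z) PiS = half R *: (cvec e1 e2 *m cvec_adj e1 e2)].
Proof.
have [e1 [e2 [h hJ]]] := GrP (F z); exists e1, e2; split=> //.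
by rewrite ev_PiS /piQ hJ cvec_projector.
Qed.

Lemma half2 : 2 * half R = 1.
Proof. by apply: complexP => /=; field. Qed.

Lemma line_ev z : isotropic_line (map_mx (ev z) PiS).
Proof.
have [e1 [e2 [h _ ->]]] := ev_PiS_cvec z.
apply: isotropic_line_of_vector half2 (cvec_norm h) (cvec_iso h) _.
have := congr1 (map_mx conjc) (cvec_iso h).
rewrite map_mxM map_mx0 -map_trmx => <-.
by rewrite cvec_adjT trmxK.
Qed.

(** The clauses hold at each point, where the isotropic line has the generator [cvec]. *)
Lemma line_PiS : isotropic_line PiS.
Proof.
have L z := line_ev z.
split.
- by apply: evmx_inj => z; rewrite map_mxM (line_idem (L z)).
- by apply: evmx_inj => z; rewrite map_mxM -map_trmx (line_iso (L z)) map_mx0.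
- by apply: evmx_inj => z; rewrite map_mxM -map_trmx (line_iso' (L z)) map_mx0.
- by move=> X; apply: evmx_inj => z; rewrite !map_mxM -!map_trmx (line_sym (L z)).
- by move=> X; apply: evmx_inj => z; rewrite !map_mxM -!map_trmx (line_sym' (L z)).
- move=> X; apply: evmx_inj => z.
  apply: etrans (esym (map_mxZ (ev z) _ PiS)).
  rewrite !map_mxM (line_rank1 (L z)); congr (_ *: _).
  by rewrite -map_mxM trace_map_mx.
Qed.

Lemma Jmx_tr (K : Gr R n) : (Jmx K)^T = - Jmx K.
Proof. by have [e1 [e2 [h ->]]] := GrP K; exact: quarter_turn_tr. Qed.

Lemma piQ_trace (K : Gr R n) : \tr (piQ K) = 2.
Proof. by rewrite /piQ; have [e1 [e2 [h ->]]] := GrP K; exact: quarter_turn_trace. Qed.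

Lemma JS_tr : J^T = - J.
Proof.
apply/matrixP => i j; apply: ev_inj => z.
have := congr1 (fun M : 'M[R]_(n.+2) => M i j) (Jmx_tr (F z)); rewrite [X in X = _ -> _]mxE [X in _ = X -> _]mxE => h.
by rewrite mxE [X in _ = ev z X]mxE evN !(lifts_JS f_smooth) h rmorphN.
Qed.

Lemma PS_tr : P^T = P.
Proof. by rewrite /PS raddfN /= trmx_mul JS_tr mulNmx mulmxN opprK. Qed.

Lemma half2S : cS (half R) + cS (half R) = 1 :> S.
Proof. by rewrite -rmorphD -(rmorph1 (@cS R)); congr (cS _); apply: complexP => /=; field. Qed.

Lemma PiS_tr : PiS^T = cS (half R) *: (P - cS (ii R) *: J).
Proof. by rewrite /PiS trmx_scale raddfD /= trmx_scale PS_tr JS_tr scalerN. Qed.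

Lemma PS_PiS : PiS + PiS^T = P.
Proof.
rewrite PiS_tr /PiS -scalerDr; move: (P) (cS (ii R) *: J) => X Y.
by rewrite addrACA subrr addr0 scalerDr -scalerDl half2S scale1r.
Qed.

Lemma JS_PiS : PiS - PiS^T = cS (ii R) *: J.
Proof.
rewrite PiS_tr /PiS -scalerBr; move: (P) (cS (ii R) *: J) => X Y.
by rewrite opprD opprK addrACA subrr add0r scalerDr -scalerDl half2S scale1r.
Qed.

Lemma conj_lift m k (AS : 'M[S]_(m, k)) M : lifts AS M -> map_mx (affine_conj R) AS = AS.
Proof.
move=> h; apply/matrixP => i j; rewrite mxE; apply: ev_inj => z.
by change (conjc (ev z (AS i j)) = ev z (AS i j)); rewrite h; apply: complexP => //=; rewrite oppr0.
Qed.

Lemma adj_PiS : adj (affine_conj R) PiS = PiS.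
Proof.
rewrite /adj /PiS map_mxZ map_mxD map_mxZ (conj_lift (lifts_PS f_smooth 0)) (conj_lift (lifts_JS f_smooth 0)).
have -> : affine_conj R (cS (half R)) = cS (half R).
  by apply: ev_inj => z; apply: complexP => //=; rewrite oppr0.
have -> : affine_conj R (cS (ii R)) = - cS (ii R).
  by apply: ev_inj => z; apply: complexP => //=; rewrite oppr0.
by rewrite trmx_scale raddfD /= trmx_scale PS_tr JS_tr scaleNr scalerN opprK.
Qed.

Lemma PS_idem : P *m P = P.
Proof. by have := PP line_PiS; rewrite PS_PiS. Qed.

Lemma dPS_tr i : (map_mx (d i) P)^T = map_mx (d i) P.
Proof. by rewrite map_trmx PS_tr. Qed.

Lemma d1P i : map_mx (d i) (1%:M - P) = - map_mx (d i) P.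
Proof.
rewrite map_mxB; have -> : map_mx (d i) 1%:M = 0 :> 'M[S]_n.+2.
  by apply/matrixP => a b; rewrite !mxE der_nat.
by rewrite sub0r.
Qed.

Lemma HSE i : HS f_smooth i = - (P *m map_mx (d i) P *m (1%:M - P)).
Proof. by rewrite /HS d1P mulmxN mulNmx. Qed.

Lemma KSE i : KS f_smooth i = - (HS f_smooth i)^T.
Proof.
rewrite HSE raddfN /= opprK !trmx_mul PS_tr dPS_tr raddfB /= PS_tr trmx1.
by rewrite /KS mulmxA.
Qed.

Lemma HKE i : HS f_smooth i *m KS f_smooth i =
  - (P *m map_mx (d i) P *m map_mx (d i) P *m P).
Proof.
have QQ : (1%:M - P) *m (1%:M - P) = 1%:M - P.
  by rewrite mulmxBl mul1mx mulmxBr mulmx1 PS_idem subrr subr0.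
rewrite HSE /KS mulNmx; congr (- _).
rewrite !mulmxA -[_ *m (1%:M - P) *m (1%:M - P)]mulmxA QQ.
by rewrite mulmxBr mulmx1 (PidPiPi PS_idem) subr0.
Qed.

Lemma lifts_inj m k (AS : 'M[S]_(m, k)) M M' z : lifts AS M -> lifts AS M' -> M z = M' z.
Proof.
move=> h h'; apply/matrixP => i j.
by have := h z i j; rewrite h' => /(congr1 (@complex.Re R)).
Qed.

Lemma lifts_tr m k (AS : 'M[S]_(m, k)) M : lifts AS M -> lifts AS^T (fun z => (M z)^T).
Proof. by move=> h z i j; rewrite !mxE h. Qed.

Lemma Kform_tr z i : Kform F z (dz R i) = - (Hform F z (dz R i))^T.
Proof.
have h := lifts_KS f_smooth i; rewrite KSE in h.
exact: lifts_inj z h (lifts_opp (lifts_tr (lifts_HS f_smooth i))).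
Qed.

Lemma Kform_piQ z i : Kform F z (dz R i) *m piQ (F z) = Kform F z (dz R i).
Proof.
have h := lifts_mul (lifts_KS f_smooth i) (lifts_PS f_smooth 0).
have e : KS f_smooth i *m P = KS f_smooth i by rewrite /KS -mulmxA PS_idem.
rewrite e in h; exact: lifts_inj z h (lifts_KS f_smooth i).
Qed.

Lemma piQ_idem z : piQ (F z) *m piQ (F z) = piQ (F z).
Proof.
have h := lifts_mul (lifts_PS f_smooth 0) (lifts_PS f_smooth 0).
rewrite PS_idem in h; exact: lifts_inj z h (lifts_PS f_smooth 0).
Qed.

(** The mean curvature operator is a multiple of the projector [p] of rank two, and its trace is
    minus the energy density. The factor [a] scales the coordinate vectors to an
    orthonormal frame. *)
Lemma rank_two_mean_curvature m (p : 'M[R]_m) (H K H' K' : 'I_2 -> 'M[R]_m) (a mu e : R) :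
  p *m p = p -> \tr p = 2 -> (forall i, K i = - (H i)^T) -> (forall i, K i *m p = K i) ->
  (forall i, H' i = a *: H i) -> (forall i, K' i = a *: K i) ->
  (forall t : 'cV_m, p *m t = t -> (\sum_(i < 2) H' i *m K' i) *m t = - (mu *: t)) ->
  \sum_(i < 2) hom_dot (H' i) (H' i) = e ->
  (a * a) *: (H 0 *m K 0 + H 1 *m K 1) = - (e / 2 *: p).
Proof.
move=> pp trp KH Kp HH KK EH en.
set X := _ *: _.
have XE : \sum_(i < 2) H' i *m K' i = X.
  by rewrite sum2 !HH !KK -!scalemxAl -!scalemxAr !scalerA -scalerDr.
have Xp : X *m p = X by rewrite /X -scalemxAl mulmxDl -!mulmxA !Kp.
have Xmu : X = - (mu *: p).
  rewrite -Xp; apply/matrixP => i j.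
  have := EH (col j p); rewrite XE !colE !mulmxA pp -scalemxAl => /(_ erefl)/colP/(_ i).
  by rewrite -!colE !mxE.
have trX : \tr X = - e.
  rewrite -en sum2 !HH /X !KH mxtraceZ mxtraceD /hom_dot.
  have tH i : \tr (H i *m - (H i)^T) = - \tr ((H i)^T *m H i).
    by rewrite mulmxN raddfN /= mxtrace_mulC.
  have tH' i : \tr ((a *: H i)^T *m (a *: H i)) = a * a * \tr ((H i)^T *m H i).
    by rewrite trmx_scale -scalemxAl -scalemxAr scalerA mxtraceZ.
  by rewrite !tH !tH'; ring.
rewrite Xmu; congr (- (_ *: _)); move: trX; rewrite Xmu raddfN /= mxtraceZ trp => /oppr_inj <-.
by field.
Qed.

End Line.

(** * The equations of the isotropic line bundle *)

Lemma opp_addNN (V : zmodType) (x y : V) : - (- x + - y) = x + y.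
Proof. by rewrite -opprD opprK. Qed.

Lemma sandwichNN (A : comNzRingType) N (P K X Y : 'M[A]_N) : P *m K *m P = K ->
  - (X *m P) *m K *m - (P *m Y) = X *m K *m Y.
Proof. by move=> {2}<-; rewrite !mulNmx mulmxN opprK !mulmxA. Qed.

Section Comb.
Variables (A : comNzRingType) (N : nat).
Implicit Types X Y Pi : 'M[A]_N.

Lemma map_comb p (a b : A) (d e : derivation A) (X : 'M[A]_(N, p)) :
  map_mx (der_comb a b d e) X = a *: map_mx d X + b *: map_mx e X.
Proof. by apply/matrixP => i j; rewrite !mxE. Qed.

Lemma flat_comb a b Pi X Y : Pi *m X *m Y *m Pi = Pi *m Y *m X *m Pi ->
  Pi *m (a *: X + b *: Y) *m (a *: X + - b *: Y) *m Pi =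
  Pi *m (a *: X + - b *: Y) *m (a *: X + b *: Y) *m Pi.
Proof.
move=> h; rewrite !(mulmxDr, mulmxDl); do ?[rewrite -!scalemxAr|rewrite -!scalemxAl].
rewrite h.
move: (Pi *m X *m X *m Pi) (Pi *m Y *m X *m Pi) (Pi *m Y *m Y *m Pi) => U V W.
by apply/matrixP => i j; rewrite !mxE; ring.
Qed.

Variables (Pi : 'M[A]_N) (PiPi : Pi *m Pi = Pi) (d e : derivation A) (a b : A).
Hypothesis de : forall x, d (e x) = e (d x).
Hypothesis Pi_flat :
  Pi *m map_mx d Pi *m map_mx e Pi *m Pi = Pi *m map_mx e Pi *m map_mx d Pi *m Pi.

Lemma nabla_comb2 : d a = 0 -> e a = 0 -> d b = 0 -> e b = 0 ->
  nabla Pi (der_comb a b d e) (nabla Pi (der_comb a (- b) d e) Pi) =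
  a ^+ 2 *: nabla Pi d (nabla Pi d Pi) - b ^+ 2 *: nabla Pi e (nabla Pi e Pi).
Proof.
move=> da ea db eb.
have nc p c c' (X : 'M[A]_(N, p)) : nabla Pi (der_comb c c' d e) X =
    c *: nabla Pi d X + c' *: nabla Pi e X.
  by rewrite /nabla map_comb mulmxDr -!scalemxAr.
have comm : nabla Pi d (nabla Pi e Pi) = nabla Pi e (nabla Pi d Pi).
  rewrite !nabla_nabla // Pi_flat; congr (_ + _ *m _).
  by apply/matrixP => i j; rewrite !mxE de.
have sn d' : Pi *m nabla Pi (der_fun d') Pi = nabla Pi d' Pi by rewrite /nabla mulmxA PiPi.
have nZ (d' : derivation A) c (X : 'M[A]_N) : d' c = 0 -> Pi *m X = X ->
   nabla Pi d' (c *: X) = c *: nabla Pi d' X.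
  by move=> dc sX; rewrite nablaZ // dc scale0r add0r.
rewrite !nc !nablaD !nZ ?sn ?derN ?da ?ea ?db ?eb ?oppr0 // comm.
move: (nabla Pi d _) (nabla Pi e (nabla Pi d Pi)) (nabla Pi e _) => U V W.
by apply/matrixP => i j; rewrite !mxE; ring.
Qed.

End Comb.

Section Equations.
Variables (R : realType) (n l : nat) (f : CP1 R -> Gr R n).
Hypothesis f_smooth : smooth_map f.
Notation T := 'rV[R]_2.
Notation S := (smooth_fun R).
Local Notation F := (local f 0).
Local Notation P := (PS f_smooth 0).
Local Notation J := (JS f_smooth 0).
Local Notation Pi := (PiS f_smooth).
Local Notation d i := (pder (dz R i)).
Local Notation w := (affine_calculus R).

Lemma lifts_scale m k (AS : 'M[S]_(m, k)) M (a : S) (b : T -> R) :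
  lifts AS M -> (forall z, ev z a = (b z)%:C) -> lifts (a *: AS) (fun z => b z *: M z).
Proof. by move=> h ha z i j; rewrite !mxE evM ha h rmorphM. Qed.

(** This is e(f) / (2 lambda^2), where e(f) = 8 pi l (l + 1) and lambda^2 = pi (1 + |z|^2)^2 is the
    square of [FS_scale]. *)
Definition kappa : S := cS (4 * (l * l.+1))%N%:R * rho w ^+ 2.

Lemma ev_kappa z : ev z kappa = ((4 * (l * l.+1))%N%:R * (1 + rsq z) ^- 2)%:C.
Proof.
have E : ev z (rho w ^+ 2) = ((1 + rsq z) ^- 2)%:C.
  by rewrite expr2 evM !ev_rhoS -rmorphM -invfM -expr2.
rewrite /kappa evM E ev_cS.
have -> : (4 * (l * l.+1))%N%:R = ((4 * (l * l.+1))%N%:R)%:C :> R[i] by rewrite rmorph_nat.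
by rewrite -rmorphM.
Qed.

Lemma EH_equation : Einstein_Hermitian f -> EH_constant f 0 l ->
  P *m map_mx (d 0) P *m map_mx (d 0) P *m P +
  P *m map_mx (d 1) P *m map_mx (d 1) P *m P = kappa *: P.
Proof.
move=> [mu mu0 EH] en.
have L0 := lifts_opp (lifts_add (lifts_mul (lifts_HS f_smooth 0) (lifts_KS f_smooth 0))
   (lifts_mul (lifts_HS f_smooth 1) (lifts_KS f_smooth 1))).
have L1 := lifts_scale (lifts_PS f_smooth 0) ev_kappa.
have <- : - (HS f_smooth 0 *m KS f_smooth 0 + HS f_smooth 1 *m KS f_smooth 1) = 
  P *m map_mx (d 0) P *m map_mx (d 0) P *m P +
  P *m map_mx (d 1) P *m map_mx (d 1) P *m P.
  apply: (etrans (congr2 (fun X Y => - (X + Y)) (HKE f_smooth 0) (HKE f_smooth 1))).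
  exact: opp_addNN.
apply: (lifts_eq L0 L1) => z.
have A := @rank_two_mean_curvature R _ (piQ (F z)) (fun i => Hform F z (dz R i))
  (fun i => Kform F z (dz R i)) (fun i => Hform F z (FS_frame z i))
  (fun i => Kform F z (FS_frame z i)) (FS_scale z) mu _ (piQ_idem f_smooth z) (piQ_trace _)
  (Kform_tr f_smooth z) (Kform_piQ f_smooth z) (fun i => HformZ f_smooth z (FS_scale z) i)
  (fun i => KformZ f_smooth z (FS_scale z) i) (EH 0 z) (en 0 z).
move: A; move: (_ + _) => X A.
have l0 := FS_scale_neq0 z; have l2 : FS_scale z * FS_scale z = pi * (1 + rsq z) ^+ 2 by rewrite -expr2 FS_scale_sq.
have ll0 : FS_scale z * FS_scale z != 0 by rewrite mulf_neq0.
apply: (scalerI ll0); rewrite scalerN A opprK scalerA; congr (_ *: _).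
rewrite l2; have q0 := qrho_neq0 z.
have -> : (`|0| + l + 1)%N = l.+1 by rewrite add0n addn1.
rewrite addn0 -mulnA !natrM.
by field.
Qed.

(** Up to a constant factor, the pulled back Kaehler form is the trace in [line_flat]. *)
Lemma totally_real_equation : totally_real f ->
  Pi *m map_mx (d 1) Pi *m map_mx (d 0) Pi *m Pi =
  Pi *m map_mx (d 0) Pi *m map_mx (d 1) Pi *m Pi.
Proof.
move=> tr; have L := line_PiS f_smooth.
have HP i : HS f_smooth i = - (P *m map_mx (d i) P).
  by rewrite HSE mulmxBr mulmx1 (PidPiPi (PS_idem f_smooth)) subr0.
have HT i : (HS f_smooth i)^T = - (map_mx (d i) P *m P).
  by rewrite HP raddfN /= trmx_mul PS_tr dPS_tr.
have PPE : Pi + Pi^T = P by exact: PS_PiS.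
apply: (line_flat (@invSP R) L); rewrite PPE JS_PiS.
have PJP : P *m (cS (ii R) *: J) *m P = cS (ii R) *: J.
  by rewrite -JS_PiS -PPE mulmxBr mulmxBl (PPi L) (PPiT L) (PiP L) (PiTP L).
have t0 : \tr ((HS f_smooth 0)^T *m J *m HS f_smooth 1) = 0.
  apply: ev_inj => z; rewrite ev0.
  have L0 := lifts_mul (lifts_mul (lifts_tr (lifts_HS f_smooth 0)) (lifts_JS f_smooth 0))
    (lifts_HS f_smooth 1).
  have := tr 0 z (dz R 0) (dz R 1); rewrite /hom_dot trmx_mul Jmx_tr mulmxN mulNmx raddfN /=.
  move=> /eqP; rewrite oppr_eq0 => /eqP h.
  rewrite /mxtrace ev_sum (eq_bigr _ (fun i _ => L0 z i i)) -rmorph_sum.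
  exact: (etrans (congr1 (real_complex R) h) (rmorph0 _)).
have E : (HS f_smooth 0)^T *m (cS (ii R) *: J) *m HS f_smooth 1 =
    map_mx (d 0) P *m (cS (ii R) *: J) *m map_mx (d 1) P.
  by rewrite HT HP; exact: sandwichNN PJP.
have := congr1 (fun X => cS (ii R) * X) t0.
rewrite -mxtraceZ scalemxAl scalemxAr E mulr0 => h.
by rewrite -mulmxA mxtrace_mulC -mulmxA mxtrace_mulC -!mulmxA; move: h; rewrite -!mulmxA.
Qed.

Lemma del_affine p m (X : 'M[S]_(p, m)) : map_mx (del w) X =
  cS (half R) *: map_mx (d 0) X + - cS (half R * ii R) *: map_mx (d 1) X.
Proof. by rewrite map_comb rmorphN. Qed.

Lemma delb_affine p m (X : 'M[S]_(p, m)) : map_mx (delb w) X =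
  cS (half R) *: map_mx (d 0) X + cS (half R * ii R) *: map_mx (d 1) X.
Proof. exact: map_comb. Qed.

Lemma flat_affine : totally_real f -> flat Pi w.
Proof.
move=> tr; rewrite /flat del_affine delb_affine; apply: esym; apply: flat_comb.
by rewrite totally_real_equation.
Qed.

Lemma minimal_equation : minimal f ->
  P *m map_mx (d 0) (P *m map_mx (d 0) P *m (1%:M - P)) *m (1%:M - P) +
  P *m map_mx (d 1) (P *m map_mx (d 1) P *m (1%:M - P)) *m (1%:M - P) = 0.
Proof.
move=> fmin; have := minimal_eq f_smooth fmin.
have E i : P *m map_mx (d i) (HS f_smooth i) *m (1%:M - P) =
   - (P *m map_mx (d i) (P *m map_mx (d i) P *m (1%:M - P)) *m (1%:M - P)).
  by rewrite HSE map_mxN mulmxN mulNmx.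
move=> h; have {}h := etrans (esym (congr2 +%R (E 0) (E 1))) h.
by apply: oppr_inj; rewrite oppr0 opprD.
Qed.

(** In terms of the two Wirtinger derivatives, [line_laplacian] is four times the mixed
    derivative, the commutator of the real directions being 0 by flatness. *)
Lemma eigen_affine : minimal f -> totally_real f -> Einstein_Hermitian f -> EH_constant f 0 l ->
  nabla Pi (del w) (nabla Pi (delb w) Pi) = - ((l * l.+1)%:R * rho w ^+ 2) *: Pi.
Proof.
move=> fmin tr EH en; have L := line_PiS f_smooth.
have PPE : Pi + Pi^T = P by exact: PS_PiS.
have HM := minimal_equation fmin; have HE := EH_equation EH en.
rewrite -!PPE in HM HE.
have lap := line_laplacian (@invSP R) L HM HE.
have PiPi := line_idem L.
rewrite (nabla_comm PiPi (flat_affine tr) PiPi).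
have dE p (X : 'M[S]_(n.+2, p)) : nabla Pi (del w) X =
    nabla Pi (der_comb (cS (half R)) (- cS (half R * ii R)) (d 0) (d 1)) X.
  by rewrite /nabla del_affine map_comb.
have N2 := nabla_comb2 PiPi (d := d 0) (e := d 1) (a := cS (half R)) (b := cS (half R * ii R))
  (pd_comm (dz R 0) (dz R 1)) (esym (totally_real_equation tr))
  (pd_cS _ _) (pd_cS _ _) (pd_cS _ _) (pd_cS _ _).
have dbE p (X : 'M[S]_(n.+2, p)) : nabla Pi (delb w) X =
    nabla Pi (der_comb (cS (half R)) (cS (half R * ii R)) (d 0) (d 1)) X by [].
rewrite dE dbE N2.
have h2 : cS (half R) ^+ 2 = cS (4%:R^-1).
  by rewrite -rmorphXn; congr (cS _); apply: complexP => /=; field.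
have hi2 : cS (half R * ii R) ^+ 2 = - cS (4%:R^-1).
  by rewrite -rmorphXn -rmorphN; congr (cS _); apply: complexP => /=; field.
rewrite h2 hi2 scaleNr opprK -scalerDr lap scalerA; congr (_ *: _).
rewrite mulrN /kappa natrM; congr (- _).
rewrite -(rmorph_nat (@cS R)) mulrA -rmorphM; congr (cS _ * _).
by field.
Qed.

End Equations.

(** * Vanishing of the extreme ladders *)

Section Regular.
Variable R : realType.
Notation T := 'rV[R]_2.
Notation S := (smooth_fun R).
Local Notation w := (affine_calculus R).

Definition reg_mx m k (X : 'M[S]_(m, k)) := forall i j, reg (X i j).
Definition van_mx m k (X : 'M[S]_(m, k)) := forall i j, van (X i j).

Lemma van_mx_reg m k (X : 'M[S]_(m, k)) : van_mx X -> reg_mx X.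
Proof. by move=> h i j; exact: van_reg. Qed.

Lemma van_mxD m k (X Y : 'M[S]_(m, k)) : van_mx X -> van_mx Y -> van_mx (X + Y).
Proof. by move=> hX hY i j; rewrite mxE; exact: vanD. Qed.

Lemma van_mxZ m k a (X : 'M[S]_(m, k)) : van a -> reg_mx X -> van_mx (a *: X).
Proof. by move=> ha hX i j; rewrite mxE; exact: vanM. Qed.

Lemma van_mxM m k p (X : 'M[S]_(m, k)) (Y : 'M[S]_(k, p)) :
  reg_mx X -> van_mx Y -> van_mx (X *m Y).
Proof.
by move=> hX hY i j; rewrite mxE; apply: van_sum => a; exact: vanMl.
Qed.

Lemma van_rho_zb : van (rho w * zb w).
Proof.
exists (rho w * zc w) => [z z0|]; last by rewrite evM ev_zS !mxE mulr0.
have q0 := qrho_neq0 z; have r0 := rsq_neq0 z0.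
rewrite !evM !ev_rhoS ev_zS invT0 invT1 rsq_inv // /invx /invy ev_conjS ev_zS.
have q1 : 1 + (rsq z)^-1 != 0.
  by rewrite gt_eqF // addr_gt0 // invr_gt0 rsq_gt0.
by apply: complexP => /=; field; rewrite r0 ?andbT addrC q0.
Qed.

Lemma van_rho_z : van (rho w * zc w).
Proof.
suff -> : rho w * zc w = conjS (rho w * zb w) by exact: van_conj van_rho_zb.
rewrite rmorphM; congr (_ * _); last exact: esym (conjSK (zS R)).
by apply: ev_inj => z; apply: complexP => //=; rewrite oppr0.
Qed.

Lemma van_mx_der m k (d : derivation S) (X : 'M[S]_(m, k)) :
  (forall u, reg u -> van (d u)) -> reg_mx X -> van_mx (map_mx d X).
Proof. by move=> hd hX i j; rewrite mxE; exact: hd. Qed.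

Lemma van_del u : reg u -> van (del w u).
Proof.
by move=> ru; apply: vanD; apply: vanMl; [exact: reg_cS|exact: van_pd|exact: reg_cS|exact: van_pd].
Qed.

Lemma van_delb u : reg u -> van (delb w u).
Proof.
by move=> ru; apply: vanD; apply: vanMl; [exact: reg_cS|exact: van_pd|exact: reg_cS|exact: van_pd].
Qed.

Section Ladder.
Variables (N : nat) (Pi : 'M[S]_N) (v : wirtinger S).
Hypotheses (PiPi : Pi *m Pi = Pi) (Pi_reg : reg_mx Pi).
Hypotheses (v_del : forall u, reg u -> van (del v u)) (v_zb : van (rho v * zb v)).

Lemma van_tensor_raise n (X : 'M[S]_N) : Pi *m X = X -> reg_mx (rho v ^+ n *: X) ->
  van_mx (rho v ^+ n.+1 *: raise Pi v n%:R X).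
Proof.
move=> sX rX; rewrite tensor_raise //; apply: van_mxD.
  by apply: van_mxM => //; exact: van_mx_der.
apply: van_mxZ => //; rewrite -mulrA; apply: vanMl => //.
have -> : 2 * n%:R = cS (2 * n%:R) :> S by rewrite rmorphM !rmorph_nat.
exact: reg_cS.
Qed.

(** Induction with [tensor_raise]: covariant derivatives vanish at infinity by [van_pd], and so does
    the factor rho zb. *)
Lemma van_ladder n : van_mx (rho v ^+ n.+1 *: ladder Pi v 0 Pi n.+1).
Proof.
suff h : reg_mx (rho v ^+ n *: ladder Pi v 0 Pi n).
  rewrite [ladder _ _ _ _ _]/= add0r; apply: van_tensor_raise => //; exact: ladder_sec.
elim: n => [|n IH]; first by rewrite expr0 scale1r.
apply: van_mx_reg; rewrite [ladder _ _ _ _ _]/= add0r.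
apply: van_tensor_raise => //; exact: ladder_sec.
Qed.

End Ladder.

Variables (N l : nat) (Pi : 'M[S]_N).
Hypotheses (PiPi : Pi *m Pi = Pi) (Pi_reg : reg_mx Pi).
Hypotheses (PiH : adj (affine_conj R) Pi = Pi) (Pi_flat : flat Pi w).
Hypothesis Pi_eigen : nabla Pi (del w) (nabla Pi (delb w) Pi) =
  - ((l * l.+1)%:R * rho w ^+ 2) *: Pi.

Lemma rho_cancel k (X : 'M[S]_N) : rho w ^+ k *: X = 0 -> X = 0.
Proof.
move=> h; rewrite -[X]scale1r -(expr1n S k) -(rhoP w) mulrC exprMn -scalerA h.
by rewrite scaler0.
Qed.

(** It is a holomorphic differential of positive order with values in a flat bundle over the
    sphere. *)
Lemma ladder_top : ladder Pi w 0 Pi l.+1 = 0.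
Proof.
apply: (@rho_cancel l.+1); apply: (holomorphic_vanishing PiPi PiH Pi_flat).
- by rewrite -scalemxAr ladder_sec.
- exact: (van_ladder (v := w) PiPi Pi_reg van_del van_rho_zb l).
- exact: Pi_tensor_holomorphic PiPi Pi_flat Pi_eigen.
Qed.

Lemma ladder_bot : ladder Pi (swapw w) 0 Pi l.+1 = 0.
Proof.
apply: (@rho_cancel l.+1); apply: (antiholomorphic_vanishing PiPi PiH Pi_flat).
- by rewrite -scalemxAr ladder_sec.
- exact: (van_ladder (v := swapw w) PiPi Pi_reg van_delb van_rho_z l).
- apply: (@Pi_tensor_holomorphic _ _ _ (swapw w) _ PiPi (esym Pi_flat)).
  by rewrite /= -(nabla_comm PiPi Pi_flat PiPi).
Qed.

End Regular.

(** * Normal form of the map in an affine chart *)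

(** An immersion has positive energy. *)
Lemma EH_constant_gt0 (R : realType) (n l : nat) (f : CP1 R -> Gr R n) :
  homothetic_immersion f -> EH_constant f 0 l -> (0 < l)%N.
Proof.
move=> [a a0 fa] en; rewrite lt0n; apply/eqP => l0.
have := en 0 0; rewrite /energy_density l0 => h.
have : a * 2 = 0 :> R.
  rewrite -[RHS](_ : 4 * pi * (2 * 0 * (`|0| + 0 + 1) + `|0|)%N%:R = 0 :> R); last first.
    by rewrite muln0 mul0n addn0 mulr0.
  rewrite -h (eq_bigr (fun=> a)) => [|i _]; last first.
    by rewrite fa FS_frame_orthonormal eqxx mulr1.
  by rewrite sumr_const card_ord mulr_natr.
by move/eqP; rewrite mulf_eq0 pnatr_eq0 orbF gt_eqF.
Qed.

Lemma reg_sum (R : realType) (I : Type) (r : seq I) (F : I -> smooth_fun R) :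
  (forall i, reg (F i)) -> reg (\sum_(i <- r) F i).
Proof. by move=> h; elim/big_ind: _ => //; [exact: van_reg (van0 R)|exact: regD]. Qed.

Lemma der_const_mx (R : realType) (d : derivation (smooth_fun R)) m k (M : 'M[R[i]]_(m, k)) :
  (forall a, d (cS a) = 0) -> map_mx d (map_mx (@cS R) M) = 0.
Proof. by move=> h; apply/matrixP => i j; rewrite mxE mxE h mxE. Qed.

Section NormalForm.
Variables (R : realType) (n l : nat) (f : CP1 R -> Gr R n).
Hypotheses (f_mi : minimal_immersion f) (f_tr : totally_real f).
Hypotheses (f_EH : Einstein_Hermitian f) (f_l : EH_constant f 0 l).
Notation T := 'rV[R]_2.
Notation S := (smooth_fun R).
Notation C := R[i].
Local Notation F := (local f 0).
Local Notation w := (affine_calculus R).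
Local Notation c := (affine_conj R).

Definition zeta (z : T) : C := z 0 0 +i* z 0 1.

(** The form (a x + b y)^l (- conj b x + conj a y)^l at x = 1, y = 'X. Up to a factor, it is x^l y^l
    moved by the unitary matrix whose first column is proportional to (a, b). *)
Definition binary_form (a b : C) : {poly C} :=
  (a%:P + b *: 'X) ^+ l * ((- conjc b)%:P + conjc a *: 'X) ^+ l.

Lemma ev_weight_poly z k : ev z (weight_poly w l)`_k = (binary_form 1 (zeta z))`_k.
Proof.
rewrite -[LHS]/((ev z) _) -coef_map /weight_poly /binary_form.
apply: (congr1 (fun p : {poly C} => p`_k)); rewrite rmorphM !rmorphXn; congr (_ ^+ _ * _ ^+ _).
  by rewrite rmorphD rmorph1 rmorphM /= map_polyC map_polyX mul_polyC.
rewrite rmorphB /= map_polyC map_polyX polyCN addrC; congr (_ + _).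
by rewrite -[X in X *: _]/(conjc 1) rmorph1 scale1r.
Qed.

(** [parallel_normal_form] over the ring of smooth functions. The parallel frame starts from
    e1 + i e2 at the origin, and constants of the ring are identified with their values. *)
Theorem isotropic_line_normal_form : exists g : nat -> 'rV[C]_n.+2,
  [/\ forall z, let u := \sum_(k < (2 * l).+1) (binary_form 1 (zeta z))`_k *: g k in
        (map_mx conjc u)^T *m u = ((1 + rsq z) ^+ (2 * l))%:C *:
          (map_mx (real_complex R) (piQ (F z)) + ii R *: map_mx (real_complex R) (Jmx (F z))),
      forall j k, (j <= 2 * l)%N -> (k <= 2 * l)%N -> g j *m (g k)^T = 0,
      forall j k, (j <= 2 * l)%N -> (k <= 2 * l)%N -> j != k ->
            g j *m (map_mx conjc (g k))^T = 0
    & forall k, (k < 2 * l)%N ->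
            'C(2 * l, k.+1)%:R *: (g k.+1 *m (map_mx conjc (g k.+1))^T) =
            'C(2 * l, k)%:R *: (g k *m (map_mx conjc (g k))^T)].
Proof.
have [f_smooth f_hom f_min] := f_mi.
have l_gt0 := EH_constant_gt0 f_hom f_l.
have L := line_PiS f_smooth; set Pi := PiS f_smooth in L.
have PiPi := line_idem L; have PiH : adj c Pi = Pi by exact: adj_PiS.
have fl : flat Pi w by exact: flat_affine.
have eig := eigen_affine f_smooth f_min f_tr f_EH f_l.
have Preg : reg_mx Pi.
  move=> i j; rewrite mxE; apply: regM; first exact: reg_cS.
  rewrite mxE; apply: regD; last by rewrite mxE; apply: regM (reg_cS _) (JS_reg _ _ _).
  rewrite !mxE -mulN1r; apply: regM.
    by rewrite -(rmorph1 (@cS R)) -rmorphN; exact: reg_cS.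
  by apply: reg_sum => k; apply: regM; exact: JS_reg.
have top := ladder_top PiPi Preg PiH fl eig.
have bot := ladder_bot PiPi Preg PiH fl eig.
have [e1 [e2 [h12 _ P0]]] := ev_PiS_cvec f_smooth 0.
pose E0 : 'cV[S]_n.+2 := map_mx (@cS R) (cvec e1 e2).
have evE0 : map_mx (ev 0) E0 = cvec e1 e2 by apply/matrixP => i j; rewrite !mxE.
have dE0 : map_mx (del w) E0 = 0.
  by apply: der_const_mx => a; rewrite /= /comb_fun /= !pd_cS !mulr0 addr0.
have dbE0 : map_mx (delb w) E0 = 0.
  by apply: der_const_mx => a; rewrite /= /comb_fun /= !pd_cS !mulr0 addr0.
have E0s : map_mx (ev 0) (Pi *m E0) = map_mx (ev 0) E0.
  rewrite map_mxM evE0 P0 -scalemxAl -mulmxA cvec_norm // mul_mx_scalar scalerA.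
  by rewrite mulrC half2 scale1r.
have adjE0 : map_mx (ev 0) (adj c E0) = cvec_adj e1 e2.
  by rewrite cvec_adjT; apply/matrixP => i j; rewrite !mxE.
have E0n : map_mx (ev 0) (adj c E0 *m E0) = 2%:M by rewrite map_mxM adjE0 evE0 cvec_norm.
have ev0z : ev 0 (zc w) = 0 by apply: complexP; rewrite /= mxE.
have ev0zb : ev 0 (zb w) = 0 by apply: complexP; rewrite /= mxE // oppr0.
have [u [g [uP [gz gzb uE] uu uu0 H]]] := parallel_normal_form (@invSP R) PiPi PiH (line_iso L)
  (line_rank1 L) fl eig ev0z ev0zb (@ev0_const R) top bot dE0 dbE0 E0s E0n
  (fun a b (h : ev 0 a = ev 0 b) => congr1 conjc h) l_gt0.
have [G1 G2 G3] := H C (ev 0) conjc ev0z ev0zb (fun a => erefl).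
exists (fun k => map_mx (ev 0) (g k)); split=> // z.
set r := ((1 + rsq z) ^- l)%:C.
have g_cst k : map_mx (ev z) (g k) = map_mx (ev 0) (g k).
  apply/matrixP => i j; rewrite !mxE.
  have h1 : dzS R (g k i j) = 0 by have := congr1 (fun M : 'rV[S]_(n.+2) => M i j) (gz k); rewrite !mxE.
  have h2 : dzbS R (g k i j) = 0 by have := congr1 (fun M : 'rV[S]_(n.+2) => M i j) (gzb k); rewrite !mxE.
  by rewrite [X in ev z X](const_S h1 h2).
set U := \sum_(k < _) _; cbv zeta.
have evu : map_mx (ev z) u = r *: U.
  rewrite uE; apply: etrans (map_mxZ _ _ _) _; congr (_ *: _).
    rewrite rmorphXn /r -exprVn rmorphXn.
    exact: (congr1 (fun a => a ^+ l) (ev_rhoS z)).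
  rewrite map_mx_sum; apply: eq_bigr => k _; rewrite map_mxZ g_cst.
  congr (_ *: _); exact: ev_weight_poly.
have eqz : (map_mx conjc (map_mx (ev z) u))^T *m map_mx (ev z) u = 2%:R *: map_mx (ev z) Pi.
  have := congr1 (map_mx (ev z)) uP; rewrite map_mxM map_mxZ rmorph_nat => <-; congr (_ *m _).
  by apply/matrixP => i j; rewrite !mxE.
have qn0 : (1 + rsq z) ^+ l != 0 by rewrite expf_neq0 ?qrho_neq0.
have rr : ((1 + rsq z) ^+ (2 * l))%:C * (r * r) = 1.
  by rewrite /r -!rmorphM mulnC exprM expr2 -invfM mulfV ?mulf_neq0 // rmorph1.
have rc : conjc r = r by apply: complexP => //=; rewrite oppr0.
have Uz : (map_mx conjc (map_mx (ev z) u))^T *m map_mx (ev z) u = (r * r) *: ((map_mx conjc U)^T *m U).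
  rewrite evu map_mxZ -[X in (X *: _)^T]/(conjc r) rc trmx_scale.
  by rewrite -scalemxAl -scalemxAr scalerA.
move: Uz; rewrite -/U eqz ev_PiS scalerA half2 scale1r => ->.
by rewrite scalerA rr scale1r.
Qed.

End NormalForm.

(** * A real frame *)

Section RealFrame.
Variables (R : realType) (N l : nat).
Notation C := R[i].
Variable g : nat -> 'rV[C]_N.
Hypothesis g_iso : forall j k, (j <= 2 * l)%N -> (k <= 2 * l)%N -> g j *m (g k)^T = 0.
Hypothesis g_orth : forall j k, (j <= 2 * l)%N -> (k <= 2 * l)%N -> j != k ->
  g j *m (map_mx conjc (g k))^T = 0.
Hypothesis g_norm : forall k, (k < 2 * l)%N ->
  'C(2 * l, k.+1)%:R *: (g k.+1 *m (map_mx conjc (g k.+1))^T) =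
  'C(2 * l, k)%:R *: (g k *m (map_mx conjc (g k))^T).

Let a k i : R := complex.Re (g k 0 i).
Let b k i : R := complex.Im (g k 0 i).

Let ReS (I : finType) (F : I -> C) : complex.Re (\sum_i F i) = \sum_i complex.Re (F i).
Proof. by apply: (big_morph (@complex.Re R)) => // x y; exact: Re_add. Qed.
Let ImS (I : finType) (F : I -> C) : complex.Im (\sum_i F i) = \sum_i complex.Im (F i).
Proof. by apply: (big_morph (@complex.Im R)) => // x y; exact: Im_add. Qed.

Let P j k : C := (g j *m (g k)^T) 0 0.
Let Q j k : C := (g j *m (map_mx conjc (g k))^T) 0 0.

Let PE j k : P j k = (\sum_i (a j i * a k i - b j i * b k i)) +i* (\sum_i (a j i * b k i + b j i * a k i)).
Proof.
rewrite /P mxE; apply: complexP; rewrite ?ReS ?ImS /=; apply: eq_bigr => i _; rewrite mxE /a /b.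
  by case: (g j 0 i) => x y; case: (g k 0 i) => u v.
by case: (g j 0 i) => x y; case: (g k 0 i) => u v.
Qed.

Let QE j k : Q j k = (\sum_i (a j i * a k i + b j i * b k i)) +i* (\sum_i (b j i * a k i - a j i * b k i)).
Proof.
rewrite /Q mxE; apply: complexP; rewrite ?ReS ?ImS /=; apply: eq_bigr => i _; rewrite !mxE /a /b.
  by case: (g j 0 i) => x y; case: (g k 0 i) => u v /=; ring.
by case: (g j 0 i) => x y; case: (g k 0 i) => u v /=; ring.
Qed.

Let s k : R := Num.sqrt ('C(2 * l, k)%:R).
Definition gram : R := complex.Re (Q 0 0).

Let QC k : (k <= 2 * l)%N -> s k * s k * complex.Re (Q k k) = gram.
Proof.
rewrite -expr2 sqr_sqrtr ?ler0n //; elim: k => [|k IH] hk; first by rewrite bin0 mul1r.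
rewrite -IH 1?ltnW //; have := congr1 (fun M : 'M[C]_1 => complex.Re (M 0 0)) (g_norm hk).
have e c (M : 'M[C]_1) : complex.Re ((c *: M) 0 0) = complex.Re (c * M 0 0) by rewrite mxE.
rewrite !e -!/(Q _ _) !Re_mul.
have h m : complex.Im (m%:R : C) = 0 by rewrite -(rmorph_nat (real_complex R)).
have h' m : complex.Re (m%:R : C) = m%:R by rewrite -(rmorph_nat (real_complex R)).
by rewrite !h !h' !mul0r !subr0.
Qed.

(** In the orthonormal basis b_j, i b_j of the space of binary forms, the real linear map
    sending the j-th monomial to the real part of [g j], and i times it to that of i [g j]. *)
Definition real_frame : 'M[R]_(N, (4 * l).+2) :=
  \matrix_(i, k) (if odd k then - (s k./2 * b k./2 i) else s k./2 * a k./2 i).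

Let rel j k : (j <= 2 * l)%N -> (k <= 2 * l)%N ->
  [/\ s j * s k * \sum_i a j i * a k i = if j == k then gram / 2 else 0,
      s j * s k * \sum_i b j i * b k i = if j == k then gram / 2 else 0 &
      \sum_i a j i * b k i = 0].
Proof.
move=> hj hk; have : P j k = 0 by rewrite /P g_iso // mxE.
rewrite PE => -[]; rewrite sumrB big_split /=; set A := \sum_i _; set B := \sum_i _.
set D := \sum_i _; set E := \sum_i _ => /eqP h1 /eqP h2.
have AB : A = B by apply/eqP; rewrite -subr_eq0.
have DE : E = - D by apply/eqP; rewrite -addr_eq0 addrC.
have ReQ : complex.Re (Q j k) = A + A by rewrite QE /= big_split /= -/A -/B -AB.
have ImQ : complex.Im (Q j k) = - (D + D) by rewrite QE /= sumrB -/D -/E DE opprD.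
rewrite -AB; case: eqP => [jk|/eqP jk].
  have HA : s j * s k * A = gram / 2.
    have e1 : Q k k = Q j k by rewrite jk.
    have e2 : s j = s k by rewrite jk.
    by rewrite e2 -(QC hk) e1 ReQ; field.
  split=> //.
  have : D = E by rewrite /D /E jk; apply: eq_bigr => i _; rewrite mulrC.
  by rewrite DE => /eqP; rewrite -subr_eq0 opprK -mulr2n mulrn_eq0 => /eqP.
have Q0 : Q j k = 0 by rewrite /Q g_orth // mxE.
move: ReQ ImQ; rewrite Q0 /= => /esym/eqP; rewrite -mulr2n mulrn_eq0 /= => /eqP ->.
move=> /esym/eqP; rewrite oppr_eq0 -mulr2n mulrn_eq0 /= => /eqP ->.
by rewrite mulr0.
Qed.

(** The real parts of the bilinear and of the Hermitian product of two of the [g k] are the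
    difference and the sum of the inner products of their real and of their imaginary parts. *)
Lemma real_frame_gram : real_frame^T *m real_frame = (gram / 2)%:M.
Proof.
have hl (k : 'I_(4 * l).+2) : (k./2 <= 2 * l)%N by have := ltn_ord k; lia.
have nk (k k' : 'I_(4 * l).+2) : (k == k') = (odd k == odd k') && (k./2 == k'./2).
  apply/eqP/andP => [-> //|[/eqP h1 /eqP h2]]; apply/val_inj => /=.
  by rewrite -(odd_double_half k) h1 h2 odd_double_half.
have H c d (F G : 'I_N -> R) : \sum_i c * F i * (d * G i) = c * d * \sum_i F i * G i.
  by rewrite mulr_sumr; apply: eq_bigr => i _; ring.
apply/matrixP => k k'; rewrite !mxE nk.
have [r1 r2 r3] := rel (hl k) (hl k'); have [_ _ r4] := rel (hl k') (hl k).
under eq_bigr do rewrite !mxE.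
case: (odd k); case: (odd k') => /=.
- under eq_bigr do rewrite mulrNN.
  by rewrite H r2; case: eqP.
- under eq_bigr do rewrite mulNr.
  rewrite sumrN H (eq_bigr (fun i => a k'./2 i * b k./2 i)) ?r4 ?mulr0 ?oppr0 // => i _.
  exact: mulrC.
- under eq_bigr do rewrite mulrN.
  by rewrite sumrN H r3 mulr0 oppr0.
- by rewrite H r1; case: eqP.
Qed.

Lemma real_frame_coords (p : {poly C}) : real_frame *m real_coords l p =
  \col_i complex.Re ((\sum_(k < (2 * l).+1) p`_k *: g k) 0 i).
Proof.
apply/colP => i; rewrite !mxE summxE ReS.
pose F k := (if odd k then - (s k./2 * b k./2 i) else s k./2 * a k./2 i) *
  ((if odd k then complex.Im p`_(k./2) else complex.Re p`_(k./2)) / s k./2).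
rewrite (eq_bigr (fun k : 'I__ => F k)); last by move=> k _; rewrite !mxE.
have -> : (4 * l).+2 = (2 * l).+1.*2 by rewrite doubleS -mul2n mulnA.
rewrite sum_pairs; apply: eq_bigr => j _.
rewrite mxE Re_mul /F /= odd_double doubleK uphalf_double /=.
have s0 : s j != 0 by rewrite gt_eqF // sqrtr_gt0 ltr0n bin_gt0 -ltnS.
by rewrite /a /b; field.
Qed.

End RealFrame.

(** * The standard map in coordinates *)

Section QuarterTurn.
Variables (R : realType).

Lemma dot_ge0 m (x : 'cV[R]_m) : 0 <= dot x x.
Proof. by rewrite /dot mxE; apply: sumr_ge0 => i _; rewrite mxE -expr2 sqr_ge0. Qed.

Lemma dot_eq0 m (x : 'cV[R]_m) : dot x x = 0 -> x = 0.
Proof.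
rewrite /dot mxE => h; apply/colP => i; rewrite mxE.
have /psumr_eq0P : forall i, true -> 0 <= x^T 0 i * x i 0.
  by move=> j _; rewrite mxE -expr2 sqr_ge0.
by move=> /(_ h i isT); rewrite mxE -expr2 => /eqP; rewrite sqrf_eq0 => /eqP.
Qed.

Lemma dotZZ m a b (x y : 'cV[R]_m) : dot (a *: x) (b *: y) = a * b * dot x y.
Proof. by rewrite /dot trmx_scale -scalemxAl -scalemxAr scalerA mxE. Qed.

Lemma quarter_turnZ m a b (x y : 'cV[R]_m) :
  quarter_turn (a *: x) (b *: y) = (a * b) *: quarter_turn x y.
Proof.
rewrite /quarter_turn !trmx_scale -!scalemxAl -!scalemxAr !scalerA [b * a]mulrC.
by rewrite scalerBr.
Qed.

Lemma quarter_turnM m k (M : 'M[R]_(k, m)) (x y : 'cV[R]_m) :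
  quarter_turn (M *m x) (M *m y) = M *m quarter_turn x y *m M^T.
Proof. by rewrite /quarter_turn mulmxBr mulmxBl !trmx_mul !mulmxA. Qed.

Lemma quarter_turn_normalize m (x y : 'cV[R]_m) : dot y y = dot x x ->
  dot x x *: quarter_turn (normalize x) (normalize y) = quarter_turn x y.
Proof.
move=> yx; rewrite /normalize yx quarter_turnZ scalerA.
have := dot_ge0 x; rewrite le_eqVlt => /predU1P[h|h].
  by rewrite (dot_eq0 (esym h)) /quarter_turn trmx0 mulmx0 mul0mx subrr scaler0.
by rewrite -invfM -expr2 sqr_sqrtr ?ltW // divff ?gt_eqF // scale1r.
Qed.

End QuarterTurn.

Section Standard.
Variables (R : realType) (l : nat).
Notation C := R[i].
Implicit Types p : {poly C}.
Local Notation rc := (real_coords l).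

Definition form_turn p := quarter_turn (rc p) (rc ('i *: p)).
Definition form_norm p := dot (rc p) (rc p).

Lemma real_coordsZ (t : R) p : rc (t%:C *: p) = t *: rc p.
Proof.
apply/colP => k; rewrite !mxE coefZ; case: (p`__) => x y /=.
by case: odd; rewrite mul0r ?subr0 ?addr0 mulrA.
Qed.

Lemma form_norm_i p : dot (rc ('i *: p)) (rc ('i *: p)) = form_norm p.
Proof.
rewrite /form_norm !dot_real_coords; apply: eq_bigr => j _; congr (_ / _).
by rewrite coefZ; case: (p`_j) => x y /=; ring.
Qed.

Lemma form_turnZ (t : R) p : form_turn (t%:C *: p) = t ^+ 2 *: form_turn p.
Proof.
rewrite /form_turn real_coordsZ.
have -> : 'i *: (t%:C *: p) = t%:C *: ('i *: p) by rewrite !scalerA mulrC.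
by rewrite real_coordsZ quarter_turnZ expr2.
Qed.

Lemma form_normZ (t : R) p : form_norm (t%:C *: p) = t ^+ 2 * form_norm p.
Proof. by rewrite /form_norm real_coordsZ dotZZ expr2. Qed.

Lemma binary_formZ (a x y : C) :
  binary_form l (a * x) (a * y) = (a * conjc a) ^+ l *: binary_form l x y.
Proof.
have cM (u v : C) : conjc (u * v) = conjc u * conjc v by rewrite rmorphM.
rewrite /binary_form !cM.
have -> : (a * x)%:P + (a * y) *: 'X = a *: (x%:P + y *: 'X).
  by rewrite scalerDr scalerA polyCM mul_polyC.
have -> : (- (conjc a * conjc y))%:P + (conjc a * conjc x) *: 'X =
    conjc a *: ((- conjc y)%:P + conjc x *: 'X).
  by rewrite scalerDr scalerA -mulrN polyCM mul_polyC.
by rewrite !exprZn -scalerAl -scalerAr scalerA -exprMn.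
Qed.

Lemma norm_real (a : C) : a * conjc a = (complex.Re a ^+ 2 + complex.Im a ^+ 2)%:C.
Proof. by case: a => x y; apply: complexP => /=; ring. Qed.

(** The unitary matrix chosen over the line has a first column proportional to [x], which changes
    the form by a positive real factor, and quarter turns do not depend on scale. *)
Lemma standard_line (L : CP1 R) (x : 'cV[C]_2) : x != 0 -> <[x]>%VS = val L ->
  let p := binary_form l (x 0 0) (x 1 0) in
  form_norm p != 0 /\ form_norm p *: Jmx (standard_map l L) = form_turn p.
Proof.
move=> x0 xL p; have [hSU _] := SU2_of_lineP L; have [_ hdet] := hSU.
set v := vpick (val L).
have /vlineP[a va] : v \in <[x]>%VS by rewrite xL memv_pick.
pose r := (Num.sqrt (complex.Re (v 0 0) ^+ 2 + complex.Im (v 0 0) ^+ 2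
                      + complex.Re (v 1 0) ^+ 2 + complex.Im (v 1 0) ^+ 2))^-1.
have hE i j : SU2_of_line L i j = r%:C *
    (if j == 0 then v i 0 else if i == 0 then - (conjc (v 1 0)) else (conjc (v 0 0))).
  by rewrite /SU2_of_line /= mxE.
pose b := r%:C * a.
have w0E : weight0 l (SU2_of_line L) = (b * conjc b) ^+ l *: p.
  rewrite -binary_formZ /weight0 /binary_form !hE /= va !mxE.
  have rC : conjc r%:C = r%:C by apply: complexP => //=; rewrite oppr0.
  have cM (y u : C) : conjc (y * u) = conjc y * conjc u by rewrite rmorphM.
  by rewrite /b !cM rC mulrN !mulrA.
have b0 : b != 0.
  apply: contra_eq_neq hdet => b0.
  have h0 i : SU2_of_line L i 0 = 0 by rewrite hE /= va mxE mulrA -/b b0 mul0r.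
  by rewrite det2 !h0 mul0r mulr0 subr0 eq_sym oner_neq0.
set t := complex.Re b ^+ 2 + complex.Im b ^+ 2.
have t0 : t != 0.
  apply: contra b0 => /eqP t0; have := norm_real b; rewrite -/t t0 => /eqP.
  by rewrite mulf_eq0 conjc_eq0 orbb.
rewrite norm_real -/t -rmorphXn in w0E.
split.
  have [h1 _ _] := frame_orthonormal l hSU; apply: contra_eq_neq h1 => p0.
  rewrite /frame1 /normalize w0E dotZZ -/(form_norm _) form_normZ p0 !mulr0.
  by rewrite eq_sym oner_neq0.
have := quarter_turn_normalize (form_norm_i (weight0 l (SU2_of_line L))).
rewrite -/(form_norm _) -/(form_turn _) w0E form_normZ form_turnZ -w0E.
rewrite -[quarter_turn _ _]/(Jmx (standard_map l L)) -scalerA.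
by apply: scalerI; rewrite expf_neq0 // expf_neq0.
Qed.

End Standard.

(** * Comparison in an affine chart *)

(** The imaginary part of the Hermitian matrix U^* U. *)
Lemma hermitian_quarter_turn (R : realType) m (U : 'rV[R[i]]_m) (t : R) (K J : 'M[R]_m) :
  (map_mx conjc U)^T *m U =
    t%:C *: (map_mx (real_complex R) K + ii R *: map_mx (real_complex R) J) ->
  quarter_turn (\col_i complex.Re (U 0 i)) (\col_i complex.Re (('i *: U) 0 i)) = t *: J.
Proof.
move=> h; apply/matrixP => i j.
have := congr1 (fun M : 'M[R[i]]_m => complex.Im (M i j)) h; cbv beta.
rewrite !mxE !big_ord1 !mxE; case: (U 0 i) => a b; case: (U 0 j) => c d /= hh.
transitivity (a * d + - b * c); first by ring.
by rewrite hh; ring.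
Qed.

(** - J^2 and - K^2 are projectors of rank two; comparing their traces determines the scale
    without computing any norm. *)
Lemma quarter_turn_scaling (R : realType) (n m : nat) (J : Gr R n) (K : Gr R m)
    (O : 'M[R]_(n.+2, m.+2)) (k c : R) : 0 <= k -> 0 <= c -> O^T *m O = c%:M ->
  Jmx J = k *: (O *m Jmx K *m O^T) -> k * c = 1.
Proof.
move=> k0 c0 OO hJ.
have : \tr (piQ J) = (k * c) ^+ 2 * 2.
  rewrite -(piQ_trace K) /piQ hJ -scalemxAl -scalemxAr scalerA !raddfN /= mxtraceZ mulrN.
  rewrite -!mulmxA (mulmxA O^T) OO mul_scalar_mx -!scalemxAr mxtraceZ.
  rewrite mxtrace_mulC -!mulmxA OO mul_mx_scalar -scalemxAr mxtraceZ.
  by congr (- _); ring.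
rewrite piQ_trace => /esym/eqP; rewrite -subr_eq0 -[X in _ - X]mul1r -mulrBl mulf_eq0.
rewrite pnatr_eq0 orbF subr_eq0 => /eqP h.
have kc0 : 0 <= k * c by exact: mulr_ge0.
by apply/eqP; rewrite -(eqrXn2 (n := 2)) ?expr1n ?h.
Qed.

Section Frame.
Variables (R : realType) (n l : nat) (f : CP1 R -> Gr R n).
Hypotheses (f_mi : minimal_immersion f) (f_tr : totally_real f).
Hypotheses (f_EH : Einstein_Hermitian f) (f_l : EH_constant f 0 l).

(** The real frame maps the quarter turn of the form over z to a positive multiple of the quarter
    turn of the fibre, and [quarter_turn_scaling] normalizes it. *)
Theorem chart_frame : exists O : 'M[R]_(n.+2, (4 * l).+2), O^T *m O = 1%:M /\
  forall z, Jmx (f (chart 0 z)) = O *m Jmx (standard_map l (chart 0 z)) *m O^T.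
Proof.
have [g [gU g_iso g_orth g_norm]] := isotropic_line_normal_form f_mi f_tr f_EH f_l.
set O := real_frame l g; have OO := real_frame_gram g_iso g_orth g_norm.
set c := gram g / 2 in OO; have c0 : 0 <= c.
  rewrite /c /gram mulr_ge0 ?invr_ge0 // mxE.
  have ReS (I : finType) (F : I -> R[i]) : complex.Re (\sum_i F i) = \sum_i complex.Re (F i).
    by apply: (big_morph (@complex.Re R)) => // x y; exact: Re_add.
  rewrite ReS; apply: sumr_ge0 => i _; rewrite !mxE; case: (g 0%N 0 i) => x y /=.
  by rewrite mulrN opprK addr_ge0 // -expr2 sqr_ge0.
have key z : exists2 k, 0 <= k &
    Jmx (f (chart 0 z)) = k *: (O *m Jmx (standard_map l (chart 0 z)) *m O^T).
  pose p := binary_form l 1 (zeta z).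
  have a0 : affine 0 z 0 0 = 1 by rewrite mxE.
  have a1 : affine 0 z 1 0 = zeta z by rewrite mxE.
  have := standard_line (L := chart 0 z) l (affine_neq0 0 z) erefl.
  rewrite a0 a1 -/p => -[_ hs].
  have := hermitian_quarter_turn (gU z).
  have -> : 'i *: (\sum_(k < (2 * l).+1) p`_k *: g k) = \sum_(k < (2 * l).+1) ('i *: p)`_k *: g k.
    by rewrite scaler_sumr; apply: eq_bigr => k _; rewrite coefZ scalerA.
  rewrite -!real_frame_coords quarter_turnM -/O -[quarter_turn _ _]/(form_turn l p) -hs.
  set Q := (1 + rsq z) ^+ _ => h.
  have Q0 : 0 < Q by rewrite exprn_gt0 // rsqE ltr_pwDl // addr_ge0 ?sqr_ge0.
  exists (form_norm l p / Q); first by rewrite divr_ge0 ?dot_ge0 // ltW.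
  have -> : Jmx (f (chart 0 z)) = Q^-1 *: (Q *: Jmx (f (chart 0 z))).
    by rewrite scalerA mulVf ?scale1r // gt_eqF.
  by rewrite -[Jmx (f _)]/(Jmx (local f 0 z)) -h -scalemxAr -scalemxAl scalerA mulrC.
have kc z k : 0 <= k -> Jmx (f (chart 0 z)) = k *: (O *m Jmx (standard_map l (chart 0 z)) *m O^T) ->
    k * c = 1.
  by move=> k0; exact: quarter_turn_scaling.
have cp : 0 < c.
  have [k k0 hk] := key 0; have := kc 0 k k0 hk.
  by move: c0; rewrite le_eqVlt => /predU1P[<-|//]; rewrite mulr0 => /esym/eqP; rewrite oner_eq0.
exists ((Num.sqrt c)^-1 *: O).
have ss : (Num.sqrt c)^-1 * (Num.sqrt c)^-1 = c^-1.
  by rewrite -invfM -expr2 sqr_sqrtr ?ltW.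
split=> [|z].
  by rewrite trmx_scale -scalemxAl -scalemxAr scalerA ss OO scale_scalar_mx mulVf ?gt_eqF.
have [k k0 hk] := key z; have h := kc z k k0 hk.
rewrite trmx_scale -!scalemxAl -scalemxAr scalerA ss hk; congr (_ *: _).
by rewrite -[c^-1]mul1r -h mulfK ?gt_eqF.
Qed.

End Frame.

(** * Comparison at infinity *)

Section Infinity.
Variable R : realType.
Notation T := 'rV[R]_2.
Notation S := (smooth_fun R).
Notation C := R[i].

(** Points off 0 accumulate at 0 in the plane. *)
Lemma continuous_eq0 (g : T -> R^o) : {for 0, continuous g} ->
  (forall z, z != 0 -> g z = 0) -> g 0 = 0.
Proof.
move=> cg h; apply/eqP; apply/negP => /negP g0.
have e0 : 0 < `|g 0| by rewrite normr_gt0.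
have /cvgrPdist_lt/(_ _ e0)/nbhs_ballP[d /= d0 H] := cg.
pose y : T := (d / 2) *: dz R 0.
have y00 : y 0 0 = d / 2 by rewrite !mxE /= mulr1.
have d2 : 0 < d / 2 by rewrite divr_gt0.
have y0 : y != 0.
  by apply: contraTneq d2 => y0; rewrite -y00 y0 mxE ltxx.
suff /H : ball (0 : T) d y by rewrite /= (h y y0) subr0 ltxx.
rewrite -ball_normE /= sub0r normrN /y normrZ gtr0_norm //.
have -> : `|dz R 0| = 1 :> R.
  rewrite [LHS]/Num.Def.normr /= mx_normrE; apply/eqP; rewrite eq_le; apply/andP; split.
    by apply/bigmax_leP; split=> // i _; rewrite mxE; case: eqP; case: eqP; rewrite ?normr1 ?normr0.
  apply: le_trans (le_bigmax _ _ (0, 0)); by rewrite mxE /= normr1.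
by rewrite mulr1 ltr_pdivrMr // mulr_natr mulr2n ltrDl.
Qed.

Lemma ev0_eq (u v : S) : (forall z, z != 0 -> ev z u = ev z v) -> ev 0 u = ev 0 v.
Proof.
move=> h; apply/eqP; rewrite -subr_eq0; apply/eqP; rewrite -evB.
have uv0 z : z != 0 -> ev z (u - v) = 0 by move=> z0; rewrite evB h // subrr.
apply: complexP.
- apply: (@continuous_eq0 (reS (u - v))); last first.
    by move=> z /uv0 e; exact: (congr1 (@complex.Re R) e).
  by apply: differentiable_continuous; exact: (smooth_diffble (smooth_reS _)).
- apply: (@continuous_eq0 (imS (u - v))); last first.
    by move=> z /uv0 e; exact: (congr1 (@complex.Im R) e).
  by apply: differentiable_continuous; exact: (smooth_diffble (smooth_imS _)).
Qed.

Lemma lifts_at0 m k (AS BS : 'M[S]_(m, k)) M M' : lifts AS M -> lifts BS M' ->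
  (forall z, z != 0 -> M z = M' z) -> M 0 = M' 0.
Proof.
move=> hA hB h; apply/matrixP => i j.
have e : ev 0 (AS i j) = ev 0 (BS i j) by apply: ev0_eq => z z0; rewrite hA hB h.
by move: e; rewrite hA hB => /(congr1 (@complex.Re R)).
Qed.

Lemma lifts_cst m k (M : 'M[R]_(m, k)) :
  lifts (map_mx (fun x => cS x%:C) M) (fun=> M).
Proof. by move=> z i j; rewrite mxE. Qed.

Definition reC (u : S) : S := cS (half R) * (u + conjS u).
Definition imC (u : S) : S := cS (- (half R * ii R)) * (u - conjS u).

Lemma ev_reC z u : ev z (reC u) = (complex.Re (ev z u))%:C.
Proof.
rewrite /reC evM ev_cS evD ev_conjS; case: (ev z u) => x y.
by apply: complexP => /=; field.
Qed.

Lemma ev_imC z u : ev z (imC u) = (complex.Im (ev z u))%:C.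
Proof.
rewrite /imC evM ev_cS evB ev_conjS; case: (ev z u) => x y.
by apply: complexP => /=; field.
Qed.

Variable l : nat.

Definition coordsS (q : nat -> S) : 'cV[S]_(4 * l).+2 :=
  \col_k (cS ((Num.sqrt ('C(2 * l, k./2)%:R))^-1)%:C *
    (if odd k then imC (q k./2) else reC (q k./2))).

Lemma lifts_coords q (P : T -> {poly C}) : (forall z k, ev z (q k) = (P z)`_k) ->
  lifts (coordsS q) (fun z => real_coords l (P z)).
Proof.
move=> h z i j; rewrite !mxE evM ev_cS mulrC rmorphM; congr (_ * _).
by case: odd; rewrite ?ev_imC ?ev_reC h.
Qed.

(** The form defining the standard map over the line of (z, 1), with coefficients in the ring of
    smooth functions. *)
Definition formS : {poly S} :=
  ((zS R)%:P + 'X) ^+ l * ((- 1)%:P + conjS (zS R) *: 'X) ^+ l.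

Lemma ev_formS z k : ev z (formS`_k) = (binary_form l (zeta z) 1)`_k.
Proof.
rewrite -[LHS]/((ev z) _) -coef_map /formS /binary_form.
apply: (congr1 (fun p : {poly C} => p`_k)); rewrite rmorphM !rmorphXn.
congr (_ ^+ _ * _ ^+ _).
  by rewrite rmorphD /= map_polyC map_polyX scale1r.
rewrite rmorphD /= map_polyC map_polyZ map_polyX rmorphN rmorph1.
by rewrite -[X in _ = (- X)%:P + _]/(conjc 1) rmorph1 polyCN.
Qed.

(** Multiplied by the squared norm of the form, both sides are smooth in the chart at infinity,
    and this norm does not vanish at its origin. *)
Lemma quarter_turn_at_infinity m (J : T -> 'M[R]_m) (JS : 'M[S]_m) (O : 'M[R]_(m, (4 * l).+2)) : lifts JS J ->
  (forall z, z != 0 -> J z = O *m Jmx (standard_map l (chart 1 z)) *m O^T) ->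
  J 0 = O *m Jmx (standard_map l (chart 1 0)) *m O^T.
Proof.
move=> hJ h; pose p (z : T) := binary_form l (zeta z) 1.
have std z : form_norm l (p z) != 0 /\
    form_norm l (p z) *: Jmx (standard_map l (chart 1 z)) = form_turn l (p z).
  have := standard_line (L := chart 1 z) l (affine_neq0 1 z) erefl.
  by rewrite /= !mxE /=.
pose XS := coordsS (fun k => formS`_k).
pose YS := coordsS (fun k => cS 'i * formS`_k).
have hX : lifts XS (fun z => real_coords l (p z)) by apply: lifts_coords => z k; exact: ev_formS.
have hY : lifts YS (fun z => real_coords l ('i *: p z)).
  by apply: lifts_coords => z k; rewrite coefZ evM ev_cS ev_formS.
have hT : lifts (YS *m XS^T + - (XS *m YS^T)) (fun z => form_turn l (p z)).
  exact (lifts_add (lifts_mul hY (lifts_tr hX)) (lifts_opp (lifts_mul hX (lifts_tr hY)))).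
have hN z : ev z ((XS^T *m XS) 0 0) = (form_norm l (p z))%:C.
  exact: (lifts_mul (lifts_tr hX) hX z 0 0).
have L1 := lifts_scale hJ hN.
have L2 := lifts_mul (lifts_mul (lifts_cst O) hT) (lifts_tr (lifts_cst O)).
have E z : form_norm l (p z) *: (O *m Jmx (standard_map l (chart 1 z)) *m O^T) =
   O *m form_turn l (p z) *m O^T.
  by rewrite -(std z).2 -scalemxAr -scalemxAl.
have := lifts_at0 L1 L2 (fun z z0 => etrans (congr1 _ (h z z0)) (E z)).
by rewrite /= -E; apply: scalerI; exact: (std 0).1.
Qed.

End Infinity.

(** * Conjugation by an orthogonal matrix *)

Lemma Gr_inj (R : realType) (n : nat) (J K : Gr R n) : Jmx J = Jmx K -> J = K.
Proof.
case: J K => [J hJ] [K hK] /= e; case: _ / e hK => hK.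
by congr MkGr; exact: Prop_irrelevance.
Qed.

Section LinearMatrix.
Variables (R : realType) (m n p q : nat).
Implicit Type L : {linear 'M[R]_(m.+1, n.+1) -> 'M[R]_(p.+1, q.+1)}.

Lemma linear_mx_continuous L : continuous L.
Proof.
have E : (L : _ -> _) = fun N => \sum_i \sum_j N i j *: L (delta_mx i j).
  apply/funext => N; rewrite {1}(matrix_sum_delta N) linear_sum; apply: eq_bigr => i _.
  by rewrite linear_sum; apply: eq_bigr => j _; rewrite linearZ.
have CS (I : Type) (r : seq I) (F : I -> 'M[R]_(m.+1, n.+1) -> 'M[R]_(p.+1, q.+1)) :
    (forall i, continuous (F i)) -> continuous (fun N => \sum_(i <- r) F i N).
  move=> h; elim: r => [|i r IH] N.
    by under eq_fun do rewrite big_nil; exact: cst_continuous.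
  under eq_fun do rewrite big_cons.
  exact: continuousD (h i N) (IH N).
rewrite E; apply: (CS) => i; apply: (CS) => j N.
exact: continuousZr_tmp (@coord_continuous R m.+1 n.+1 i j N).
Qed.

Lemma derive_linear L (G : R^o -> 'M[R]_(m.+1, n.+1)) (t : R^o) : derivable G t 1 ->
  'D_1 (fun s => L (G s)) t = L ('D_1 G t).
Proof.
move=> /derivable1_diffP dG; have cL := linear_mx_continuous (L := L).
have dL : differentiable L (G t) by exact: linear_differentiable.
have dLG : differentiable (L \o G) t by apply: differentiable_comp.
rewrite -[LHS]/('D_1 (L \o G) t) (deriveE _ dLG) (deriveE _ dG) (diff_comp dG dL) /=.
by rewrite diff_lin.
Qed.

End LinearMatrix.

Section Conjugation.
Variables (R : realType) (n : nat) (A : 'M[R]_n.+2).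
Hypothesis AA : A^T *m A = 1%:M.

Definition conjmx M := A *m M *m A^T.
Lemma conjmx_linear : linear conjmx.
Proof.
by move=> a M N; rewrite /conjmx mulmxDr mulmxDl -scalemxAr -scalemxAl.
Qed.
HB.instance Definition _ := GRing.isLinear.Build R 'M[R]_n.+2 'M[R]_n.+2 _ conjmx conjmx_linear.

Lemma conjmxM M N : conjmx (M *m N) = conjmx M *m conjmx N.
Proof. by rewrite /conjmx !mulmxA -[A *m M *m A^T *m A]mulmxA AA mulmx1. Qed.

Lemma conjmx1 : conjmx 1%:M = 1%:M.
Proof. by rewrite /conjmx mulmx1; exact: mulmx1C. Qed.

Lemma conj_Gr_proof (J : Gr R n) : exists e1 e2 : 'cV[R]_n.+2,
  orthonormal2 e1 e2 /\ conjmx (Jmx J) = quarter_turn e1 e2.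
Proof.
have [e1 [e2 [[h1 h2 h3] ->]]] := GrP J; exists (A *m e1), (A *m e2).
split; last by rewrite quarter_turnM.
have D u v : dot (A *m u) (A *m v) = dot u v.
  by rewrite /dot trmx_mul -!mulmxA (mulmxA A^T) AA mul1mx.
by split; rewrite D.
Qed.
Definition conj_Gr (J : Gr R n) : Gr R n := MkGr (conj_Gr_proof J).

Lemma piQ_conj J : piQ (conj_Gr J) = conjmx (piQ J).
Proof. by rewrite /piQ raddfN /= conjmxM. Qed.

Lemma piS_conj J : piS (conj_Gr J) = conjmx (piS J).
Proof. by rewrite /piS raddfB /= conjmx1 piQ_conj. Qed.

Lemma smooth_conj_Gr : smooth_Gr conj_Gr.
Proof.
move=> J; exists setT, conjmx; split=> //; first exact: openT.
by move=> k; apply: Ck_linear; exact: linear_mx_continuous.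
Qed.

Lemma piS_derivable (g : R^o -> Gr R n) (t : R^o) : smooth_family g ->
  derivable (fun s => piS (g s)) t 1.
Proof.
move=> sg; apply/derivable_mxP => i j.
have E : (fun s => piS (g s) i j : R^o) =
    cst ((1%:M : 'M[R]_n.+2) i j) + \sum_k ((fun s => Jmx (g s) i k : R^o) * (fun s => Jmx (g s) k j : R^o)).
  apply/funext => s; rewrite /piS /piQ opprK [LHS]mxE [X in _ + X]mxE.
  by rewrite [RHS]/(_ + _) fct_sumE.
rewrite E; apply: diff_derivable.
suff [h _] : Ck setT 1 (cst ((1%:M : 'M[R]_n.+2) i j) + \sum_k ((fun s => Jmx (g s) i k : R^o) * (fun s => Jmx (g s) k j : R^o)) : R^o -> R^o) by exact: h.
apply: CkD; first exact: Ck_cst.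
elim/big_ind: _ => [|u v|k _]; [exact: Ck_cst|exact: CkD|].
by apply: CkM; exact: Ck_mx (sg 1%N).
Qed.

Lemma Hform_conj g : smooth_family g ->
  Hform (conj_Gr \o g : R^o -> _) 0 1 = conjmx (Hform (g : R^o -> _) 0 1).
Proof.
move=> sg; rewrite /Hform !conjmxM -piQ_conj -piS_conj; congr (_ *m _ *m _).
have E : (fun s => piS ((conj_Gr \o g) s)) = (fun s => conjmx (piS (g s))).
  by apply/funext => s; exact: piS_conj.
exact: etrans (congr1 (fun G : R^o -> 'M[R]_n.+2 => 'D_1 G 0) E)
  (derive_linear conjmx (piS_derivable (t := 0) sg)).
Qed.

Lemma preserves_metric_conj_Gr : preserves_metric conj_Gr.
Proof.
move=> g1 g2 s1 s2 _; rewrite !Hform_conj // /hom_dot.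
have tr M : (conjmx M)^T = conjmx M^T by rewrite /conjmx !trmx_mul trmxK mulmxA.
rewrite tr -conjmxM /conjmx mxtrace_mulC.
by rewrite (mulmxA A^T) AA mul1mx.
Qed.

End Conjugation.

(** Conjugation by an orthogonal matrix is linear, preserves traces, and takes the differential
    [Hform] of a family of planes to that of the moved family. *)
Lemma isometry_conj_Gr (R : realType) (n : nat) (A : 'M[R]_n.+2) (AA : A^T *m A = 1%:M) :
  isometry_Gr (conj_Gr AA).
Proof.
have AA' : A^T^T *m A^T = 1%:M by rewrite trmxK; exact: mulmx1C.
split; [|exact: smooth_conj_Gr|exact: preserves_metric_conj_Gr].
exists (conj_Gr AA'); split; last exact: smooth_conj_Gr.
- move=> J; apply: Gr_inj; rewrite /= /conjmx trmxK !mulmxA AA mul1mx.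
  by rewrite -mulmxA AA mulmx1.
- move=> J; apply: Gr_inj; rewrite /= /conjmx trmxK !mulmxA -{1}[A]trmxK AA' mul1mx.
  by rewrite -mulmxA -{1}[A]trmxK AA' mulmx1.
Qed.

(** * Comparison with the standard map *)

Lemma CP1_cover (R : realType) (L : CP1 R) : (exists z, L = chart 0 z) \/ L = chart 1 0.
Proof.
have lineE (v x : 'cV[R[i]]_2) (a : R[i]) : v != 0 -> x != 0 -> v = a *: x ->
    <[v]>%VS = <[x]>%VS.
  move=> v0 x0 va; apply/eqP; rewrite eqEdim -memvE {1}va memvZ ?memv_line //=.
  by rewrite !dim_vline v0 x0.
set v := vpick (val L).
have vL : val L = <[v]>%VS.
  apply/esym/eqP; rewrite eqEdim -memvE memv_pick (eqP (valP L)) dim_vline.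
  by rewrite vpick0 -dimv_eq0 (eqP (valP L)).
have v0 : v != 0 by rewrite vpick0 -dimv_eq0 (eqP (valP L)).
have [a0|a0] := eqVneq (v 0 0) 0.
  right; apply: val_inj; rewrite vL /=; apply: (lineE _ _ (v 1 0)) => //.
    exact: affine_neq0.
  apply/colP => i; rewrite !mxE; case: (ord2P i) => -> /=; last by rewrite mulr1.
  by rewrite a0 mulr0.
left; pose b := v 1 0 / v 0 0.
exists (\row_j (if j == 0 then complex.Re b else complex.Im b)).
apply: val_inj; rewrite vL /=; apply: (lineE _ _ (v 0 0)) => //.
  exact: affine_neq0.
apply/colP => i; rewrite !mxE; case: (ord2P i) => -> /=; first by rewrite mulr1.
have -> : complex.Re b +i* complex.Im b = b by case: (b).
by rewrite /b mulrCA divff // mulr1.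
Qed.

Section Global.
Variables (R : realType) (n l : nat) (f : CP1 R -> Gr R n).
Hypotheses (f_mi : minimal_immersion f) (f_tr : totally_real f).
Hypotheses (f_EH : Einstein_Hermitian f) (f_l : EH_constant f 0 l).

Theorem global_frame : exists O : 'M[R]_(n.+2, (4 * l).+2), O^T *m O = 1%:M /\
  forall L, Jmx (f L) = O *m Jmx (standard_map l L) *m O^T.
Proof.
have [ O [OO hO]] := chart_frame f_mi f_tr f_EH f_l.
exists O; split=> // L; have [[z ->]|->] := CP1_cover L; first exact: hO.
have [f_smooth _ _] := f_mi.
apply: (quarter_turn_at_infinity (lifts_JS f_smooth 1)) => z z0.
by rewrite /local -(invTK z0) -chart_inv ?invT_neq0.
Qed.

End Global.

(** A vector killed by the transpose of O is orthogonal to all the planes of f. *)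
Lemma full_coisometry (R : realType) (n m : nat) (f : CP1 R -> Gr R n)
    (f0 : CP1 R -> Gr R m) (O : 'M[R]_(n.+2, m.+2)) :
  full f -> O^T *m O = 1%:M -> (forall L, Jmx (f L) = O *m Jmx (f0 L) *m O^T) ->
  O *m O^T = 1%:M.
Proof.
move=> f_full OO hO.
(* J = O J_0 O^T, so J^2 t = 0 as soon as O^T t = 0. *)
have ker (t : 'cV[R]_n.+2) : O^T *m t = 0 -> t = 0.
  move=> Ot; apply: f_full; apply/funext => p; rewrite mulmx0.
  by rewrite /piQ hO !mulNmx -!mulmxA Ot !mulmx0 oppr0.
have h : O^T *m (1%:M - O *m O^T) = 0 by rewrite mulmxBr mulmx1 mulmxA OO mul1mx subrr.
apply/esym/eqP; rewrite -subr_eq0; apply/eqP/matrixP => i j.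
have := ker (col j (1%:M - O *m O^T)).
rewrite colE mulmxA h mul0mx => /(_ erefl); rewrite -colE => /colP/(_ i).
by rewrite [col _ _ _ _]mxE => ->; rewrite !mxE.
Qed.

Theorem theorem7p1 (R : realType) (n l : nat) (f : CP1 R -> Gr R n)
  (f_minimal_immersion : minimal_immersion f)
  (f_totally_real : totally_real f)
  (f_full : full f)
  (f_EH : Einstein_Hermitian f)
  (f_degree : has_degree f 0)
  (f_EH_constant : EH_constant f 0 l) :
  exists n_eq : n = (4 * l)%N,
    image_equivalent (ecast m (CP1 R -> Gr R m) n_eq f) (@standard_map R l).
Proof.
have [ O [OO hO]] := global_frame f_minimal_immersion f_totally_real f_EH f_EH_constant.
have OO' := full_coisometry f_full OO hO.
have n_eq : n = (4 * l)%N.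
  by have := mulmx1_min OO; have := mulmx1_min OO'; lia.
subst n; exists erefl => /=.
have A : O^T^T *m O^T = 1%:M by rewrite trmxK.
exists (conj_Gr A); split; first exact: isometry_conj_Gr.
apply/funext => L; apply: Gr_inj; rewrite /= /conjmx hO trmxK.
by rewrite !mulmxA OO mul1mx -mulmxA OO mulmx1.
Qed.
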